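(* Let $\boldsymbol{A}\in\mathcal{DM}_{\rm loc}(\Omega)$, let $\lambda_1,\lambda_2:\Omega\to[0,1]$ be Borel functions and let $u\in BV^{\boldsymbol{A},\lambda_1}(\Omega)$. Let $E\subset\Omega$ be a Borel set such that $\chi_E\in BV^{u^{\lambda_1}\boldsymbol{A},\lambda_2}(\Omega)$ and $\operatorname{supp}(\chi_E^{\lambda_2}u^{\lambda_1}|\boldsymbol{A}|)\Subset\Omega$. Then $$\int_{E^1}u^{\lambda_1}\,d\,\mathrm{div}\boldsymbol{A}+\int_{\partial^*E}\lambda_2u^{\lambda_1}\,d\,\mathrm{div}\boldsymbol{A}+\int_{E^1}d(\boldsymbol{A},Du)_{\lambda_1}+\int_{\partial^*E}\lambda_2\,d(\boldsymbol{A},Du)_{\lambda_1}=-\int_{\partial^-E}d(u^{\lambda_1}\boldsymbol{A},D\chi_E)_{\lambda_2}.$$ In particular, if $\lambda:\Omega\to[0,1]$ is a Borel function, $u\in BV^{\boldsymbol{A},\lambda}(\Omega)$, $\chi_E\in BV^{u^\lambda\boldsymbol{A},0}(\Omega)$ and $\operatorname{supp}(\chi_E^-u^\lambda|\boldsymbol{A}|)\Subset\Omega$, then $$\int_{E^1}u^\lambda\,d\,\mathrm{div}\boldsymbol{A}+\int_{E^1}d(\boldsymbol{A},Du)_\lambda=-\int_{\partial^-E}d(u^\lambda\boldsymbol{A},D\chi_E)_0;$$ while, if $u\in BV^{\boldsymbol{A},\lambda}(\Omega)$, $\chi_E\in BV^{u^\lambda\boldsymbol{A},1}(\Omega)$ and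 $\operatorname{supp}(\chi_E^+u^\lambda|\boldsymbol{A}|)\Subset\Omega$, then $$\int_{E^1\cup\partial^*E}u^\lambda\,d\,\mathrm{div}\boldsymbol{A}+\int_{E^1\cup\partial^*E}d(\boldsymbol{A},Du)_\lambda=-\int_{\partial^-E}d(u^\lambda\boldsymbol{A},D\chi_E)_1.$$
   Context: $\Omega\subset\mathbb{R}^N$ is a nonempty open set; $\mathscr{L}^N$ is Lebesgue measure. $\mathcal{M}(\Omega)$, $\mathcal{M}_{\rm loc}(\Omega)$ are the finite, respectively locally finite, (signed) Radon measures on $\Omega$, $\mathcal{M}_{\rm loc}(\Omega;\mathbb{R}^N)$ the vector-valued version; $|\mu|$ is the total variation, $\operatorname{supp}$ the (closed) support of a measure. $F\Subset\Omega$ means that $\overline F$ is bounded and $\overline F\subset\Omega$. $\mathscr{B}(\Omega)$ is the set of Borel functions $u:\Omega\to\mathbb{R}$ modulo $\mathscr{L}^N$-a.e. equality. Density: $D(E;x):=\lim_{r\to0^+}\mathscr{L}^N(E\cap B_r(x))/\mathscr{L}^N(B_r(x))$ when it exists. $E^1:=\{x:D(E;x)=1\}$, $\partial^*E:=\mathbb{R}^N\setminus(E^1\cup(\mathbb{R}^N\setminus E)^1)$, $\partial^-E:=\{x\in\mathbb{R}^N:0<\mathscr{L}^N(E\cap B_r(x))<\mathscr{L}^N(B_r(x))\ \forall r>0\}$. Integrals over these sets of measures on $\Omega$ are over the intersection with $\Omega$. For $u\in\mathscr{B}(\Omega)$, for every $x\in\Omega$, $$u^-(x):=\sup\{t\in\overline{\mathbb{R}}:D(\{u<t\};x)=0\},\quad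 u^+(x):=\inf\{t\in\overline{\mathbb{R}}:D(\{u>t\};x)=0\},$$ $Z_u:=\{u^+=+\infty,\ u^-=-\infty\}$. For a Borel $\lambda:\Omega\to[0,1]$ set $u^\lambda:=(1-\lambda)u^-+\lambda u^+$ on $\Omega\setminus Z_u$ (with $0\cdot(\pm\infty)=0$), and on $Z_u$: $u^\lambda:=+\infty,\,0,\,-\infty$ according to $\lambda>\frac12$, $\lambda=\frac12$, $\lambda<\frac12$. In particular $\chi_E^\lambda=\chi_{E^1}+\lambda\chi_{\partial^*E}$, $\chi_E^-=\chi_{E^1}$, $\chi_E^+=\chi_{E^1\cup\partial^*E}$. $\mathcal{DM}_{\rm loc}(\Omega)$ is the set of $\boldsymbol{A}\in\mathcal{M}_{\rm loc}(\Omega;\mathbb{R}^N)$ with distributional divergence $\mathrm{div}\boldsymbol{A}\in\mathcal{M}_{\rm loc}(\Omega)$. $X^{\boldsymbol{A},\lambda}(\Omega):=\{u\in\mathscr{B}(\Omega):u^\lambda\in L^1(\Omega,|\boldsymbol{A}|)\cap L^1(\Omega,|\mathrm{div}\boldsymbol{A}|)\}$. For $u\in X^{\boldsymbol{A},\lambda}(\Omega)$ the $\lambda$-pairing is the distribution $$\langle(\boldsymbol{A},Du)_\lambda,\varphi\rangle:=-\int_\Omega u^\lambda\varphi\,d\,\mathrm{div}\boldsymbol{A}-\int_\Omega u^\lambda\nabla\varphi\cdot d\boldsymbol{A},\qquad\varphi\in C_c^\infty(\Omega).$$ $BV^{\boldsymbol{A},\lambda}(\Omega):=\{u\in X^{\boldsymbol{A},\lambda}(\Omega):(\boldsymbol{A},Du)_\lambda\in\mathcal{M}(\Omega)\}$.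 Subscripts/superscripts $0$ and $1$ mean $\lambda\equiv0$, $\lambda\equiv1$. If $u\in BV^{\boldsymbol{A},\lambda_1}(\Omega)$, then $u^{\lambda_1}\boldsymbol{A}\in\mathcal{DM}_{\rm loc}(\Omega)$. For such $u$ and for Borel functions $\lambda_1,\lambda_2:\Omega\to[0,1]$, $X^{u^{\lambda_1}\boldsymbol{A},\lambda_2}(\Omega):=\{v\in\mathscr{B}(\Omega):v^{\lambda_2}\in L^1(\Omega,|u^{\lambda_1}\boldsymbol{A}|)\cap L^1(\Omega,|\mathrm{div}(u^{\lambda_1}\boldsymbol{A})|)\}$; for $v\in X^{u^{\lambda_1}\boldsymbol{A},\lambda_2}(\Omega)$ the pairing $(u^{\lambda_1}\boldsymbol{A},Dv)_{\lambda_2}$ is the distribution $$\langle(u^{\lambda_1}\boldsymbol{A},Dv)_{\lambda_2},\varphi\rangle:=-\int_\Omega v^{\lambda_2}\varphi\,d\,\mathrm{div}(u^{\lambda_1}\boldsymbol{A})-\int_\Omega v^{\lambda_2}u^{\lambda_1}\nabla\varphi\cdot d\boldsymbol{A},\qquad\varphi\in C_c^\infty(\Omega);$$ and $BV^{u^{\lambda_1}\boldsymbol{A},\lambda_2}(\Omega):=\{v\in X^{u^{\lambda_1}\boldsymbol{A},\lambda_2}(\Omega):(u^{\lambda_1}\boldsymbol{A},Dv)_{\lambda_2}\in\mathcal{M}(\Omega)\}$. *)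

(* Defs.v *)
From HB Require Import structures.
From mathcomp Require Import all_boot all_order all_algebra.
From mathcomp Require Import all_classical all_reals all_analysis.

Set Implicit Arguments.
Unset Strict Implicit.
Unset Printing Implicit Defensive.

Import Order.TTheory GRing.Theory Num.Theory.
Import numFieldNormedType.Exports.

Local Open Scope classical_set_scope.
Local Open Scope ring_scope.

(* R^n is 'rV[R]_n. Its library norm is the max norm, which gives the usual
   topology and bounded sets; balls and lengths of vectors below use the
   Euclidean norm [enorm]. *)

HB.instance Definition _ (R : realType) (m n : nat) :=
  @isMeasurable.Build (sigma_display (@open 'M[R]_(m, n))) 'M[R]_(m, n)
    <<s @open 'M[R]_(m, n) >> (@sigma_algebra0 _ setT _)
    (@sigma_algebraC _ _) (@sigma_algebra_bigcup _ setT _).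

Section euclidean.
Context (R : realType) (N : nat).
Notation E := 'rV[R]_N.

Definition enorm (v : E) : R := Num.sqrt (\sum_i v 0 i ^+ 2).

Definition eball (x : E) (r : R) : set E := [set y | enorm (y - x) < r].

Definition basis_vec (i : 'I_N) : E := delta_mx 0 i.

Definition relcpt_in (O F : set E) : Prop :=
  bounded_set (closure F) /\ closure F `<=` O.

Fixpoint Ck (k : nat) (f : E -> R) : Prop :=
  if k is k'.+1 then
    continuous f /\
    forall i, (forall x, derivable f x (basis_vec i)) /\
              Ck k' ('D_(basis_vec i) f)
  else continuous f.

(* Functions on O are extended by 0 outside O. *)
Definition test_fun (O : set E) (phi : E -> R) : Prop :=
  [/\ forall k, Ck k phi,
      compact (closure [set x | phi x != 0]) &
      closure [set x | phi x != 0] `<=` O].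

End euclidean.

(* Lebesgue measure of a Borel set, as the iterated product L^1 x L^n; the
   recursive step is the library's [product_measure1]: L^n of the section of A
   at the first coordinate t, integrated in t. *)
Fixpoint lebN (R : realType) (n : nat) : set 'rV[R]_n -> \bar R :=
  if n is n'.+1 then
    fun A => (\int[@lebesgue_measure R]_t
      lebN [set v : 'rV[R]_n' | A (row_mx (const_mx t : 'rV[R]_1) v)])%E
  else fun A => \d_(0 : 'rV[R]_0) A.

Section density.
Context (R : realType) (N : nat).
Notation E := 'rV[R]_N.

Definition has_density (A : set E) (x : E) (d : R) : Prop :=
  fine (lebN (A `&` eball x r)) / fine (lebN (eball x r)) @[r --> 0^'+] --> d.

Definition density1 (A : set E) : set E := [set x | has_density A x 1].

Definition essbnd (A : set E) : set E :=
  ~` (density1 A `|` density1 (~` A)).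

Definition bndm (A : set E) : set E :=
  [set x | forall r : R, 0 < r ->
    (0 < lebN (A `&` eball x r))%E /\
    (lebN (A `&` eball x r) < lebN (eball x r))%E].

Definition uminus (O : set E) (u : E -> R) (x : E) : \bar R :=
  ereal_sup [set t : \bar R |
    has_density [set y | O y /\ ((u y)%:E < t)%E] x 0].

Definition uplus (O : set E) (u : E -> R) (x : E) : \bar R :=
  ereal_inf [set t : \bar R |
    has_density [set y | O y /\ (t < (u y)%:E)%E] x 0].

Definition ulam (O : set E) (lam : E -> R) (u : E -> R) (x : E) : \bar R :=
  if (uplus O u x == +oo%E) && (uminus O u x == -oo%E) then
    if 2^-1 < lam x then +oo%E else if lam x == 2^-1 then 0%E else -oo%E
  else ((1 - lam x)%:E * uminus O u x + (lam x)%:E * uplus O u x)%E.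

Definition borel01 (O : set E) (lam : E -> R) : Prop :=
  measurable_fun O lam /\ forall x, O x -> 0 <= lam x <= 1.

End density.

(* Radon measures on O. A locally finite signed (vector) Radon measure is a set
   function defined on the relatively compact Borel subsets of O that is a
   charge on each compact subset of O. It is represented by a function on all
   sets, whose values on the other sets are irrelevant: total variation,
   positive part and negative part only read it on [relcpt_borel O]. *)
Section radon.
Context (R : realType) (N : nat) (O : set 'rV[R]_N).
Notation E := 'rV[R]_N.

Definition relcpt_borel (F : set E) : Prop :=
  measurable F /\ relcpt_in O F.

Definition Mloc (mu : set E -> R) : Prop :=
  forall K : set E, compact K -> K `<=` O ->
    exists nu : {charge set E -> \bar R},
      forall B, measurable B -> nu B = (mu (B `&` K))%:E.

Definition vMloc (A : set E -> E) : Prop :=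
  forall i, Mloc (fun F => A F 0 i).

(* The families are contained in B instead of being partitions of B: for a Borel
   subset B of O the supremum is the same. *)
Definition meas_variation (V : Type) (nrm : V -> R) (mu : set E -> V)
    (B : set E) : \bar R :=
  ereal_sup [set (\sum_(0 <= k <oo) (nrm (mu (F k)))%:E)%E | F in
    [set F : nat -> set E | [/\ trivIset setT F,
       forall k, relcpt_borel (F k) & forall k, F k `<=` B]]].

Definition tv (mu : set E -> R) : set E -> \bar R :=
  meas_variation Num.norm mu.

Definition vtv (A : set E -> E) : set E -> \bar R :=
  meas_variation (@enorm R N) A.

Definition Mfin (mu : set E -> R) : Prop := Mloc mu /\ (tv mu O < +oo)%E.

(* Jordan decomposition, as suprema because mu F makes sense only for relatively
   compact Borel F. *)
Definition mpos (mu : set E -> R) (B : set E) : \bar R :=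
  ereal_sup [set (mu F)%:E | F in [set F | relcpt_borel F /\ F `<=` B]].

Definition mneg (mu : set E -> R) (B : set E) : \bar R :=
  ereal_sup [set (- mu F)%:E | F in [set F | relcpt_borel F /\ F `<=` B]].

Definition sint (mu : set E -> R) (D : set E) (f : E -> \bar R) : R :=
  fine (\int[mpos mu]_(x in D) f x)%E - fine (\int[mneg mu]_(x in D) f x)%E.

Definition vint (A : set E -> E) (D : set E) (f : 'I_N -> E -> \bar R) : R :=
  \sum_(i < N) sint (fun F => A F 0 i) D (f i).

Definition wmeasure (w : E -> \bar R) (A : set E -> E) (F : set E) : E :=
  \row_i sint (fun G => A G 0 i) F w.

(* the signed measure w |A| *)
Definition wvtv (w : E -> \bar R) (A : set E -> E) (F : set E) : R :=
  fine (\int[vtv A]_(x in F) w x)%E.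

Definition msupp (mu : set E -> R) : set E :=
  [set x | O x /\ forall V, open V -> V x -> (0 < tv mu V)%E].

(* Distributions are functionals on test functions, and [dmeasure T] is the
   Radon measure that represents T, if there is one: it is unique as a function
   on relatively compact Borel subsets of O. *)
Definition represents (mu : set E -> R) (T : (E -> R) -> R) : Prop :=
  forall phi, test_fun O phi -> T phi = sint mu O (EFin \o phi).

Definition dmeasure (T : (E -> R) -> R) : set E -> R :=
  get [set mu | Mloc mu /\ represents mu T].

Definition distr_div (A : set E -> E) (phi : E -> R) : R :=
  - vint A O (fun i => EFin \o 'D_(basis_vec R i) phi).

Definition DMloc (A : set E -> E) : Prop :=
  vMloc A /\ exists mu, Mloc mu /\ represents mu (distr_div A).

Definition divm (A : set E -> E) : set E -> R := dmeasure (distr_div A).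

Definition Xspace (A : set E -> E) (lam : E -> R) (u : E -> R) : Prop :=
  [/\ measurable_fun O u,
      (vtv A).-integrable O (ulam O lam u) &
      (tv (divm A)).-integrable O (ulam O lam u)].

Definition pairing (A : set E -> E) (lam : E -> R) (u : E -> R)
    (phi : E -> R) : R :=
  - sint (divm A) O (fun x => (ulam O lam u x * (phi x)%:E)%E)
  - vint A O (fun i x => (ulam O lam u x * ('D_(basis_vec R i) phi x)%:E)%E).

Definition BVspace (A : set E -> E) (lam : E -> R) (u : E -> R) : Prop :=
  Xspace A lam u /\ exists mu, Mfin mu /\ represents mu (pairing A lam u).

Definition pairm (A : set E -> E) (lam : E -> R) (u : E -> R) : set E -> R :=
  dmeasure (pairing A lam u).

End radon.

(* Main.v *)
(* Put B = u^λ1 A and c = χ_E^λ2.  The definition of the pairing (A, Du) says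
   div B = u^λ1 div A + (A, Du).  Testing (B, Dχ_E) with cutoffs that increase
   to 1 on Ω and equal 1 near the compact support of c u^λ1 |A| removes the
   gradient term, so the total mass of (B, Dχ_E) is - ∫ c d(div B).  Every point
   outside the measure-theoretic boundary of E has a neighbourhood where c is
   constantly 0 or 1, hence where (B, Dχ_E) vanishes, and
   c = χ_{E^1} + λ2 χ_{∂*E} splits the remaining integral. *)
From HB Require Import structures.
Require Import Defs.
From mathcomp Require Import all_boot all_order all_algebra.
From mathcomp Require Import all_classical all_reals all_analysis.
From mathcomp Require Import lebesgue_measure measurable_realfun.
From mathcomp Require Import ring lra.
Import Order.TTheory GRing.Theory Num.Theory.
Import numFieldNormedType.Exports.

Set Implicit Arguments.
Unset Strict Implicit.
Unset Printing Implicit Defensive.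

Local Open Scope classical_set_scope.
Local Open Scope ring_scope.

(** * Smooth functions *)

(** div A, div B and the pairings are chosen representing measures, so nothing can be computed from
    them directly. Each time a concrete set function is shown to represent the same distribution,
    and uniqueness identifies the two on relatively compact Borel sets. These sets determine the
    Jordan parts and hence all integrals. A signed integral is a difference of two integrals read
    through [fine], so its linearity and limit rules need integrability against both parts. The
    trace u^λ1 may be unbounded; products such as c φ u^λ1 are integrable because c and φ are
    bounded and u^λ1 is integrable on all of Ω. The cutoffs may tend to 1 because (A, Du) and (B,
    Dχ_E) are finite and u^λ1 is |div A|-integrable: this gives majorants on Ω. The gradient term
    disappears because, outside the closed support, c u^λ1 is zero almost everywhere for both Jordan
    parts of every component of A. This fact, and the vanishing of (B, Dχ_E) off ∂⁻E, are local;
    countably many rational cubes make them global. *)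

Section flat_functions.
Context {R : realType}.
Implicit Types (x : R) (n : nat).

(** The family is closed under differentiation: the derivative of [flat n] is
    [flat n.+2 - n * flat n.+1]. Smoothness of [flat 0] therefore follows by induction on the order
    of differentiability, for all [n] at once. *)
Definition flat n x : R := if 0 < x then x^-1 ^+ n * expR (- x^-1) else 0.

Lemma flat_ge0 n x : 0 <= flat n x.
Proof.
rewrite /flat; case: ifPn => // x0.
by rewrite mulr_ge0 ?expR_ge0// exprn_ge0// invr_ge0 ltW.
Qed.

Lemma flat_gt0 n x : 0 < x -> 0 < flat n x.
Proof. by move=> x0; rewrite /flat x0 mulr_gt0 ?expR_gt0// exprn_gt0// invr_gt0. Qed.

Lemma flat_le0 n x : x <= 0 -> flat n x = 0.
Proof. by rewrite /flat ltNge => ->. Qed.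

Lemma flat0_ndecr x y : x <= y -> flat 0 x <= flat 0 y.
Proof.
move=> xy; have [x0|x0] := leP x 0; first by rewrite flat_le0// flat_ge0.
have y0 := lt_le_trans x0 xy.
by rewrite /flat x0 y0 !expr0 !mul1r ler_expR lerN2 lef_pV2.
Qed.

(** A single term of the exponential series at 1/x bounds exp(-1/x) by (n+1)! x^(n+1). The bound is
    linear in x, so it makes [flat n] small near 0 for every [n]. *)
Lemma flat_le n x : flat n x <= n.+1`!%:R * `|x|.
Proof.
have [x0|x0] := leP x 0; first by rewrite flat_le0// mulr_ge0.
rewrite /flat x0 gtr0_norm// expRN ler_pdivrMr ?expR_gt0//.
have h : x^-1 ^+ n.+1 / n.+1`!%:R <= expR x^-1.
  by rewrite (le_trans _ (expR_ge1Dxn n _)) ?invr_ge0 ?(ltW x0)// lerDr.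
rewrite ler_pdivrMr in h; last by rewrite ltr0n fact_gt0.
rewrite (_ : x^-1 ^+ n = x * x^-1 ^+ n.+1); last first.
  by rewrite exprS mulrA divff ?mul1r// gt_eqF.
rewrite mulrAC mulrC ler_pM2r// mulrC; exact: h.
Qed.

Lemma flat_div n x : x^-1 * flat n x = flat n.+1 x.
Proof. by rewrite /flat; case: ifPn => _; rewrite ?mulr0// exprS mulrA. Qed.

Lemma is_derive_flat n x :
  is_derive x 1 (flat n) (flat n.+2 x - n%:R * flat n.+1 x).
Proof.
have [x0|x0|->] := ltgtP x 0.
- rewrite !flat_le0 ?(ltW x0)// mulr0 subr0.
  apply: (@near_eq_is_derive _ _ _ (cst 0)).
  near=> y; rewrite flat_le0//; apply: ltW; near: y.
  exact: lt_nbhsl.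
- suff H : is_derive x 1 (fun y => y^-1 ^+ n * expR (- y^-1))
      (flat n.+2 x - n%:R * flat n.+1 x).
    apply: (near_eq_is_derive _ H); near=> y.
    by rewrite /flat ifT//; near: y; exact: lt_nbhsr.
  have xn0 : x != 0 by rewrite gt_eqF.
  have di : is_derive x 1 (fun y : R => y^-1) (- x ^- 2).
    apply: DeriveDef; first exact: derivableV.
    by rewrite deriveV// derive_id [_ *: _]mulr1.
  have de : is_derive x 1 (fun y : R => expR (- y^-1)) (expR (- x^-1) * x ^- 2).
    have dni : is_derive x 1 (fun y : R => - y^-1) (x ^- 2).
      by rewrite -[x ^- 2]opprK; exact: is_deriveN.
    exact: (@is_derive1_comp _ expR (fun y => - y^-1) x _ _ (is_derive_expR _)).
  have dX : is_derive x 1 (fun y : R => y^-1 ^+ n)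
      (n%:R * x^-1 ^+ n.-1 * (- x ^- 2)).
    case: (n) => [|m].
      rewrite !mul0r (_ : (fun _ => _) = cst 1); first exact: is_derive_cst.
      by apply/funext => y; rewrite expr0.
    by rewrite (_ : (fun _ => _) = (fun y : R => y^-1) ^+ m.+1);
      [apply: is_deriveX | apply/funext => y; rewrite exprfctE].
  apply: (is_derive_eq (is_deriveM dX de)).
  rewrite /flat x0 /= [_ *: _]mulrC [X in _ + X]mulrC.
  rewrite -[x ^- 2]exprVn.
  by case: (n) => [|m] /=; rewrite !exprS; ring.
(* At 0 the difference quotient of [flat n] is [flat n.+1], which tends to 0 by [flat_le]. *)
- rewrite !flat_le0 ?mulr0 ?subr0//.
  have lim0 : h^-1 *: (flat n h - 0) @[h --> (0:R)^'] --> (0:R).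
    under eq_fun do rewrite subr0 [_ *: _]flat_div.
    apply/cvgr0Pnorm_le => e e0.
    have c0 : 0 < (n.+2`!%:R : R) by rewrite ltr0n fact_gt0.
    near=> h; rewrite ger0_norm ?flat_ge0//.
    rewrite (le_trans (flat_le _ _))// mulrC -ler_pdivlMr//.
    near: h; apply: dnbhs0_le; exact: divr_gt0.
  have E : (fun h : R => h^-1 *: ((flat n \o shift 0) (h *: 1) - flat n 0)) =
           (fun h : R => h^-1 *: (flat n h - 0)).
    apply/funext => h; rewrite /= addr0 [h *: 1]mulr1.
    by rewrite (flat_le0 n (lexx 0)).
  apply: DeriveDef.
    by rewrite /derivable E; apply/cvg_ex; exists 0.
  by rewrite /derive E; apply/cvg_lim.
Unshelve. all: by end_near. Qed.

Lemma flat_continuous n : continuous (flat n).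
Proof.
move=> x; apply/differentiable_continuous/derivable1_diffP.
exact: (@ex_derive _ _ _ _ _ _ _ (is_derive_flat n x)).
Qed.

End flat_functions.

Section smooth_functions.
Context {R : realType} {N : nat}.
Notation E := 'rV[R]_N.
Implicit Types (f g : E -> R) (x v : E) (k n : nat).

(** Restriction to the line t -> t v + x turns a directional derivative into an ordinary one, where
    the one-variable chain rule applies. *)
Lemma is_derive_comp1 (h : R -> R) f x v (dh df : R) :
  is_derive (f x) 1 h dh -> is_derive x v f df ->
  is_derive x v (h \o f) (dh * df).
Proof.
move=> [hd hE] [fd fE].
have line (g : E -> R) d : is_derive x v g d <->
    is_derive (0:R) 1 (fun t => g (t *: v + x)) d.
  have E0 : (fun h : R => h^-1 *: ((g \o shift x) (h *: v) - g x)) =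
    (fun h : R => h^-1 *: (((fun t => g (t *: v + x)) \o shift 0) (h *: 1)
       - g (0 *: v + x))).
    apply/funext => t; rewrite /= addr0 scale0r add0r.
    by rewrite [t *: 1]mulr1.
  split=> -[gd gE]; apply: DeriveDef; rewrite /derivable /derive.
  - by rewrite -E0.
  - by rewrite -E0.
  - by rewrite E0.
  - by rewrite E0.
have H := @is_derive1_comp _ h (fun t => f (t *: v + x)) 0 dh df.
apply/line; apply: H; first by rewrite scale0r add0r; split.
by apply/line; split.
Qed.

Lemma Ck_continuous k f : Ck k f -> continuous f.
Proof. by case: k => [//|k] []. Qed.

Lemma Ck_pred k f : Ck k.+1 f -> Ck k f.
Proof.
elim: k f => [f []//|k IH f [cf df]]; split=> // i.
by have [fd fC] := df i; split=> //; exact: IH.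
Qed.

Lemma Ck_cst k (c : R) : Ck k (cst c : E -> R).
Proof.
elim: k c => [|k IH] c /=; first by exact: cst_continuous.
split=> [|i]; first by exact: cst_continuous.
split=> [x|]; first exact: derivable_cst.
by rewrite (_ : 'D__ _ = cst 0)//; apply/funext => x; rewrite derive_cst.
Qed.

Lemma CkD k f g : Ck k f -> Ck k g -> Ck k (fun x => f x + g x).
Proof.
elim: k f g => [|k IH] f g.
  by move=> cf cg x; exact: (cvgD (cf x) (cg x)).
move=> [cf df] [cg dg]; split=> [x|i].
  by exact: (cvgD (cf x) (cg x)).
have [fd fC] := df i; have [gd gC] := dg i.
split=> [x|]; first exact: derivableD.
rewrite (_ : 'D__ _ = fun x => 'D_(basis_vec R i) f x + 'D_(basis_vec R i) g x).
  exact: IH.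
by apply/funext => x; rewrite -deriveD.
Qed.

Lemma CkM k f g : Ck k f -> Ck k g -> Ck k (fun x => f x * g x).
Proof.
elim: k f g => [|k IH] f g.
  by move=> cf cg x; exact: (cvgM (cf x) (cg x)).
move=> /[dup] Cf [cf df] /[dup] Cg [cg dg]; split=> [x|i].
  by exact: (cvgM (cf x) (cg x)).
have [fd fC] := df i; have [gd gC] := dg i.
split=> [x|]; first exact: derivableM.
rewrite (_ : 'D__ _ = fun x =>
    f x * 'D_(basis_vec R i) g x + g x * 'D_(basis_vec R i) f x).
  by apply: CkD; apply: IH => //; exact: Ck_pred.
by apply/funext => x; rewrite -[RHS](deriveM (fd x) (gd x)).
Qed.

Lemma Ck_coord k (i : 'I_N) : Ck k (fun x : E => x 0 i).
Proof.
have cont : continuous (fun x : E => x 0 i) by exact: coord_continuous.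
case: k => [//|k]; split=> // j.
have dE (x : E) : is_derive x (basis_vec R j) (fun x : E => x 0 i)
    ((basis_vec R j) 0 i).
  have lim : (fun h : R => h^-1 *: (((fun x : E => x 0 i) \o shift x)
      (h *: basis_vec R j) - x 0 i)) @ 0^' --> (basis_vec R j) 0 i.
    apply: cvg_near_cst; near=> h.
    rewrite /= !mxE addrK [_ *: _]mulrA mulVf ?mul1r//.
    by near: h; exact: nbhs_dnbhs_neq.
  by apply: DeriveDef; [apply/cvg_ex; eexists; exact: lim | exact/cvg_lim].
split=> [x|]; first by case: (dE x).
rewrite (_ : 'D__ _ = cst ((basis_vec R j) 0 i)); first exact: Ck_cst.
by apply/funext => x; case: (dE x).
Unshelve. all: by end_near. Qed.

Lemma Ck_flat k n f : Ck k f -> Ck k (flat n \o f).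
Proof.
elim: k n f => [|k IH] n f.
  by move=> cf x; apply: continuous_comp; [exact: cf|exact: flat_continuous].
move=> /[dup] Cf [cf df]; split=> [x|i].
  by apply: continuous_comp; [exact: cf|exact: flat_continuous].
have [fd fC] := df i.
have dE x := is_derive_comp1 (is_derive_flat n (f x)) (derivableP (fd x)).
split=> [x|]; first by case: (dE x).
rewrite (_ : 'D__ _ = fun x => (flat n.+2 (f x) + (- n%:R) * flat n.+1 (f x)) *
   'D_(basis_vec R i) f x); last first.
  by apply/funext => x; rewrite (@derive_val _ _ _ _ _ _ _ (dE x)) mulNr.
apply: CkM => //; apply: CkD; first by apply: IH; exact: Ck_pred.
by apply: CkM; [exact: Ck_cst|apply: IH; exact: Ck_pred].
Qed.

Lemma Ck_sum k (I : Type) (r : seq I) (F : I -> E -> R) :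
  (forall i, Ck k (F i)) -> Ck k (fun x => \sum_(i <- r) F i x).
Proof.
move=> CF; elim: r => [|i r IH].
  rewrite (_ : (fun _ => _) = cst 0); first exact: Ck_cst.
  by apply/funext => x; rewrite big_nil.
rewrite (_ : (fun _ => _) = fun x => F i x + \sum_(j <- r) F j x).
  exact: CkD.
by apply/funext => x; rewrite big_cons.
Qed.

Lemma Ck_prod k (I : Type) (r : seq I) (F : I -> E -> R) :
  (forall i, Ck k (F i)) -> Ck k (fun x => \prod_(i <- r) F i x).
Proof.
move=> CF; elim: r => [|i r IH].
  rewrite (_ : (fun _ => _) = cst 1); first exact: Ck_cst.
  by apply/funext => x; rewrite big_nil.
rewrite (_ : (fun _ => _) = fun x => F i x * \prod_(j <- r) F j x).
  exact: CkM.
by apply/funext => x; rewrite big_cons.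
Qed.

End smooth_functions.

(** * Cutoff functions *)

Definition cube {R : realType} {N : nat} (c : 'rV[R]_N) (r : R) : set 'rV[R]_N :=
  [set y | forall i, `|c 0 i - y 0 i| < r].

Lemma open_cube {R : realType} {N : nat} (c : 'rV[R]_N) (r : R) :
  0 < r -> open (cube c r).
Proof.
move=> r0; rewrite (_ : cube c r = ball c r); first exact: ball_open.
apply/seteqP; split=> [y h|y [_ h] i]; last exact: h.
by split=> // i0 i; rewrite (ord1 i0); exact: h.
Qed.

Section rational_cubes.
Context {R : realType} {N : nat}.
Notation E := 'rV[R]_N.
Implicit Types (x y : E) (U S : set E) (j k : nat).

(** A countable basis of cubes: [j] codes a rational centre and an n, the radius being 1/(n+1). A
    [j] that decodes to nothing yields the cube of radius 1 at 0, a harmless repetition. *)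
Definition qcode j : 'rV[rat]_N * nat := odflt (0, 0%N) (unpickle j).
Definition qctr j : E := map_mx ratr (qcode j).1.
Definition qrad j : R := (qcode j).2.+1%:R^-1.
Definition qcube j : set E := cube (qctr j) (qrad j).
Definition qccube j : set E := [set y | forall i, `|qctr j 0 i - y 0 i| <= qrad j].

Lemma qrad_gt0 j : 0 < qrad j. Proof. by rewrite /qrad invr_gt0. Qed.

Lemma qcube_ccube j : qcube j `<=` qccube j.
Proof. by move=> y h i; exact/ltW. Qed.

Lemma compact_qccube j : compact (qccube j).
Proof.
have := @rV_compact R N (fun i => `[qctr j 0 i - qrad j, qctr j 0 i + qrad j]%classic).
rewrite (_ : [set _ | _] = qccube j); last first.
  apply/seteqP; split=> y h i; have := h i => /=.
    by rewrite in_itv/= distrC ler_distl.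
  by rewrite in_itv/= distrC ler_distl.
by apply=> i; exact: segment_compact.
Qed.

Lemma open_qcube j : open (qcube j).
Proof. exact/open_cube/qrad_gt0. Qed.

Lemma qcube_basis U x : open U -> U x -> exists j, qcube j x /\ qccube j `<=` U.
Proof.
move=> oU Ux; have := open_nbhs_nbhs (conj oU Ux).
move=> /nbhs_ballP[e /= e0 xeU].
(* Half of [e], because the distance from [x] to a point of the cube is estimated through the
   centre, at the cost of one radius on each side. *)
have [n n0] : exists n, n.+1%:R^-1 < e / 2.
  have := @near_infty_natSinv_lt R (PosNum (divr_gt0 e0 (ltr0Sn R 1))).
  by case=> m _ /(_ m) /=; rewrite leqnn => /(_ isT) h; exists m.
have : 0 < n.+1%:R^-1 :> R by rewrite invr_gt0.
move: n0; set r : R := n.+1%:R^-1 => rlt r0.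
have H i : {q : rat | `|ratr q - x 0 i| < r}.
  apply: cid; have [|q] := @rat_in_itvoo R (x 0 i - r) (x 0 i + r).
    by rewrite ltrD2l (lt_trans _ r0)// oppr_lt0.
  by rewrite in_itv/= => h; exists q; rewrite ltr_distl.
pose q : 'rV[rat]_N := \row_i sval (H i).
exists (pickle (q, n)); rewrite /qcube /cube /qccube /qctr /qrad /qcode pickleK /=.
split=> [i|y yq]; first by rewrite !mxE; exact: (svalP (H i)).
apply: xeU; split=> // i0 i; rewrite (ord1 i0) /ball /=.
have := yq i; rewrite !mxE => h1; have /= h2 := svalP (H i).
rewrite (le_lt_trans (ler_distD (ratr (sval (H i))) _ _))//.
by rewrite (distrC (x 0 i)) (lt_le_trans (ltr_leD h2 h1))// -mulr2n -mulr_natr -ler_pdivlMr// ltW.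
Qed.

Lemma bigcup_qcube U : open U ->
  U = \bigcup_(j in [set j | qccube j `<=` U]) qcube j.
Proof.
move=> oU; apply/seteqP; split=> [x Ux|x [j jU xj]].
  by have [j [xj jU]] := qcube_basis oU Ux; exists j.
exact/jU/qcube_ccube.
Qed.

(** The product over the coordinates of exp(-1/(r^2 - t^2)), with t the distance to the centre in
    that coordinate: smooth, and positive exactly on the open cube. Differences are spelled with [+]
    and [(- 1) *] so that [CkD] and [CkM] apply. *)
Definition bump j x : R :=
  \prod_(i <- enum 'I_N) flat 0 (qrad j ^+ 2 + (- 1) * ((x 0 i + - qctr j 0 i) *
    (x 0 i + - qctr j 0 i))).

Lemma Ck_bump n j : Ck n (bump j).
Proof.
apply: Ck_prod => i; apply: (@Ck_flat _ _ _ 0 (fun x : E => qrad j ^+ 2 + (- 1) *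
  ((x 0 i + - qctr j 0 i) * (x 0 i + - qctr j 0 i)))).
have C1 : Ck n (fun x : E => x 0 i + - qctr j 0 i).
  by apply: CkD; [exact: Ck_coord|exact: Ck_cst].
apply: CkD; first exact: Ck_cst.
by apply: CkM; [exact: Ck_cst|exact: CkM].
Qed.

Lemma bump_ge0 j x : 0 <= bump j x.
Proof. by apply: prodr_ge0 => i _; exact: flat_ge0. Qed.

Let sqr_lt (a r : R) : 0 < r -> (0 < r ^+ 2 + (- 1) * (a * a)) = (`|a| < r).
Proof.
move=> r0; rewrite mulN1r subr_gt0 -expr2 -[a ^+ 2]real_normK ?num_real//.
by rewrite ltr_pXn2r// nnegrE// ltW.
Qed.

Lemma bump_gt0 j x : qcube j x -> 0 < bump j x.
Proof.
move=> xj; apply: prodr_gt0 => i _; apply: flat_gt0.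
by rewrite sqr_lt ?qrad_gt0// distrC.
Qed.

Lemma bump_neq0 j x : bump j x != 0 -> qcube j x.
Proof.
rewrite /bump prodf_seq_neq0 => /allP h i.
have /= := h i; rewrite mem_enum => /(_ isT).
rewrite distrC -sqr_lt ?qrad_gt0//; apply: contraNT; rewrite -leNgt => h'.
by rewrite flat_le0.
Qed.

End rational_cubes.

Section cutoff.
Context {R : realType} {N : nat}.
Notation E := 'rV[R]_N.
Variable U : set E.

(** Each partial sum vanishes off a compact subset of [U]. The sums increase with [k], and at every
    point of an open [U] they are eventually positive. *)
Definition bumps (k : nat) (x : E) : R :=
  \sum_(j <- iota 0 k) (if `[< qccube j `<=` U >] then bump j else cst 0) x.

Lemma bumpsS k x : bumps k.+1 x = bumps k x +
  (if `[< qccube k `<=` U >] then bump k else cst 0) x.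
Proof. by rewrite /bumps -addn1 iotaD big_cat/= big_seq1 add0n. Qed.

Lemma bump_if_ge0 k (x : E) : 0 <= (if `[< qccube k `<=` U >] then bump k else cst 0) x.
Proof. by case: ifPn => // _; exact: bump_ge0. Qed.

Lemma bumps_ge0 k x : 0 <= bumps k x.
Proof. by apply: sumr_ge0 => j _; exact: bump_if_ge0. Qed.

Lemma bumps_ndecr (x : E) : {homo bumps^~ x : m n / (m <= n)%N >-> m <= n}.
Proof.
apply: homo_leq => [//|y z t|k]; first exact: le_trans.
by rewrite bumpsS lerDl; exact: bump_if_ge0.
Qed.

Lemma Ck_bumps n k : Ck n (bumps k).
Proof. by apply: Ck_sum => j; case: ifPn => _; [exact: Ck_bump|exact: Ck_cst]. Qed.

Lemma bumps_support k : exists K : set E, [/\ compact K, K `<=` U &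
  forall x, bumps k x != 0 -> K x].
Proof.
elim: k => [|k [K [cK KU KP]]].
  by exists set0; split => [||x]; [exact: compact0|by []|rewrite /bumps big_nil eqxx].
have [kU|kU] := pselect (qccube k `<=` U).
  exists (K `|` qccube k); split; first exact/compactU/compact_qccube.
    by move=> x [/KU|/kU].
  move=> x; rewrite bumpsS (asboolT kU).
  have [->|/KP ?] := eqVneq (bumps k x) 0; last by left.
  by rewrite add0r => /bump_neq0/qcube_ccube; right.
exists K; split=> // x; rewrite bumpsS (asboolF kU) addr0; exact: KP.
Qed.

Lemma bumps_pos x : open U -> U x -> exists k, 0 < bumps k x.
Proof.
move=> oU Ux; have [j [xj jU]] := qcube_basis oU Ux.
exists j.+1; rewrite bumpsS (asboolT jU).
by rewrite ltr_wpDl ?bumps_ge0// bump_gt0.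
Qed.

(** The threshold decreases while [bumps] increases, so these open sets are nested; they exhaust [U]
    when [U] is open. A compact subset of [U] therefore lies in a single one. *)
Definition plateau (k : nat) : set E := [set x | k.+1%:R^-1 < bumps k x].

Lemma plateau_ndecr m n : (m <= n)%N -> plateau m `<=` plateau n.
Proof.
rewrite /plateau => mn x /= h; rewrite (le_lt_trans _ (lt_le_trans h (bumps_ndecr _ mn)))//.
by rewrite lef_pV2 ?posrE ?ltr0n// ler_nat.
Qed.

Lemma plateau_cover x : open U -> U x -> exists k, plateau k x.
Proof.
move=> oU Ux; have [j j0] := bumps_pos oU Ux.
have := @near_infty_natSinv_lt R (PosNum j0).
case=> m _ /(_ (maxn j m)) /=; rewrite leq_maxr => /(_ isT) h; exists (maxn j m).
by rewrite /plateau /= (lt_le_trans h)//; apply: bumps_ndecr; exact: leq_maxl.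
Qed.

Lemma open_plateau k : open (plateau k).
Proof.
apply: (@open_comp _ _ (bumps k) [set y | k.+1%:R^-1 < y]).
  by move=> x _; exact: (Ck_continuous (Ck_bumps 0 k)).
exact: open_gt.
Qed.

(* 0 where [bumps k] vanishes and 1 where it is at least 1/(k+1). *)
Definition cutoff (k : nat) (x : E) : R :=
  1 + (- (flat 0 (k.+1%:R^-1))^-1) * flat 0 (k.+1%:R^-1 + (- 1) * bumps k x).

Let c0 k : 0 < (k.+1%:R^-1 : R). Proof. by rewrite invr_gt0. Qed.

Lemma Ck_cutoff n k : Ck n (cutoff k).
Proof.
apply: CkD; first exact: Ck_cst.
apply: CkM; first exact: Ck_cst.
apply: (@Ck_flat _ _ _ 0 (fun x => k.+1%:R^-1 + (- 1) * bumps k x)).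
apply: CkD; first exact: Ck_cst.
by apply: CkM; [exact: Ck_cst|exact: Ck_bumps].
Qed.

Lemma cutoff_itv k x : 0 <= cutoff k x <= 1.
Proof.
rewrite /cutoff mulN1r mulNr subr_ge0 gerBl; apply/andP; split.
  rewrite mulrC ler_pdivrMr ?flat_gt0// mul1r.
  by apply: flat0_ndecr; rewrite gerBl bumps_ge0.
by rewrite mulr_ge0 ?flat_ge0// invr_ge0 flat_ge0.
Qed.

Lemma cutoff1 k x : plateau k x -> cutoff k x = 1.
Proof.
move=> h; rewrite /cutoff mulN1r [X in _ * X]flat_le0 ?mulr0 ?addr0//.
by rewrite subr_le0 ltW.
Qed.

Lemma derive_cutoff k i x : plateau k x -> 'D_(basis_vec R i) (cutoff k) x = 0.
Proof.
move=> h.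
rewrite (@near_eq_derive _ _ _ (cutoff k) (cst 1)) ?derive_cst//.
have : nbhs x (plateau k) by apply: open_nbhs_nbhs; split => //; exact: open_plateau.
by apply: filterS => y /cutoff1.
Qed.

Lemma test_fun_cutoff k : test_fun U (cutoff k).
Proof.
have [K [cK KU KP]] := bumps_support k.
have sK : closure [set x | cutoff k x != 0] `<=` K.
  have : [set x | cutoff k x != 0] `<=` K.
    move=> x /= xn0; apply: KP; apply: contra_neq xn0 => b0.
    by rewrite /cutoff b0 mulr0 addr0 mulNr mulVf ?subrr// gt_eqF// flat_gt0.
  move/closureS => /subset_trans; apply.
  by rewrite -(closure_id K).1//; exact: (compact_closed (@norm_hausdorff _ _)).
split=> [n||]; first exact: Ck_cutoff.
  by apply: (subclosed_compact _ cK) => //; exact: closed_closure.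
exact: subset_trans KU.
Qed.

End cutoff.

Lemma compact_plateau {R : realType} {N : nat} (U S : set 'rV[R]_N) :
  open U -> compact S -> S `<=` U -> exists k, S `<=` plateau U k.
Proof.
move=> oU cS SU.
move: cS; rewrite compact_cover => /(_ nat setT (plateau U)).
case=> [k _|x Sx|D _ SD]; first exact: open_plateau.
  by have [k kx] := plateau_cover oU (SU x Sx); exists k.
exists (\max_(k <- finmap.enum_fset D) k)%N => x /SD[k /= kD].
exact/plateau_ndecr/(@leq_bigmax_seq _ _ xpredT id k).
Qed.

Lemma compact_open_between {R : realType} {N : nat} (U S : set 'rV[R]_N) :
  open U -> compact S -> S `<=` U -> exists W K : set 'rV[R]_N,
  [/\ open W, compact K, S `<=` W, W `<=` K & K `<=` U].
Proof.
move=> oU cS SU; have [k Sk] := compact_plateau oU cS SU.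
have [K [cK KU KP]] := bumps_support U k.
exists (plateau U k), K; split => //; first exact: open_plateau.
move=> x xk; apply: KP; rewrite gt_eqF// (lt_trans _ xk)//.
Qed.

(** [S] lies in one open plateau, of index [k0]. Starting the sequence at [k0] makes every member
    constant around [S], so the gradient vanishes on [S] for all [k], not only in the limit. *)
Lemma cutoff_exists {R : realType} {N : nat} (U S : set 'rV[R]_N) :
  open U -> compact S -> S `<=` U ->
  exists phi : nat -> 'rV[R]_N -> R,
  [/\ forall k, test_fun U (phi k),
      forall k x, 0 <= phi k x <= 1,
      forall x, U x -> \forall k \near \oo, phi k x = 1 &
      forall k i x, S x -> 'D_(basis_vec R i) (phi k) x = 0].
Proof.
move=> oU cS SU.
have [k0 Sk0] := compact_plateau oU cS SU.
exists (fun k => cutoff U (k0 + k)); split.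
- by move=> k; exact: test_fun_cutoff.
- by move=> k x; exact: cutoff_itv.
- move=> x Ux; have [m xm] := plateau_cover oU Ux.
  exists m => // k /= mk; apply: cutoff1; apply: plateau_ndecr xm.
  exact: leq_trans mk (leq_addl _ _).
- move=> k i x /Sk0 xk; apply: derive_cutoff; apply: plateau_ndecr xk.
  exact: leq_addr.
Qed.

(** * Measures with a density *)

Section density.
Local Open Scope ereal_scope.
Context d (T : measurableType d) (R : realType).
Variables (mu : {measure set T -> \bar R}) (g : T -> \bar R).
Hypotheses (mg : measurable_fun setT g) (g0 : forall x, 0 <= g x).

Lemma density_measure : exists m : {measure set T -> \bar R},
  forall A, m A = \int[mu]_(x in A) g x.
Proof.
pose nu (A : set T) := \int[mu]_(x in A) g x.
have nu0 : nu set0 = 0 by rewrite /nu integral_set0.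
have nuge0 A : 0 <= nu A by apply: integral_ge0 => x _; exact: g0.
have nus : semi_sigma_additive nu by exact: semi_sigma_additive_nng_induced.
pose M := isMeasure.Build d T R nu nu0 nuge0 nus.
pose m : {measure set T -> \bar R} := HB.pack nu M.
by exists m.
Qed.

Variable m : {measure set T -> \bar R}.
Hypothesis mE : forall A, m A = \int[mu]_(x in A) g x.

Import HBNNSimple.

Let cvg_nnsfunM (E : set T) (f : T -> \bar R) (mD : measurable E)
    (mf : measurable_fun E f) x : E x -> (forall x, E x -> 0 <= f x) ->
  ((nnsfun_approx mD mf n x)%:E * g x) @[n --> \oo] --> f x * g x.
Proof.
move=> Ex f0; have cf := cvg_nnsfun_approx mD mf f0 Ex.
have [gfin|] := boolP (g x \is a fin_num); first exact: cvgeZr.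
rewrite ge0_fin_numE// -leNgt leye_eq => /eqP gx.
(* Multiplication by +oo is not continuous at 0. If [f x] is 0, all approximants are 0; otherwise
   they are eventually positive, and the products are eventually +oo. *)
have [fx0|fx0] := eqVneq (f x) 0.
  rewrite fx0 mul0e; apply: cvg_near_cst; near=> n.
  have h : (nnsfun_approx mD mf n x)%:E <= f x.
    by rewrite nnsfun_approxE; exact: le_approx.
  rewrite (_ : (nnsfun_approx mD mf n x)%:E = 0) ?mul0e//.
  by move: h; rewrite fx0 => h; apply/eqP; rewrite eq_le h lee_fin/=.
have fx : 0 < f x by rewrite lt0e fx0 f0.
rewrite gx gt0_muley//; apply: cvg_near_cst.
have : \forall n \near \oo, 0 < (nnsfun_approx mD mf n x)%:E.
  by have := cf _ (open_ereal_gt' fx).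
by apply: filterS => n n0; rewrite gt0_muley.
Unshelve. all: by end_near. Qed.

(** For indicators this is [mE]. It extends to simple functions by linearity and to [f] by monotone
    convergence on both sides. *)
Lemma ge0_integral_density (f : T -> \bar R) E : measurable E ->
  measurable_fun E f -> (forall x, E x -> 0 <= f x) ->
  \int[m]_(x in E) f x = \int[mu]_(x in E) (f x * g x).
Proof.
move=> mD mf f0; pose h := nnsfun_approx mD mf.
have -> : \int[m]_(x in E) f x =
    lim (\int[m]_(x in E) (EFin \o h n) x @[n --> \oo]).
  have fE x : E x -> f x = lim ((EFin \o h n) x @[n --> \oo]).
    by move=> Ex; apply/esym/cvg_lim => //; exact: cvg_nnsfun_approx.
  under eq_integral => x /[!inE] /fE -> //.
  apply: monotone_convergence => //.
  - move=> n; apply/measurable_EFinP.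
    by apply: (measurable_funS measurableT) => //; exact/measurable_funP.
  - by move=> n x Ex //=; rewrite lee_fin.
  - by move=> x Ex a b ab; rewrite lee_fin; exact/lefP/nd_nnsfun_approx.
have -> : \int[mu]_(x in E) (f \* g) x =
    lim (\int[mu]_(x in E) ((EFin \o h n) \* g) x @[n --> \oo]).
  have fg x : E x -> f x * g x = lim (((EFin \o h n) \* g) x @[n --> \oo]).
    by move=> Ex; apply/esym/cvg_lim => //; exact: cvg_nnsfunM.
  under eq_integral => x /[!inE] /fg -> //.
  apply: monotone_convergence => [//| | |].
  - move=> n; apply/emeasurable_funM; apply/measurable_funTS => //.
    exact/measurable_EFinP.
  - by move=> n x Ex /=; rewrite mule_ge0 ?lee_fin.
  - move=> x Ex a b ab/=; rewrite lee_wpmul2r ?lee_fin//.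
    exact/lefP/nd_nnsfun_approx.
suff suf n : \int[mu]_(x in E) ((EFin \o h n) x * g x) =
    \int[m]_(x in E) (EFin \o h n) x.
  by congr (limn _); apply/funext => n; exact/esym/suf.
transitivity (\int[m]_(x in E)
   (\sum_(y \in range (h n)) (y * \1_(h n @^-1` [set y]) x)%:E)); last first.
  by apply: eq_integral => t tE; rewrite /= fimfunE -fsumEFin.
have indich k r : measurable_fun E (fun x => (r * \1_(h k @^-1` [set r]) x)%:E).
  by apply: (measurable_comp measurableT) => //; exact: measurable_funM.
rewrite ge0_integral_fsum//; last by move=> k y Ey; exact: nnfun_muleindic_ge0.
transitivity (\int[mu]_(x in E) (\sum_(y \in range (h n))
    (y * \1_(h n @^-1` [set y]) x)%:E * g x)).
  under [RHS]eq_integral => x xE.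
    rewrite -ge0_mule_fsuml => [|y]; last exact: nnfun_muleindic_ge0.
    rewrite fsumEFin // -(fimfunE _ x); over.
  by [].
rewrite ge0_integral_fsum//; last 2 first.
  - by move=> y; apply: emeasurable_funM => //; exact: measurable_funTS.
  - by move=> k y Ey; rewrite mule_ge0// nnfun_muleindic_ge0.
apply: eq_fsbigr => r rhn.
under [RHS]eq_integral do rewrite EFinM.
rewrite integralZl_indic_nnsfun => //.
under eq_integral do rewrite EFinM -muleA.
rewrite ge0_integralZl//.
- under eq_integral do rewrite muleC.
  rewrite (eq_integral (g \_ (h n @^-1` [set r]))); last first.
    by move=> x xE; rewrite epatch_indic.
  by rewrite -integral_mkcondr -mE integral_indic// setIC.
- apply: emeasurable_funM; first exact/measurable_EFinP.
  exact/measurable_funTS.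
- by move=> t Et; rewrite mule_ge0 ?lee_fin.
- by move: rhn; rewrite inE => -[t _ <-]; rewrite lee_fin.
Qed.

Lemma integral_density (f : T -> R) E : measurable E ->
  measurable_fun E f -> [bounded f x | x in E] -> mu.-integrable setT g ->
  m.-integrable E (EFin \o f) /\
  \int[m]_(x in E) (f x)%:E = \int[mu]_(x in E) ((f x)%:E * g x).
Proof.
move=> mD mf bf ig.
have mfE : measurable_fun E (EFin \o f) by exact/measurable_EFinP.
have mfin : m setT < +oo by rewrite mE; exact: integrable_lty.
have igE : mu.-integrable E g by exact: (integrableS measurableT).
have ifg : mu.-integrable E (fun x => (f x)%:E * g x) by exact: integrableMr.
split.
  apply: measurable_bounded_integrable => //.
  by rewrite (le_lt_trans _ mfin)// le_measure ?inE.
rewrite integralE ge0_integral_density//; last exact: measurable_funepos.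
rewrite ge0_integral_density//; last exact: measurable_funeneg.
(* Taking the positive part commutes with multiplication by a nonnegative factor, so the parts of f
   g are the parts of f times g. *)
have maxM (r : R) (c : \bar R) : 0 <= c -> maxe r%:E 0 * c = maxe (r%:E * c) 0.
  move=> c0; have [r0|r0] := leP 0%R r.
    have E1 : maxe r%:E 0 = r%:E by apply/max_idPl; rewrite lee_fin.
    by rewrite E1; apply/esym/max_idPl; rewrite mule_ge0// lee_fin.
  have E1 : maxe r%:E 0 = 0 by apply/max_idPr; rewrite lee_fin ltW.
  by rewrite E1 mul0e; apply/esym/max_idPr; rewrite mule_le0_ge0// lee_fin ltW.
rewrite [RHS]integralE; congr (_ - _); apply: eq_integral => x _.
  by rewrite !funeposE maxM.
by rewrite !funenegE -EFinN maxM// EFinN mulNe.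
Qed.

End density.

(** * Jordan decomposition of local Radon measures *)

Lemma le_ecvg {R : realType} (u v : nat -> \bar R) (a b : \bar R) :
  u @ \oo --> a -> v @ \oo --> b -> (forall n, u n <= v n)%E -> (a <= b)%E.
Proof.
move=> ua vb uv; rewrite -(cvg_lim _ ua)// -(cvg_lim _ vb)//.
by apply: lee_lim; [apply/cvg_ex; exists a|apply/cvg_ex; exists b|exact: nearW].
Qed.

Section borel.
Context {R : realType} {N : nat}.
Notation E := 'rV[R]_N.
Implicit Types (K U F : set E) (f : E -> R).

Lemma measurable_open U : open U -> measurable U.
Proof. by move=> oU; exact: sub_sigma_algebra. Qed.

Lemma measurable_closed F : closed F -> measurable F.
Proof.
move=> cF; rewrite -[F]setCK; apply: measurableC; apply: measurable_open.
exact: closed_openC.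
Qed.

Lemma closed_compact K : compact K -> closed K.
Proof. exact: (compact_closed (@norm_hausdorff _ _)). Qed.

Lemma measurable_compact K : compact K -> measurable K.
Proof. by move=> /closed_compact/measurable_closed. Qed.

Lemma continuous_measurable f : continuous f -> measurable_fun setT f.
Proof.
move=> cf; apply: (measurability _ (RGenOInfty.measurableE R)).
move=> _ [_ [a ->] <-]; rewrite setTI; apply: measurable_open.
by apply: open_comp => [x _|]; [exact: cf|exact: interval_open].
Qed.

(** [Mloc] speaks of compact subsets of [O]; a compact set between [F] and [O] is what connects it
    with relative compactness. *)
Lemma relcpt_borelP (O F : set E) : relcpt_borel O F <->
  measurable F /\ exists2 K, compact K & K `<=` O /\ F `<=` K.
Proof.
split=> [[mF [bF FO]]|[mF [K cK [KO FK]]]]; split => //.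
  exists (closure F); last by split=> //; exact: subset_closure.
  by apply: bounded_closed_compact => //; exact: closed_closure.
have FK' : closure F `<=` K.
  by rewrite [K](closure_id K).1; [exact: closureS|exact: closed_compact].
split; last exact: subset_trans KO.
have [M [Mr Mb]] := compact_bounded cK.
by exists M; split=> // x xM y /FK'; exact: Mb.
Qed.

End borel.

Section radon_measures.
Context {R : realType} {N : nat}.
Notation E := 'rV[R]_N.
Variables (O : set E).
Local Notation measureE := {measure set E -> \bar R}.

Lemma relcptS (F G : set E) : measurable F -> F `<=` G -> relcpt_borel O G ->
  relcpt_borel O F.
Proof.
move=> mF FG /relcpt_borelP[_ [K cK [KO GK]]]; apply/relcpt_borelP; split => //.
by exists K => //; split => //; exact: subset_trans GK.
Qed.

Lemma relcpt_sub F : relcpt_borel O F -> F `<=` O.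
Proof. by move=> /relcpt_borelP[_ [K cK [KO GK]]]; exact: subset_trans KO. Qed.

Lemma relcpt0 : relcpt_borel O set0.
Proof.
apply/relcpt_borelP; split=> //; exists set0; first exact: compact0.
by split; exact: sub0set.
Qed.

Lemma relcptU F G : relcpt_borel O F -> relcpt_borel O G -> relcpt_borel O (F `|` G).
Proof.
move=> /relcpt_borelP[mF [K cK [KO FK]]] /relcpt_borelP[mG [L cL [LO GL]]].
apply/relcpt_borelP; split; first exact: measurableU.
exists (K `|` L); first exact: compactU.
by split; [move=> x [/KO|/LO]|exact: setUSS].
Qed.

Lemma compact_relcpt K : compact K -> K `<=` O -> relcpt_borel O K.
Proof.
move=> cK KO; apply/relcpt_borelP; split; first exact: measurable_compact.
by exists K => //; split.
Qed.

Definition lfin (m : set E -> \bar R) :=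
  forall K, compact K -> K `<=` O -> (m K < +oo)%E.

Lemma lfin_relcpt (m : measureE) F : lfin m -> relcpt_borel O F -> m F \is a fin_num.
Proof.
move=> lm /relcpt_borelP[mF [K cK [KO FK]]].
rewrite ge0_fin_numE ?measure_ge0// (le_lt_trans _ (lm _ cK KO))//.
by rewrite le_measure ?inE//; exact: measurable_compact.
Qed.

Lemma compact_exhaustion : open O -> exists K : nat -> set E,
  [/\ forall n, relcpt_borel O (K n), nondecreasing_seq K & O = \bigcup_n K n].
Proof.
move=> oO; pose Q j := if `[< qccube j `<=` O >] then @qccube R N j else set0.
have cQ j : relcpt_borel O (Q j).
  rewrite /Q; case: asboolP => // [jO|_]; last exact: relcpt0.
  by apply: compact_relcpt => //; exact: compact_qccube.
have rK n : relcpt_borel O (\big[setU/set0]_(j < n) Q j).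
  elim: n => [|n IH]; first by rewrite big_ord0; exact: relcpt0.
  by rewrite big_ord_recr; exact: relcptU.
exists (fun n => \big[setU/set0]_(j < n) Q j); split=> //.
  by move=> m n mn; apply/subsetPset; exact: subset_bigsetU.
apply/seteqP; split=> [x Ox|x [n _]]; last exact: (relcpt_sub (rK n)).
have [j [xj jO]] := qcube_basis oO Ox; exists j.+1 => //.
apply: (@bigsetU_sup _ j j.+1) => //.
by rewrite /Q (asboolT jO); exact: qcube_ccube.
Qed.

(** Continuity from below along a compact exhaustion of [O]. *)
Lemma le_measure_relcpt (m1 m2 : measureE) : open O ->
  (forall F, relcpt_borel O F -> m1 F <= m2 F)%E ->
  forall B, measurable B -> B `<=` O -> (m1 B <= m2 B)%E.
Proof.
move=> oO m12 B mB BO; have [K [rK ndK OK]] := compact_exhaustion oO.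
have mK n : measurable (B `&` K n).
  by apply: measurableI => //; case/relcpt_borelP : (rK n).
have ndB : nondecreasing_seq (fun n => B `&` K n).
  by move=> p q pq; apply/subsetPset; apply: setIS; exact/subsetPset/ndK.
have BE : \bigcup_n (B `&` K n) = B by rewrite -setI_bigcupr -OK setIidl.
have mU : measurable (\bigcup_n (B `&` K n)) by exact: bigcupT_measurable.
have c1 := nondecreasing_cvg_mu (mu := m1) mK mU ndB.
have c2 := nondecreasing_cvg_mu (mu := m2) mK mU ndB.
rewrite BE in c1 c2; apply: (le_ecvg c1 c2) => n.
by apply: m12; apply: relcptS (rK n) => //; exact: subIsetr.
Qed.

Lemma eq_measure_relcpt (m1 m2 : measureE) : open O ->
  (forall F, relcpt_borel O F -> m1 F = m2 F) ->
  forall B, measurable B -> B `<=` O -> m1 B = m2 B.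
Proof.
move=> oO m12 B mB BO; apply/eqP; rewrite eq_le; apply/andP; split;
  by apply: le_measure_relcpt => // F rF; rewrite m12.
Qed.

Section jordan.
Variables (mu : set E -> R) (Mmu : Mloc O mu).
Local Open Scope ereal_scope.

Lemma Mloc0 : mu set0 = 0%R.
Proof.
have [nu nuE] := Mmu compact0 (@sub0set _ O).
by have := nuE set0 measurable0; rewrite charge0 setI0 => -[<-].
Qed.

Lemma Mloc_charge F : relcpt_borel O F -> exists nu : {charge set E -> \bar R},
  forall G, measurable G -> G `<=` F -> nu G = (mu G)%:E.
Proof.
move=> /relcpt_borelP[mF [K cK [KO FK]]]; have [nu nuE] := Mmu cK KO.
exists nu => G mG GF; rewrite nuE// setIidl//; exact: subset_trans FK.
Qed.

Lemma Mloc_sigma_additive (F : (set E)^nat) : trivIset setT F ->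
  (forall i, measurable (F i)) -> relcpt_borel O (\bigcup_i F i) ->
  \sum_(0 <= i < n) (mu (F i))%:E @[n --> \oo] --> (mu (\bigcup_i F i))%:E.
Proof.
move=> tF mF rF; have [nu nuE] := Mloc_charge rF.
have mU : measurable (\bigcup_i F i) by exact: bigcupT_measurable.
rewrite -nuE//.
have -> : (fun n => \sum_(0 <= i < n) (mu (F i))%:E) =
    (fun n => \sum_(0 <= i < n) nu (F i)).
  apply/funext => n; apply: eq_bigr => i _; rewrite nuE//.
  exact: bigcup_sup.
exact: charge_semi_sigma_additive.
Qed.

Lemma MlocU F G : relcpt_borel O F -> relcpt_borel O G -> F `&` G = set0 ->
  mu (F `|` G) = (mu F + mu G)%R.
Proof.
move=> rF rG FG; have [nu nuE] := Mloc_charge (relcptU rF rG).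
have mF : measurable F by case: rF.
have mG : measurable G by case: rG.
apply: EFin_inj; rewrite EFinD -!nuE//; first exact: chargeU.
exact: measurableU.
Qed.

Lemma mpos_ge0 B : 0 <= mpos O mu B.
Proof.
apply: ereal_sup_ubound; exists set0; last by rewrite Mloc0.
by split; [exact: relcpt0|exact: sub0set].
Qed.

Lemma mpos_set0 : mpos O mu set0 = 0.
Proof.
apply/eqP; rewrite eq_le mpos_ge0 andbT; apply: ge_ereal_sup => _ [F [rF F0] <-].
by have -> : F = set0 by [apply/seteqP; split]; rewrite Mloc0.
Qed.

Lemma mposS B C : B `<=` C -> mpos O mu B <= mpos O mu C.
Proof.
move=> BC; apply: le_ereal_sup => _ [F [rF FB] <-]; exists F => //; split => //.
exact: subset_trans BC.
Qed.

Lemma mpos_superadditive B C : B `&` C = set0 ->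
  mpos O mu B + mpos O mu C <= mpos O mu (B `|` C).
Proof.
move=> BC; have [->|Soo] := eqVneq (mpos O mu (B `|` C)) +oo; first exact: leey.
have Sfin : mpos O mu (B `|` C) \is a fin_num.
  by rewrite ge0_fin_numE ?mpos_ge0// ltey.
have Cfin : mpos O mu C \is a fin_num.
  rewrite ge0_fin_numE ?mpos_ge0// (le_lt_trans (mposS (@subsetUr _ B C)))//.
  by rewrite ltey.
rewrite -leeBrDr//; apply: ge_ereal_sup => _ [F [rF FB] <-].
rewrite leeBrDr// addeC -leeBrDr//; apply: ge_ereal_sup => _ [G [rG GC] <-].
rewrite leeBrDr// -EFinD; apply: ereal_sup_ubound; exists (F `|` G); last first.
  rewrite MlocU// ?(addrC (mu F))//.
  by apply: subsetI_eq0 BC.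
by split; [exact: relcptU|exact: setUSS].
Qed.

(** For the upper bound, a relatively compact test set [G] is cut along the [F i], and [mu] is
    countably additive inside [G]. For the lower bound, finite superadditivity and monotonicity
    bound all partial sums. *)
Lemma mpos_sigma_additive : semi_sigma_additive (mpos O mu).
Proof.
move=> F mF tF mUF.
have [+ ->] : (\sum_(0 <= i < n) mpos O mu (F i) @[n --> \oo] -->
   \sum_(0 <= i <oo) mpos O mu (F i)) /\
   mpos O mu (\bigcup_i F i) = \sum_(0 <= i <oo) mpos O mu (F i); last by [].
split; first by apply: is_cvg_nneseries => n _ _; exact: mpos_ge0.
apply/eqP; rewrite eq_le; apply/andP; split.
  apply: ge_ereal_sup => _ [G [rG GF] <-].
  have GE : G = \bigcup_i (G `&` F i) by rewrite -setI_bigcupr setIidl.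
  have mG : measurable G by case: rG.
  have mGF i : measurable (G `&` F i) by exact: measurableI.
  have rGF : relcpt_borel O (\bigcup_i (G `&` F i)) by rewrite -GE.
  have tGF : trivIset setT (fun i => G `&` F i) by exact: trivIset_setIl.
  have := Mloc_sigma_additive tGF mGF rGF.
  rewrite -GE => c.
  have cc : \sum_(0 <= i < n) mpos O mu (F i) @[n --> \oo] -->
      \sum_(0 <= i <oo) mpos O mu (F i).
    by apply: is_cvg_nneseries => n _ _; exact: mpos_ge0.
  apply: (le_ecvg c cc) => n; apply: lee_sum => i _.
  apply: ereal_sup_ubound; exists (G `&` F i) => //; split; last exact: subIsetr.
  by apply: relcptS rG => //; exact: subIsetl.
apply: lime_le.
  by apply: is_cvg_nneseries => n _ _; exact: mpos_ge0.
apply: nearW => n; rewrite big_mkord.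
apply: le_trans (mposS (@bigsetU_bigcup _ F n)).
elim: n => [|n IH]; first by rewrite !big_ord0 mpos_set0.
rewrite !big_ord_recr/= (le_trans (leeD IH (lexx _)))//.
apply: mpos_superadditive.
by apply: (@trivIset_bigsetUI _ predT) => //; exact: sub_trivIset tF.
Qed.

Lemma mpos_measure : exists m : measureE, (m : set E -> \bar R) = mpos O mu.
Proof.
pose M := isMeasure.Build _ E R (mpos O mu) mpos_set0 mpos_ge0 mpos_sigma_additive.
pose m : measureE := HB.pack (mpos O mu) M.
by exists m.
Qed.

End jordan.

Lemma Mloc_opp mu : Mloc O mu -> Mloc O (fun F => - mu F).
Proof.
move=> Mmu K cK KO; have [nu nuE] := Mmu _ cK KO; exists (copp nu) => B mB.
by rewrite /= /copp/= nuE// EFinN.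
Qed.

Lemma mneg_measure mu : Mloc O mu ->
  exists m : measureE, (m : set E -> \bar R) = mneg O mu.
Proof. by move=> /Mloc_opp/mpos_measure. Qed.

(** Around [F] the set function agrees with a finite charge. A Hahn decomposition (P, Q) of that
    charge identifies the two suprema with its values on the P-part and, up to sign, the Q-part of
    [F]. *)
Lemma jordan_relcpt mu F : Mloc O mu -> relcpt_borel O F ->
  [/\ mpos O mu F < +oo, mneg O mu F < +oo &
    (mu F)%:E = mpos O mu F - mneg O mu F]%E.
Proof.
move=> Mmu rF; have [nu nuE] := Mloc_charge Mmu rF.
have [P [Q [[mP posP] [mQ negQ] PQT PQ0]]] := Hahn_decomposition nu.
have mF : measurable F by case: rF.
have mFP : measurable (F `&` P) by exact: measurableI.
have mFQ : measurable (F `&` Q) by exact: measurableI.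
have nuS G : measurable G -> nu G = (nu (G `&` P) + nu (G `&` Q))%E.
  by move=> mG; exact: charge_partition.
have posE : mpos O mu F = nu (F `&` P).
  apply/eqP; rewrite eq_le; apply/andP; split.
    apply: ge_ereal_sup => _ [G [rG GF] <-]; have mG : measurable G by case: rG.
    rewrite -nuE// nuS//.
    have mGP : measurable (G `&` P) by exact: measurableI.
    have mGQ : measurable (G `&` Q) by exact: measurableI.
    rewrite (@le_trans _ _ (nu (G `&` P)))//.
      by rewrite geeDl//; apply: negQ => //; exact: subIsetr.
    rewrite [leRHS](chargeDI nu mFP mG).
    have -> : F `&` P `&` G = G `&` P.
      by apply/seteqP; split => x [] => [[]|] //; split=> //; split => //; exact: GF.
    by rewrite leeDr//; apply: posP; [exact: measurableD|move=> x [[]]].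
  apply: ereal_sup_ubound; exists (F `&` P).
    by split; [apply: relcptS rF => //; exact: subIsetl|exact: subIsetl].
  by rewrite -nuE//; exact: subIsetl.
have negE : mneg O mu F = (- nu (F `&` Q))%E.
  apply/eqP; rewrite eq_le; apply/andP; split.
    apply: ge_ereal_sup => _ [G [rG GF] <-]; have mG : measurable G by case: rG.
    rewrite EFinN -nuE// nuS// leeN2.
    have mGP : measurable (G `&` P) by exact: measurableI.
    have mGQ : measurable (G `&` Q) by exact: measurableI.
    rewrite (@le_trans _ _ (nu (G `&` Q)))//; last first.
      by rewrite leeDr//; apply: posP => //; exact: subIsetr.
    rewrite [leLHS](chargeDI nu mFQ mG).
    have -> : F `&` Q `&` G = G `&` Q.
      by apply/seteqP; split => x [] => [[]|] //; split=> //; split => //; exact: GF.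
    by rewrite geeDr//; apply: negQ; [exact: measurableD|move=> x [[]]].
  apply: ereal_sup_ubound; exists (F `&` Q).
    by split; [apply: relcptS rF => //; exact: subIsetl|exact: subIsetl].
  by rewrite EFinN -nuE//; exact: subIsetl.
have fP : nu (F `&` P) \is a fin_num by exact: fin_num_measure.
have fQ : nu (F `&` Q) \is a fin_num by exact: fin_num_measure.
split.
- by rewrite posE ltey_eq fP.
- by rewrite negE ltey_eq fin_numN fQ.
- by rewrite posE negE oppeK -nuS// nuE.
Qed.

End radon_measures.

(** * Integration against signed Radon measures *)

(* The variations [tv] and [vtv] enter only as integrators that dominate Jordan
   parts, so their additivity is never needed. *)
Section set_function_integral.
Local Open Scope ereal_scope.
Context d (T : measurableType d) (R : realType).
Variable V : set T -> \bar R.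
Hypothesis V0 : V set0 = 0.

Import HBNNSimple.

Let nnintegral (W : set T -> \bar R) f := ereal_sup [set sintegral W h |
  h in [set h : {nnsfun T >-> R} | forall x, (h x)%:E <= f x]].

Lemma sintegral_range (h : {nnsfun T >-> R}) :
  sintegral V h = \sum_(x \in range h) x%:E * V (h @^-1` [set x]).
Proof.
rewrite /sintegral (fsbig_widen (range h) setT)//= => x [_ Nfx] /=.
by rewrite preimage10// V0 mule0.
Qed.

Let nnintegral_set0 : nnintegral V (cst 0) = 0.
Proof.
have s0 (h : {nnsfun T >-> R}) : (forall x, h x = 0%R) -> sintegral V h = 0.
  move=> h0; rewrite sintegral_range fsbig1// => r [t _ <-].
  by rewrite h0 mul0e.
rewrite /nnintegral /=; apply/eqP; rewrite eq_le; apply/andP; split; last first.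
  by apply/ereal_sup_ubound; exists nnsfun0; [|exact: s0].
apply/ge_ereal_sup => /= x [f /= f0 <-]; rewrite s0// => y.
by apply/eqP; rewrite eq_le -2!lee_fin f0 //= lee_fin//.
Qed.

Let ge0_integral_set D f : (forall x, D x -> 0 <= f x) ->
  \int[V]_(x in D) f x = nnintegral V (f \_ D).
Proof.
move=> f0; rewrite /integral funeneg_restrict funepos_restrict.
have /eq_restrictP-> := ge0_funeposE f0.
have /eq_restrictP-> := ge0_funenegE f0.
by rewrite erestrict0; have := nnintegral_set0; rewrite /nnintegral => ->; rewrite sube0.
Qed.

(** Chebyshev's inequality: c times the indicator of [B] is one of the simple functions in the
    supremum that defines the integral. *)
Lemma integral_set_ge (D B : set T) (f : T -> \bar R) (c : R) : (0 < c)%R ->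
  measurable B -> B `<=` D -> (forall x, D x -> 0 <= f x) ->
  (forall x, B x -> c%:E <= f x) -> c%:E * V B <= \int[V]_(x in D) f x.
Proof.
move=> c0 mB BD f0 cf; rewrite ge0_integral_set//.
have [h hE] : exists h : {nnsfun T >-> R}, forall x, h x = (c * \1_B x)%R.
  by exists (scale_nnsfun (indic_nnsfun R mB) (ltW c0)).
have -> : c%:E * V B = sintegral V h.
  have hc : h @^-1` [set c] = B.
    apply/seteqP; split=> x; rewrite /= hE.
      have [Bx _|Bx] := pselect (B x); first exact: Bx.
      by rewrite indicE memNset// mulr0 => c00; move: c0; rewrite -c00 ltxx.
    by move=> Bx; rewrite indicE mem_set// mulr1.
  rewrite sintegral_range (fsbig_widen (range h) [set 0%R; c])/=.
  - rewrite fsbigU//=; last by move=> r [-> c00]; move: c0; rewrite -c00 ltxx.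
    by rewrite !fsbig_set1 mul0e add0e hc.
  - move=> _ [x _ <-] /=; rewrite hE indicE; case: (x \in B); first by right; rewrite mulr1.
    by left; rewrite mulr0.
  - by move=> r [_ Nr] /=; rewrite preimage10// V0 mule0.
apply: ereal_sup_ubound; exists h => //= x; rewrite hE indicE /patch.
have [xB|xB] := boolP (x \in B).
  rewrite mulr1 (mem_set (BD _ (set_mem xB))); exact/cf/set_mem.
by rewrite mulr0; case: ifPn => // /set_mem/f0.
Qed.

Lemma integral_set_le (D D' : set T) (f g : T -> \bar R) : D `<=` D' ->
  (forall x, D x -> 0 <= f x) -> (forall x, D' x -> 0 <= g x) ->
  (forall x, D x -> f x <= g x) -> \int[V]_(x in D) f x <= \int[V]_(x in D') g x.
Proof.
move=> DD f0 g0 fg; rewrite !ge0_integral_set//.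
apply: le_ereal_sup => _ [h hf <-]; exists h => // x; rewrite (le_trans (hf x))//.
rewrite /patch; case: ifPn => [/set_mem Dx|_].
  by rewrite mem_set ?fg//; exact: DD.
by case: ifPn => // /set_mem/g0.
Qed.

Lemma integral_set_ge0 (D : set T) (f : T -> \bar R) :
  (forall x, D x -> 0 <= f x) -> 0 <= \int[V]_(x in D) f x.
Proof.
move=> f0; apply: le_trans (integral_set_le (@sub0set _ D) _ f0 _) => //.
by rewrite ge0_integral_set// patch_set0 nnintegral_set0.
Qed.

Lemma integral_setN (D : set T) (f : T -> \bar R) : (forall x, D x -> 0 <= f x) ->
  \int[V]_(x in D) (- f x) = - \int[V]_(x in D) f x.
Proof.
move=> f0; rewrite [in RHS]ge0_integral_set// /integral.
have -> : (\- f) \_ D = \- (f \_ D).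
  by apply/funext => x; rewrite /patch; case: ifPn => // _; rewrite oppe0.
have fD0 x : 0 <= (f \_ D) x by rewrite /patch; case: ifPn => // /set_mem/f0.
have -> : (\- (f \_ D))^\+ = cst 0.
  by apply/funext => x; rewrite funeposE; apply/max_idPr; rewrite oppe_le0.
have -> : (\- (f \_ D))^\- = f \_ D.
  by apply/funext => x; rewrite funenegE oppeK; apply/max_idPl.
by have := nnintegral_set0; rewrite /nnintegral => ->; rewrite add0e.
Qed.

(** For each simple function the sums over its values compare term by term, hence so do the suprema.
    This carries integrability from [tv] and [vtv] to the Jordan parts. *)
Lemma integrable_le_set (m : {measure set T -> \bar R}) D f :
  (forall A, measurable A -> m A <= V A) -> V.-integrable D f -> m.-integrable D f.
Proof.
move=> mV /integrableP[mf fi]; apply/integrableP; split=> //.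
apply: le_lt_trans fi; rewrite ge0_integralE// ge0_integral_set// /nnintegral.
apply: ge_ereal_sup => _ [h hf <-].
apply: (@le_trans _ _ (sintegral V h)); last by apply: ereal_sup_ubound; exists h.
rewrite sintegral_range sintegralE; apply: lee_fsum => // r [t _ <-].
by rewrite lee_wpmul2l ?lee_fin ?mV.
Qed.

End set_function_integral.

(** * Integrals against sums and differences of measures *)

Section sint.
Context {R : realType} {N : nat}.
Notation E := 'rV[R]_N.
Variables (O : set E) (oO : open O).
Local Notation measureE := {measure set E -> \bar R}.
Implicit Types (mu nu : set E -> R) (m : measureE) (D : set E).

Let mO : measurable O. Proof. exact: measurable_open. Qed.

Definition sintegrable mu D f :=
  (mpos O mu).-integrable D f /\ (mneg O mu).-integrable D f.

Lemma integrable_measure_add m1 m2 D f : measurable D ->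
  m1.-integrable D f -> m2.-integrable D f -> (measure_add m1 m2).-integrable D f.
Proof.
move=> mD /integrableP[mf f1] /integrableP[_ f2]; apply/integrableP; split=> //.
rewrite ge0_integral_measure_add//; first exact: lte_add_pinfty.
exact: measurableT_comp.
Qed.

Lemma lfin_add m1 m2 : lfin O m1 -> lfin O m2 -> lfin O (measure_add m1 m2).
Proof.
move=> l1 l2 K cK KO; rewrite measure_addE lte_add_pinfty//; [exact: l1|exact: l2].
Qed.

Lemma Mloc_diff mu m1 m2 : lfin O m1 -> lfin O m2 ->
  (forall F, relcpt_borel O F -> (mu F)%:E = m1 F - m2 F)%E -> Mloc O mu.
Proof.
move=> l1 l2 muE K cK KO; have mK := measurable_compact cK.
pose f1 : {finite_measure set E -> \bar R} := mfrestr mK (l1 K cK KO).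
pose f2 : {finite_measure set E -> \bar R} := mfrestr mK (l2 K cK KO).
exists (cadd (charge_of_finite_measure f1) (copp (charge_of_finite_measure f2))).
move=> B mB; rewrite muE//; apply: relcptS (compact_relcpt cK KO).
  exact: measurableI.
exact: subIsetr.
Qed.

(** Minimality of the Jordan decomposition: if mu = m1 - m2, then mu F <= m1 F <= m1 B for every
    admissible [F] inside [B]. *)
Lemma mpos_le mu m1 m2 : 
  (forall F, relcpt_borel O F -> (mu F)%:E = m1 F - m2 F)%E ->
  forall B, measurable B -> (mpos O mu B <= m1 B)%E.
Proof.
move=> muE B mB; apply: ge_ereal_sup => _ [F [rF FB] <-]; rewrite muE//.
have mF : measurable F by case: rF.
rewrite (@le_trans _ _ (m1 F))//; last by rewrite le_measure ?inE.
by rewrite geeDl// oppe_le0 measure_ge0.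
Qed.

(* The right-hand side need not be the Jordan decomposition of [mu]. *)
Lemma sint_diff mu m1 m2 D f : lfin O m1 -> lfin O m2 ->
  (forall F, relcpt_borel O F -> (mu F)%:E = m1 F - m2 F)%E ->
  measurable D -> D `<=` O -> m1.-integrable D f -> m2.-integrable D f ->
  sintegrable mu D f /\ sint O mu D f =
    fine (\int[m1]_(x in D) f x)%E - fine (\int[m2]_(x in D) f x)%E.
Proof.
move=> l1 l2 muE mD DO i1 i2; have Mmu := Mloc_diff l1 l2 muE.
have [p pE] := mpos_measure Mmu; have [n nE] := mneg_measure Mmu.
have muE' F : relcpt_borel O F -> ((- mu F)%:E = m2 F - m1 F)%E.
  move=> rF; rewrite EFinN muE// fin_num_oppeB ?(lfin_relcpt l2)//.
  by rewrite addeC.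
have ip : p.-integrable D f.
  apply: integrable_le_set i1 => // A mA; rewrite pE; exact: mpos_le muE _ _.
have iN : n.-integrable D f.
  apply: integrable_le_set i2 => // A mA; rewrite nE; exact: mpos_le muE' _ _.
(* From p - n = m1 - m2 one passes to p + m2 = n + m1. As an identity of measures it extends from
   relatively compact sets to all Borel subsets of [O], where the differences could be infinite
   minus infinite. *)
have pn B : measurable B -> B `<=` O -> measure_add p m2 B = measure_add n m1 B.
  apply: eq_measure_relcpt => // F rF.
  rewrite [LHS]measure_addE [RHS]measure_addE pE nE.
  have [p1 n1] := jordan_relcpt Mmu rF; rewrite muE// -pE -nE.
  have := lfin_relcpt l1 rF; have := lfin_relcpt l2 rF.
  have : p F \is a fin_num by rewrite ge0_fin_numE// pE.
  have : n F \is a fin_num by rewrite ge0_fin_numE// nE.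
  move=> /fineK <- /fineK <- /fineK <- /fineK <-.
  by rewrite -!EFinB -!EFinD => -[] h; congr EFin; lra.
split; first by rewrite /sintegrable -pE -nE.
rewrite /sint -pE -nE.
have : (\int[measure_add p m2]_(x in D) f x = \int[measure_add n m1]_(x in D) f x)%E.
  by apply: eq_measure_integral => B mB BD; apply: pn => //; exact: subset_trans DO.
have mf := measurable_int _ ip.
rewrite !integral_measure_add//.
have /fineK <- := integrable_fin_num mD ip.
have /fineK <- := integrable_fin_num mD iN.
have /fineK <- := integrable_fin_num mD i1.
have /fineK <- := integrable_fin_num mD i2.
by rewrite -!EFinD => -[] h /=; lra.
Qed.

Lemma eq_mpos mu nu : (forall F, relcpt_borel O F -> mu F = nu F) ->
  mpos O mu = mpos O nu /\ mneg O mu = mneg O nu.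
Proof.
move=> E1; split; apply/funext => B; rewrite /mpos /mneg; congr ereal_sup;
  by apply/seteqP; split=> _ [F [rF FB] <-]; exists F => //; rewrite E1.
Qed.

Lemma eq_sint_relcpt mu nu D f : (forall F, relcpt_borel O F -> mu F = nu F) ->
  sint O mu D f = sint O nu D f.
Proof. by move=> /eq_mpos[pE nE]; rewrite /sint pE nE. Qed.

Lemma lfin_jordan mu : Mloc O mu -> lfin O (mpos O mu) /\ lfin O (mneg O mu).
Proof.
move=> Mmu; split=> K cK KO.
  by have [] := jordan_relcpt Mmu (compact_relcpt cK KO).
by have [] := jordan_relcpt Mmu (compact_relcpt cK KO).
Qed.

(** nu = (p1 + p2) - (n1 + n2). In general this is not the Jordan decomposition of [nu], which is
    why [sint_diff] accepts any difference of locally finite measures. *)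
Lemma sintD mu1 mu2 nu D f : Mloc O mu1 -> Mloc O mu2 ->
  (forall F, relcpt_borel O F -> nu F = mu1 F + mu2 F) ->
  Mloc O nu /\ (measurable D -> D `<=` O ->
    sintegrable mu1 D f -> sintegrable mu2 D f ->
    sintegrable nu D f /\ sint O nu D f = sint O mu1 D f + sint O mu2 D f).
Proof.
move=> M1 M2 nuE.
have [p1 p1E] := mpos_measure M1; have [n1 n1E] := mneg_measure M1.
have [p2 p2E] := mpos_measure M2; have [n2 n2E] := mneg_measure M2.
have [lp1 ln1] := lfin_jordan M1; have [lp2 ln2] := lfin_jordan M2.
rewrite -p1E -n1E -p2E -n2E in lp1 ln1 lp2 ln2.
have nuE' F : relcpt_borel O F ->
    (nu F)%:E = (measure_add p1 p2 F - measure_add n1 n2 F)%E.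
  move=> rF; rewrite nuE// EFinD; have [_ _ ->] := jordan_relcpt M1 rF.
  have [_ _ ->] := jordan_relcpt M2 rF; rewrite -p1E -n1E -p2E -n2E !measure_addE.
  rewrite -(fineK (lfin_relcpt lp1 rF)) -(fineK (lfin_relcpt lp2 rF)).
  rewrite -(fineK (lfin_relcpt ln1 rF)) -(fineK (lfin_relcpt ln2 rF)).
  by rewrite -!EFinD; congr EFin; lra.
have lp := lfin_add lp1 lp2; have ln := lfin_add ln1 ln2.
split; first exact: (Mloc_diff lp ln nuE').
rewrite /sintegrable -p1E -n1E -p2E -n2E => mD DO [ip1 in1] [ip2 in2].
have [//|||ii ->] := @sint_diff nu _ _ D f lp ln nuE' mD.
- exact: integrable_measure_add.
- exact: integrable_measure_add.
- split => //; rewrite /sint -p1E -n1E -p2E -n2E !integral_measure_add//;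
    try by apply: measurable_int ip1.
  have /fineK <- := integrable_fin_num mD ip1.
  have /fineK <- := integrable_fin_num mD in1.
  have /fineK <- := integrable_fin_num mD ip2.
  have /fineK <- := integrable_fin_num mD in2.
  by rewrite -!EFinD /=; lra.
Qed.

Lemma mneg_opp mu : mneg O (fun F => - mu F) = mpos O mu.
Proof.
apply/funext => B; rewrite /mneg /mpos; congr ereal_sup.
by apply/seteqP; split=> _ [F [rF FB] <-]; exists F => //; rewrite opprK.
Qed.

Lemma sintegrableN mu D f : sintegrable mu D f -> sintegrable (fun F => - mu F) D f.
Proof. by case=> ip iN; rewrite /sintegrable mneg_opp. Qed.

Lemma sintN mu D f : sint O (fun F => - mu F) D f = - sint O mu D f.
Proof. by rewrite /sint opprB mneg_opp. Qed.

End sint.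

(** * Weighted measures and dominated convergence *)

Section weighted_measures.
Context {R : realType} {N : nat}.
Notation E := 'rV[R]_N.
Variables (O : set E) (oO : open O).
Local Notation measureE := {measure set E -> \bar R}.
Implicit Types (mu nu : set E -> R) (D : set E) (w : E -> \bar R).

Let mO : measurable O. Proof. exact: measurable_open. Qed.

Definition bounded_on D (f : E -> R) := exists M : R, forall x, D x -> `|f x| <= M.

Lemma bounded_onP D f : bounded_on D f -> [bounded f x | x in D].
Proof.
move=> [M Mf]; exists M; split; first exact: num_real.
by move=> r Mr x Dx; exact: le_trans (Mf _ Dx) (ltW Mr).
Qed.

Local Open Scope ereal_scope.

(** [a] and [b] have the densities w^+ and w^- with respect to [p], with [w] extended by 0 outside
    [O]. Both are finite since [w] is integrable, so bounded functions may be integrated against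
    them. *)
Lemma signed_density (p : measureE) w : p.-integrable O w ->
  exists a b : measureE, [/\ a setT < +oo, b setT < +oo,
    forall F, measurable F -> F `<=` O -> \int[p]_(x in F) w x = a F - b F &
    forall D f, measurable D -> D `<=` O -> measurable_fun D f -> bounded_on D f ->
    [/\ a.-integrable D (EFin \o f), b.-integrable D (EFin \o f),
      p.-integrable D (fun x => w x * (f x)%:E) &
      \int[p]_(x in D) (w x * (f x)%:E) =
      \int[a]_(x in D) (f x)%:E - \int[b]_(x in D) (f x)%:E]].
Proof.
move=> iw; pose w' := w \_ O.
have iw' : p.-integrable setT w' by apply/(integrable_mkcond w mO).1.
have w'E D : D `<=` O -> {in D, w =1 w'}.
  by move=> DO x /set_mem/DO xO; rewrite /w' /patch mem_set.
have ip : p.-integrable setT w'^\+ by exact: integrable_funepos.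
have iN : p.-integrable setT w'^\- by exact: integrable_funeneg.
have mp := measurable_int _ ip; have mN := measurable_int _ iN.
have p0 x : 0 <= w'^\+ x by exact: funepos_ge0.
have n0 x : 0 <= w'^\- x by exact: funeneg_ge0.
have [a aE] := density_measure p mp p0.
have [b bE] := density_measure p mN n0.
exists a, b; split.
- by rewrite aE integrable_lty.
- by rewrite bE integrable_lty.
- move=> F mF FO; rewrite (eq_integral _ _ (w'E F FO)) integralE aE bE.
  by [].
move=> D f mD DO mf /bounded_onP bf.
have [ia aI] := integral_density mp p0 aE mD mf bf ip.
have [ib bI] := integral_density mN n0 bE mD mf bf iN.
have ipf : p.-integrable D (fun x => (f x)%:E * w'^\+ x).
  by apply: integrableMr => //; exact: (integrableS measurableT).
have inf : p.-integrable D (fun x => (f x)%:E * w'^\- x).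
  by apply: integrableMr => //; exact: (integrableS measurableT).
have wfE : {in D, (fun x => (f x)%:E * w'^\+ x) \- (fun x => (f x)%:E * w'^\- x)
    =1 (fun x => w x * (f x)%:E)}.
  move=> x xD /=; rewrite -muleBr// ?add_def_funeposneg// muleC (w'E D DO)//.
  by rewrite {3}(funeposneg w').
split => //.
  by apply: (eq_integrable mD _ _ wfE); exact: integrableB.
by rewrite aI bI -(eq_integral _ _ wfE) integralB.
Qed.

Local Close Scope ereal_scope.

(** [nu] is the measure w mu. With p and n the Jordan parts of [mu], it equals (w^+ p + w^- n) -
    (w^- p + w^+ n), a difference of finite measures, and [sint_diff] computes its integrals. *)
Lemma sint_weight mu nu w : Mloc O mu -> sintegrable O mu O w ->
  (forall F, relcpt_borel O F -> nu F = sint O mu F w) ->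
  Mloc O nu /\ forall D f, measurable D -> D `<=` O -> measurable_fun D f ->
    bounded_on D f ->
    [/\ sintegrable O nu D (EFin \o f),
      sintegrable O mu D (fun x => w x * (f x)%:E)%E &
      sint O nu D (EFin \o f) = sint O mu D (fun x => w x * (f x)%:E)%E].
Proof.
move=> Mmu [+ +] nuE.
have [p pE] := mpos_measure Mmu; have [n nE] := mneg_measure Mmu.
rewrite -pE -nE => iwp iwn.
have [a [b [afin bfin abE abI]]] := signed_density iwp.
have [c [d [cfin dfin cdE cdI]]] := signed_density iwn.
have fin_lfin (m : measureE) : (m setT < +oo)%E -> lfin O m.
  move=> mfin K cK _; rewrite (le_lt_trans _ mfin)//.
  by rewrite le_measure ?inE//; exact: measurable_compact.
have finF (m : measureE) F : (m setT < +oo)%E -> measurable F -> m F \is a fin_num.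
  move=> mfin mF; rewrite ge0_fin_numE// (le_lt_trans _ mfin)//.
  by rewrite le_measure ?inE.
have l1 : lfin O (measure_add a d) by apply: lfin_add; exact: fin_lfin.
have l2 : lfin O (measure_add b c) by apply: lfin_add; exact: fin_lfin.
have nuE' F : relcpt_borel O F ->
    (nu F)%:E = (measure_add a d F - measure_add b c F)%E.
  move=> rF; have FO := relcpt_sub rF; have mF : measurable F by case: rF.
  rewrite nuE// /sint -pE -nE abE// cdE// !measure_addE.
  rewrite -(fineK (finF a F afin mF)) -(fineK (finF b F bfin mF)).
  rewrite -(fineK (finF c F cfin mF)) -(fineK (finF d F dfin mF)).
  by rewrite -!EFinD /=; congr EFin; lra.
split; first exact: Mloc_diff l1 l2 nuE'.
move=> D f mD DO mf bf.
have [ia ib ip abE'] := abI _ _ mD DO mf bf.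
have [ic id iN cdE'] := cdI _ _ mD DO mf bf.
have mfE : measurable_fun D (EFin \o f) by exact/measurable_EFinP.
have [||inu ->] := sint_diff oO l1 l2 nuE' mD DO (f := EFin \o f).
- exact: integrable_measure_add.
- exact: integrable_measure_add.
split => //; first by rewrite /sintegrable -pE -nE.
rewrite /sint -pE -nE !integral_measure_add// abE' cdE'.
have /fineK <- := integrable_fin_num mD ia.
have /fineK <- := integrable_fin_num mD ib.
have /fineK <- := integrable_fin_num mD ic.
have /fineK <- := integrable_fin_num mD id.
by rewrite -!EFinD /=; lra.
Qed.

Lemma sint_dominated mu D (f_ : nat -> E -> \bar R) f g : Mloc O mu ->
  measurable D -> sintegrable O mu D g ->
  (forall n, measurable_fun D (f_ n)) ->
  (forall n x, D x -> `|f_ n x| <= `|g x|)%E ->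
  (forall x, D x -> f_ ^~ x @ \oo --> f x) ->
  sintegrable O mu D f /\ sint O mu D (f_ n) @[n --> \oo] --> sint O mu D f.
Proof.
move=> Mmu mD [+ +] mf_ f_g f_f.
have [p pE] := mpos_measure Mmu; have [n nE] := mneg_measure Mmu.
rewrite /sintegrable /sint -pE -nE => igp ign.
have mf : measurable_fun D f by exact: emeasurable_fun_cvg f_f.
have DC (m : measureE) : m.-integrable D g -> m.-integrable D f /\
    fine (\int[m]_(x in D) f_ k x)%E @[k --> \oo] --> fine (\int[m]_(x in D) f x)%E.
  move=> ig; have iag : m.-integrable D (abse \o g) by exact: integrable_abse.
  have [||if_ _ c] := dominated_convergence mD mf_ mf _ iag.
  - exact: aeW.
  - by apply: aeW => x k Dx; exact: f_g.
  - by split => //; apply: fine_cvg; rewrite fineK ?integrable_fin_num.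
have [ifp cp] := DC p igp; have [ifn cn] := DC n ign.
by split => //; exact: cvgB.
Qed.

End weighted_measures.

(** * Test functions *)

Section test_functions.
Context {R : realType} {N : nat}.
Notation E := 'rV[R]_N.
Variables (O : set E).
Implicit Types (D V : set E) (phi : E -> R).

Lemma test_fun_eq0 phi x : test_fun O phi -> ~ O x -> phi x = 0.
Proof.
move=> [_ _ sO] Ox; apply/eqP/negP => /negP px; apply: Ox; apply: sO.
exact: subset_closure.
Qed.

Lemma test_funS V phi : V `<=` O -> test_fun V phi -> test_fun O phi.
Proof. by move=> VO [Cp cp sV]; split=> //; exact: subset_trans VO. Qed.

Lemma test_fun_continuous phi : test_fun O phi -> continuous phi.
Proof. by move=> [Cp _ _]; exact: Ck_continuous (Cp 0). Qed.

Lemma test_fun_derive_continuous phi i : test_fun O phi ->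
  continuous ('D_(basis_vec R i) phi).
Proof. by move=> [Cp _ _]; have [_ /(_ i)[_]] := Cp 1. Qed.

Lemma bounded_compact_support (K : set E) (f : E -> R) : compact K -> continuous f ->
  (forall x, f x != 0 -> K x) -> exists M, forall x, `|f x| <= M.
Proof.
move=> cK cf fK.
have [M [_ Mf]] : bounded_set (f @` K).
  apply: compact_bounded; apply: continuous_compact => //.
  exact: continuous_subspaceT.
exists (Num.max 0 (M + 1)) => x; have [->|/fK Kx] := eqVneq (f x) 0.
  by rewrite normr0 le_max lexx.
rewrite le_max; apply/orP; right; apply: (Mf (M + 1)); first by rewrite ltrDl.
by exists x.
Qed.

Lemma test_fun_bounded D phi : test_fun O phi -> bounded_on D phi.
Proof.
move=> /[dup] tp [Cp cp _]; have cphi := test_fun_continuous tp.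
have [|M MP] := bounded_compact_support cp cphi; last by exists M.
by move=> x px; exact: subset_closure.
Qed.

Lemma derive_support phi i x : 'D_(basis_vec R i) phi x != 0 ->
  closure [set y | phi y != 0] x.
Proof.
apply: contraNP => xN; apply/eqP; rewrite (@near_eq_derive _ _ _ phi (cst 0)).
  exact: derive_cst.
have : nbhs x (~` closure [set y | phi y != 0]).
  by apply: open_nbhs_nbhs; split => //; exact/closed_openC/closed_closure.
apply: filterS => y yN; apply/eqP/negP => /negP py; apply: yN.
exact: subset_closure.
Qed.

Lemma test_fun_derive_bounded D phi i : test_fun O phi ->
  bounded_on D ('D_(basis_vec R i) phi).
Proof.
move=> /[dup] tp [Cp cp _]; have cphi := test_fun_derive_continuous (i:=i) tp.
have [x|M MP] := bounded_compact_support cp cphi; last by exists M.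
exact: derive_support.
Qed.

End test_functions.

(** * Uniqueness of the representing measure *)

Section representation.
Context {R : realType} {N : nat}.
Notation E := 'rV[R]_N.
Variables (O : set E) (oO : open O).
Local Notation measureE := {measure set E -> \bar R}.
Implicit Types (mu nu : set E -> R) (V : set E) (phi : E -> R).

Lemma bounded_relcpt_sintegrable mu (f : E -> R) (K : set E) : Mloc O mu ->
  relcpt_borel O K -> measurable_fun setT f -> bounded_on setT f ->
  (forall x, ~ K x -> f x = 0) -> sintegrable O mu O (EFin \o f).
Proof.
move=> Mmu rK mf bf fK; have mO := measurable_open oO.
have mK : measurable K by case: rK.
have [p pE] := mpos_measure Mmu; have [n nE] := mneg_measure Mmu.
have [Kp Kn _] := jordan_relcpt Mmu rK.
have H (m : measureE) : (m K < +oo)%E -> m.-integrable O (EFin \o f).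
  move=> mKf; apply: (integrableS measurableT) => //.
  rewrite (_ : EFin \o f = (EFin \o f) \_ K); last first.
    apply/funext => x; rewrite /patch; case: ifPn => // /negP xK.
    by rewrite /= fK// => Kx; apply: xK; exact: mem_set.
  apply/(integrable_mkcond _ mK); apply: measurable_bounded_integrable => //.
    exact: measurable_funTS.
  by apply: bounded_onP; have [M MP] := bf; exists M => x _; exact: MP.
by rewrite /sintegrable -pE -nE; split; apply: H; rewrite ?pE ?nE.
Qed.

Lemma test_fun_sintegrable mu phi : Mloc O mu -> test_fun O phi ->
  sintegrable O mu O (EFin \o phi).
Proof.
move=> Mmu /[dup] tp [Cp cp sO].
apply: (bounded_relcpt_sintegrable Mmu (compact_relcpt cp sO)).
- by apply: continuous_measurable; exact: test_fun_continuous tp.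
- exact: test_fun_bounded tp.
- by move=> x xN; apply/eqP/negP => /negP px; apply: xN; exact: subset_closure.
Qed.

(** The cutoffs of [W] are also test functions on [V], and they converge pointwise to the indicator
    of [W]. The indicator of the compact [K] is an integrable majorant, so the limit gives mu W = 0
    as an equality of the Jordan parts. *)
Lemma sint_open_eq0 mu V W K : Mloc O mu -> open V -> V `<=` O ->
  (forall phi, test_fun V phi -> sint O mu O (EFin \o phi) = 0) ->
  open W -> compact K -> W `<=` K -> K `<=` V -> mpos O mu W = mneg O mu W.
Proof.
move=> Mmu oV VO mu0 oW cK WK KV; have mO := measurable_open oO.
have mW := measurable_open oW.
have KO := subset_trans KV VO; have WO := subset_trans WK KO.
have [phi [tphi phi01 phi1 _]] := cutoff_exists oW compact0 (@sub0set _ W).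
have i1 : sintegrable O mu O (EFin \o \1_K).
  apply: (bounded_relcpt_sintegrable Mmu (compact_relcpt cK KO)).
  - by apply: measurable_indic; exact: measurable_compact.
  - exists 1 => x _; rewrite indicE; case: (x \in K); first by rewrite normr1.
    by rewrite normr0.
  - by move=> x xK; rewrite indicE memNset.
have [|||_ c] := @sint_dominated _ _ O mu O (fun k => EFin \o phi k)
    (EFin \o \1_W) _ Mmu mO i1.
- move=> k; apply/measurable_EFinP/measurable_funTS; apply: continuous_measurable.
  exact: test_fun_continuous (tphi k).
- move=> k x Ox; have /andP[p0 p1] := phi01 k x.
  rewrite /= lee_fin indicE; have [Kx|Kx] := pselect (K x).
    by rewrite mem_set// normr1 ger0_norm.
  by rewrite (test_fun_eq0 (tphi k)) ?normr0// => /WK.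
- move=> x Ox; apply: cvg_near_cst; have [Wx|Wx] := pselect (W x).
    by apply: filterS (phi1 x Wx) => k /= ->; rewrite indicE mem_set.
  by near=> k; rewrite /= (test_fun_eq0 (tphi k))// indicE memNset.
have {}c : sint O mu O (EFin \o \1_W) = 0.
  have E0 : (fun k => sint O mu O (EFin \o phi k)) = cst 0.
    apply/funext => k; apply: mu0; apply: test_funS (tphi k).
    exact: subset_trans WK KV.
  by rewrite E0 in c; apply/esym/(cvg_unique _ _ c) => //; exact: cvg_cst.
have [p pE] := mpos_measure Mmu; have [n nE] := mneg_measure Mmu.
have rW : relcpt_borel O W by apply: relcptS (compact_relcpt cK KO).
have [pf nf _] := jordan_relcpt Mmu rW.
move: c pf nf; rewrite /sint -pE -nE /= !integral_indic// setIidl//.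
move=> + pf nf => /eqP; rewrite subr_eq0 => /eqP h.
by rewrite -[LHS]fineK ?ge0_fin_numE// h fineK// ge0_fin_numE.
Unshelve. all: by end_near. Qed.

(** The Jordan parts agree on open sets that are relatively compact in [V], hence on all Borel
    subsets of [V]. Then [mu] vanishes on relatively compact subsets of [V], and so do the suprema
    that define its Jordan parts. *)
Lemma vanish_open mu V : Mloc O mu -> open V -> V `<=` O ->
  (forall phi, test_fun V phi -> sint O mu O (EFin \o phi) = 0) ->
  mpos O mu V = 0%E /\ mneg O mu V = 0%E.
Proof.
move=> Mmu oV VO mu0.
have [p pE] := mpos_measure Mmu; have [n nE] := mneg_measure Mmu.
have pn B : measurable B -> B `<=` V -> p B = n B.
  apply: eq_measure_relcpt => // F /relcpt_borelP[mF [S cS [SV FS]]].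
  have [W [K [oW cK SW WK KV]]] := compact_open_between oV cS SV.
  have mW := measurable_open oW.
  have Kf : (p K < +oo)%E.
    rewrite pE.
    by have [] := jordan_relcpt Mmu (compact_relcpt cK (subset_trans KV VO)).
  have FW : F `&` W = F by apply: setIidl; exact: subset_trans FS SW.
  (* Open sets form a pi-system that generates the Borel sets. Restriction to [W], which lies in a
     compact set, provides the finiteness required by uniqueness of measures. *)
  have : mrestr p mW F = mrestr n mW F; last by rewrite /mrestr FW.
  apply: (measure_unique (@open E) (fun=> setT)) => //.
  - by move=> U1 U2 oU1 oU2; exact: openI.
  - by move=> _; exact: openT.
  - by apply/seteqP; split => // x _; exists 0%N.
  - move=> U oU; change (p (U `&` W) = n (U `&` W)); rewrite pE nE.
    apply: (sint_open_eq0 Mmu oV VO mu0 (openI oU oW) cK _ KV).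
    exact: subset_trans (@subIsetr _ _ _) WK.
  - move=> _; rewrite /= /mrestr setTI (le_lt_trans _ Kf)//.
    by rewrite le_measure ?inE//; exact: measurable_compact.
have mu00 F : relcpt_borel O F -> F `<=` V -> mu F = 0.
  move=> rF FV; have mF : measurable F by case: rF.
  have [pf nf] := jordan_relcpt Mmu rF; rewrite -pE -nE pn// subee; last first.
    by rewrite ge0_fin_numE// nE.
  by case.
split; apply/eqP; rewrite eq_le -?pE -?nE measure_ge0 andbT ?pE ?nE.
  by apply: ge_ereal_sup => _ [F [rF FV] <-]; rewrite mu00.
by apply: ge_ereal_sup => _ [F [rF FV] <-]; rewrite mu00// oppr0.
Qed.

(** [vanish_open] applied to mu - nu. Since [dmeasure] is a choice, every concrete formula for a
    divergence or a pairing is transferred to it by this lemma. *)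
Lemma represents_unique mu nu T : Mloc O mu -> Mloc O nu ->
  represents O mu T -> represents O nu T ->
  forall F, relcpt_borel O F -> mu F = nu F.
Proof.
move=> Mmu Mnu rmu rnu; pose dl F := mu F + - nu F.
have [Mdl dlI] := @sintD _ _ O oO mu (fun F => - nu F) dl O (fun=> 0%E)
  Mmu (Mloc_opp Mnu) (fun F _ => erefl).
have dl0 phi : test_fun O phi -> sint O dl O (EFin \o phi) = 0.
  move=> tp; have [_ dlI'] := @sintD _ _ O oO mu (fun F => - nu F) dl O (EFin \o phi)
    Mmu (Mloc_opp Mnu) (fun F _ => erefl).
  have [//|||_ ->] := dlI' (measurable_open oO).
  - exact: test_fun_sintegrable.
  - by apply: sintegrableN; exact: test_fun_sintegrable.
  - by rewrite sintN -rmu// -rnu// subrr.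
have [p0 n0] := vanish_open Mdl oO (@subset_refl _ O) dl0.
move=> F rF; apply/eqP; rewrite -subr_eq0 eq_le; apply/andP; split.
  rewrite -lee_fin; apply: (@le_trans _ _ (mpos O dl O)); last by rewrite p0.
  apply: ereal_sup_ubound; exists F => //.
  by split => //; exact: relcpt_sub.
rewrite -oppr_le0 -lee_fin; apply: (@le_trans _ _ (mneg O dl O)); last by rewrite n0.
apply: ereal_sup_ubound; exists F => //.
by split => //; exact: relcpt_sub.
Qed.

Lemma dmeasureP T : (exists mu, Mloc O mu /\ represents O mu T) ->
  Mloc O (dmeasure O T) /\ represents O (dmeasure O T) T.
Proof. by move=> /getPex. Qed.

End representation.

(** * Lebesgue measure on row vectors *)

Section lebesgue_cons.
Context {R : realType} {n : nat}.

Definition rcons_fst (x : measurableTypeR R * 'rV[R]_n) : 'rV[R]_n.+1 :=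
  row_mx (const_mx x.1 : 'rV[R]_1) x.2.

Lemma rcons_fst0 x : rcons_fst x 0 (lshift n (0 : 'I_1)) = x.1.
Proof. by rewrite /rcons_fst (row_mxEl (const_mx x.1 : 'rV[R]_1)) mxE. Qed.

Lemma rcons_fstS x (j : 'I_n) : rcons_fst x 0 (rshift 1 j) = x.2 0 j.
Proof. by rewrite /rcons_fst (row_mxEr (const_mx x.1 : 'rV[R]_1)). Qed.

Lemma rcons_fst_cube (c : 'rV[R]_n.+1) (r : R) : 0 < r ->
  rcons_fst @^-1` cube c r =
  ball (c 0 (lshift n (0 : 'I_1)) : R) r `*` cube (\row_j c 0 (rshift 1 j)) r.
Proof.
move=> r0; apply/seteqP; split=> [x /= h|x /= [h0 h] i].
  split=> [|i]; first by have := h (lshift n (0 : 'I_1)); rewrite rcons_fst0.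
  by have := h (rshift 1 i); rewrite rcons_fstS mxE.
have [j|j] := @split_ordP 1 n i => ->; last by have := h j; rewrite rcons_fstS mxE.
by rewrite (ord1 j) rcons_fst0.
Qed.

(** An open set is a countable union of cubes, and the preimage of a cube is a rectangle. So Borel
    sets of rows pull back to the product sigma-algebra. *)
Lemma measurable_rcons_fst : measurable_fun setT rcons_fst.
Proof.
apply: (@measurability _ _ _ _ _ _ (@open 'rV[R]_n.+1)) => // _ [U oU <-].
rewrite setTI (bigcup_qcube oU) preimage_bigcup; apply: bigcup_measurable => j _.
rewrite rcons_fst_cube ?qrad_gt0//; apply: measurableX.
  exact: measurable_ball.
apply: measurable_open; exact: open_cube (qrad_gt0 _).
Qed.

End lebesgue_cons.

Section image_measure.
Local Open Scope ereal_scope.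
Context d1 d2 (T1 : measurableType d1) (T2 : measurableType d2) (R : realType).

Lemma image_measure (m : {measure set T1 -> \bar R}) (f : T1 -> T2) :
  measurable_fun setT f ->
  exists m' : {measure set T2 -> \bar R}, forall A, m' A = m (f @^-1` A).
Proof.
move=> mf; pose nu A := m (f @^-1` A).
have nu0 : nu set0 = 0 by rewrite /nu preimage_set0 measure0.
have nuge0 A : 0 <= nu A by exact: measure_ge0.
have nus : semi_sigma_additive nu.
  move=> F mF tF mUF; rewrite /nu preimage_bigcup.
  apply: measure_semi_sigma_additive.
  - by move=> n; rewrite -[X in measurable X]setTI; exact: mf.
  - apply/trivIsetP => /= i j _ _ ij; rewrite -preimage_setI.
    by move/trivIsetP : tF => /(_ _ _ _ _ ij) ->//; rewrite preimage_set0.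
  - by rewrite -preimage_bigcup -[X in measurable X]setTI; exact: mf.
pose M := isMeasure.Build _ T2 R nu nu0 nuge0 nus.
pose m' : {measure set T2 -> \bar R} := HB.pack nu M.
by exists m'.
Qed.

Lemma sigma_finite_pack (m : {measure set T1 -> \bar R}) : sigma_finite setT m ->
  exists m' : {sigma_finite_measure set T1 -> \bar R}, (m' : set T1 -> \bar R) = m.
Proof.
move=> sm; pose S0 := isSFinite.Build _ T1 R m (sfinite_measure_sigma_finite sm).
pose S := isSigmaFinite.Build _ T1 R m sm.
pose m' : {sigma_finite_measure set T1 -> \bar R} :=
  HB.pack (m : set T1 -> \bar R) S0 S (Measure.class m).
by exists m'.
Qed.

End image_measure.

Section lebesgue_rV.
Context {R : realType}.

(** On Borel sets the iterated integral is the image of a product measure, hence a measure. The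
    value on cubes is carried through the induction because it gives the sigma-finiteness with which
    the next product is formed. *)
Lemma lebN_measure n : exists L : {measure set 'rV[R]_n -> \bar R},
  (forall A, measurable A -> lebN A = L A) /\
  (forall (c : 'rV[R]_n) (r : R), 0 < r ->
    L (cube c r) = ((r *+ 2) ^+ n)%:E).
Proof.
elim: n => [|n [L [LE Lcube]]].
  exists (dirac (0 : 'rV[R]_0)); split=> // c r r0.
  rewrite (_ : cube c r = [set: 'rV[R]_0]); first by rewrite expr0; exact: diracT.
  by apply/seteqP; split=> // x _ [].
have sL : sigma_finite setT L.
  exists (fun k => cube 0 k.+1%:R).
    apply/seteqP; split=> // y _; have [k yk] : exists k : nat, `|y| < k%:R.
      by exists (Num.bound `|y|); exact: archi_boundP.
    exists k => // i; rewrite mxE sub0r normrN.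
    rewrite (@le_lt_trans _ _ `|y|)//; last first.
      by rewrite (lt_trans yk)// ltr_nat.
    rewrite [leRHS]/Num.norm/= mx_normrE.
    by apply: (@le_bigmax _ _ _ _ (fun ij : 'I_1 * 'I_n => `|y ij.1 ij.2|) (0, i)).
  move=> k; split; first by apply: measurable_open; exact: open_cube.
  by rewrite Lcube// ltry.
have [L' L'E] := sigma_finite_pack sL.
have [M ME] := image_measure (product_measure1 (@lebesgue_measure R) L')
  measurable_rcons_fst.
exists M; split=> [A mA|c r r0].
  rewrite ME /product_measure1 /=; apply: eq_integral => t _ /=.
  have mS : measurable [set v : 'rV[R]_n | A (row_mx (const_mx t : 'rV[R]_1) v)].
    rewrite (_ : [set _ | _] = xsection (rcons_fst @^-1` A) t).
      apply: measurable_xsection; rewrite -[X in measurable X]setTI.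
      exact: measurable_rcons_fst.
    by apply/seteqP; split=> v; rewrite /xsection /= ?inE.
  rewrite LE// L'E; congr (L _).
  by apply/seteqP; split=> v; rewrite /xsection /= ?inE.
rewrite ME rcons_fst_cube//.
apply: etrans (product_measure1E (@lebesgue_measure R) L' (measurable_ball _ _) _) _.
  by apply: measurable_open; exact: open_cube.
rewrite L'E Lcube// exprS EFinM; congr (_ * _)%E.
exact: lebesgue_measure_ball (ltW r0).
Qed.

End lebesgue_rV.

(** * Euclidean balls and points of density *)

Section euclidean_balls.
Context {R : realType} {N : nat}.
Notation E := 'rV[R]_N.
Implicit Types (x y v w : E) (r s : R).

Lemma sumsqr_ge0 v : 0 <= \sum_i v 0 i ^+ 2.
Proof. by apply: sumr_ge0 => i _; exact: sqr_ge0. Qed.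

Lemma enorm_ge0 v : 0 <= enorm v. Proof. exact: sqrtr_ge0. Qed.

Lemma enorm_sqr v : enorm v ^+ 2 = \sum_i v 0 i ^+ 2.
Proof. by rewrite sqr_sqrtr// sumsqr_ge0. Qed.

Lemma enormB x y : enorm (x - y) = enorm (y - x).
Proof.
by rewrite /enorm; congr Num.sqrt; apply: eq_bigr => i _; rewrite !mxE -sqrrN opprB.
Qed.

(** The sum of the squares (|w| v_i - |v| w_i)^2 equals 2 |v| |w| (|v| |w| - v.w), and one divides
    by |v| |w|. If that product is 0, one of the vectors is 0. *)
Lemma cauchy_schwarz v w : \sum_i v 0 i * w 0 i <= enorm v * enorm w.
Proof.
have a0 := enorm_ge0 v; have b0 := enorm_ge0 w.
set a := enorm v in a0 *; set b := enorm w in b0 *.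
have key : 0 <= \sum_i (b * v 0 i - a * w 0 i) ^+ 2.
  by apply: sumr_ge0 => i _; exact: sqr_ge0.
have E1 : \sum_i (b * v 0 i - a * w 0 i) ^+ 2 =
    b ^+ 2 * a ^+ 2 + a ^+ 2 * b ^+ 2 - 2 * (a * b) * \sum_i v 0 i * w 0 i.
  rewrite [in RHS](enorm_sqr v : a ^+ 2 = _) [in RHS](enorm_sqr w : b ^+ 2 = _).
  rewrite -(enorm_sqr w) -/b -(enorm_sqr v) -/a.
  rewrite {1}(enorm_sqr v : a ^+ 2 = _) {2}(enorm_sqr w : b ^+ 2 = _) !mulr_sumr.
  rewrite -big_split/= -sumrB; apply: eq_bigr => i _; ring.
have [ab0|ab0] := eqVneq (a * b) 0.
  rewrite ab0; have [a00|b00] : a = 0 \/ b = 0.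
  - by move/eqP: ab0; rewrite mulf_eq0 => /orP[/eqP|/eqP]; [left|right].
  - rewrite big1// => i _; have : \sum_i v 0 i ^+ 2 = 0 by rewrite -enorm_sqr -/a a00 expr0n.
    move/eqP; rewrite psumr_eq0 => [/allP/(_ i)|j _]; last exact: sqr_ge0.
    by rewrite mem_index_enum sqrf_eq0 => /(_ isT) /eqP ->; rewrite mul0r.
  - rewrite big1// => i _; have : \sum_i w 0 i ^+ 2 = 0 by rewrite -enorm_sqr -/b b00 expr0n.
    move/eqP; rewrite psumr_eq0 => [/allP/(_ i)|j _]; last exact: sqr_ge0.
    by rewrite mem_index_enum sqrf_eq0 => /(_ isT) /eqP ->; rewrite mulr0.
have abp : 0 < a * b by rewrite lt0r ab0 mulr_ge0.
by rewrite E1 in key; nra.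
Qed.

Lemma enorm_triangle v w : enorm (v + w) <= enorm v + enorm w.
Proof.
rewrite -(@ler_pXn2r _ 2)// ?nnegrE ?addr_ge0 ?enorm_ge0//.
rewrite sqrrD !enorm_sqr.
have -> : \sum_i (v + w) 0 i ^+ 2 =
    \sum_i v 0 i ^+ 2 + (\sum_i v 0 i * w 0 i) *+ 2 + \sum_i w 0 i ^+ 2.
  rewrite -sumrMnl -!big_split/=; apply: eq_bigr => i _; rewrite !mxE; ring.
by rewrite lerD2r lerD2l lerMn2r/= cauchy_schwarz.
Qed.

Lemma eball_sub x y r s : enorm (y - x) + s <= r -> eball y s `<=` eball x r.
Proof.
rewrite /eball => h z /= zy; apply: (lt_le_trans _ h).
apply: (@le_lt_trans _ _ (enorm (z - y) + enorm (y - x))); last first.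
  by rewrite [ltRHS]addrC ltrD2r.
by rewrite (le_trans _ (enorm_triangle _ _))// addrA subrK.
Qed.

Lemma eballS x r s : r <= s -> eball x r `<=` eball x s.
Proof. by move=> rs y /= h; exact: lt_le_trans rs. Qed.

Lemma eball_center x r : 0 < r -> eball x r x.
Proof.
move=> r0; rewrite /eball/= subrr /enorm big1 ?sqrtr0// => i _.
by rewrite mxE expr0n.
Qed.

Lemma ler_enorm v i : `|v 0 i| <= enorm v.
Proof.
rewrite -(@ler_pXn2r _ 2)// ?nnegrE ?enorm_ge0// enorm_sqr real_normK ?num_real//.
by rewrite (bigD1 i)//= lerDl; apply: sumr_ge0 => j _; exact: sqr_ge0.
Qed.

Lemma eball_cube x r :
  eball x r `<=` cube x r.
Proof.
move=> y /= yx i; rewrite distrC (le_lt_trans _ yx)//.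
by have := ler_enorm (y - x) i; rewrite !mxE.
Qed.

(** N (r/(N+1))^2 < r^2. Taking N+1 in place of N makes the inequality strict and also covers
    dimension 0. *)
Lemma cube_eball x r : 0 < r ->
  cube x (r / N.+1%:R) `<=` eball x r.
Proof.
move=> r0 y /= h; rewrite /eball/=.
rewrite -(@ltr_pXn2r _ 2)// ?nnegrE ?enorm_ge0 ?(ltW r0)// enorm_sqr.
apply: (@le_lt_trans _ _ (\sum_(i < N) (r / N.+1%:R) ^+ 2)).
  apply: ler_sum => i _; rewrite !mxE -[leLHS]real_normK ?num_real// distrC.
  by rewrite ler_pXn2r// ?nnegrE ?divr_ge0 ?(ltW r0)// ltW.
rewrite sumr_const card_ord -[ltLHS]mulr_natr expr_div_n -mulrA [X in _ * X]mulrC.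
rewrite -[ltRHS]mulr1 ltr_pM2l ?exprn_gt0// ltr_pdivrMr ?exprn_gt0// mul1r.
by rewrite -natrX ltr_nat (leq_trans (ltnSn N))// -mulnn leq_pmulr.
Qed.

Lemma open_from_nbhs (V : set E) : (forall x, V x -> nbhs x V) -> open V.
Proof. by move=> h; rewrite openE. Qed.

Lemma open_eball x r : open (eball x r).
Proof.
apply: open_from_nbhs => y /= yx; set s := r - enorm (y - x).
have s0 : 0 < s by rewrite subr_gt0.
apply: filterS (_ : eball y s `<=` _) _.
  by apply: eball_sub; rewrite /s addrC subrK.
apply: filterS (@cube_eball y s s0) _.
apply: open_nbhs_nbhs; split; first by apply: open_cube; rewrite divr_gt0.
by move=> i; rewrite subrr normr0 divr_gt0.
Qed.

Lemma measurable_eball x r : measurable (eball x r).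
Proof. by apply: measurable_open; exact: open_eball. Qed.

Lemma eball_nbhs (O : set E) x : open O -> O x -> exists2 r, 0 < r & eball x r `<=` O.
Proof.
move=> oO Ox; have := open_nbhs_nbhs (conj oO Ox).
move=> /nbhs_ballP[r /= r0 rO]; exists r => //.
move=> y /eball_cube yx; apply: rO; split => // i0 i; rewrite (ord1 i0); exact: yx.
Qed.

End euclidean_balls.

Section density_points.
Context {R : realType} {N : nat}.
Notation E := 'rV[R]_N.
Implicit Types (A B O : set E) (x y : E) (r s d : R).
Variable L : {measure set E -> \bar R}.
Hypothesis LE : forall A, measurable A -> lebN A = L A.
Hypothesis Lcube : forall (c : E) r, 0 < r ->
  L (cube c r) = ((r *+ 2) ^+ N)%:E.

Let lball A x r : R := fine (L (A `&` eball x r)).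

Let mI A x r : measurable A -> measurable (A `&` eball x r).
Proof. by move=> mA; apply: measurableI => //; exact: measurable_eball. Qed.

Let L_eball_lty x r : 0 < r -> (L (eball x r) < +oo)%E.
Proof.
move=> r0; apply: (@le_lt_trans _ _ (L (cube x r))); last by rewrite Lcube// ltry.
apply: le_measure (@eball_cube _ _ x r); rewrite inE; first exact: measurable_eball.
by apply: measurable_open; exact: open_cube.
Qed.

Let L_eball_gt0 x r : 0 < r -> (0 < L (eball x r))%E.
Proof.
move=> r0; have r1 : 0 < r / N.+1%:R by rewrite divr_gt0.
apply: (@lt_le_trans _ _ (L (cube x (r / N.+1%:R)))).
  by rewrite Lcube// lte_fin exprn_gt0// pmulrn_lgt0.
apply: le_measure (@cube_eball _ _ x r r0); rewrite inE; last exact: measurable_eball.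
by apply: measurable_open; exact: open_cube.
Qed.

Let LI_fin A x r : 0 < r -> measurable A -> L (A `&` eball x r) \is a fin_num.
Proof.
move=> r0 mA; rewrite ge0_fin_numE ?measure_ge0//.
apply: le_lt_trans (L_eball_lty x r0).
by rewrite le_measure ?inE//; [exact: mI|exact: measurable_eball].
Qed.

Let L_eball_fin x r : 0 < r -> L (eball x r) \is a fin_num.
Proof. by move=> r0; rewrite ge0_fin_numE ?measure_ge0//; exact: L_eball_lty. Qed.

Let ball_gt0 x r : 0 < r -> 0 < fine (L (eball x r)).
Proof. by move=> r0; rewrite fine_gt0// L_eball_gt0//= L_eball_lty. Qed.

Let ratio A x r : R := lball A x r / fine (L (eball x r)).

Let has_densityE A x d : measurable A ->
  has_density A x d <-> ratio A x r @[r --> 0^'+] --> d.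
Proof.
move=> mA; rewrite /has_density.
suff -> : (fun r => fine (lebN (A `&` eball x r)) / fine (lebN (eball x r))) =
  ratio A x by [].
apply/funext => r; rewrite /ratio /lball !LE//.
  exact: measurable_eball.
exact: mI.
Qed.

Let ratioC A x r : 0 < r -> measurable A -> ratio (~` A) x r = 1 - ratio A x r.
Proof.
move=> r0 mA; have b0 := ball_gt0 x r0.
rewrite /ratio -[X in X - _](@divff _ (fine (L (eball x r)))) ?gt_eqF// -mulrBl.
congr (_ / _); rewrite /lball.
have LC : L (eball x r) = (L (A `&` eball x r) + L (~` A `&` eball x r))%E.
  rewrite -measureU.
  - by rewrite -setIUl setUv setTI.
  - exact: mI.
  - by apply: mI; exact: measurableC.
  - by rewrite setIACA setICr set0I.
have mC := measurableC mA.
rewrite LC -(fineK (LI_fin x r0 mA)) -(fineK (LI_fin x r0 mC)) -EFinD /=.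
by rewrite addrC addKr.
Qed.

Lemma has_densityC A x d : measurable A -> has_density A x d ->
  has_density (~` A) x (1 - d).
Proof.
move=> mA /(has_densityE _ _ mA) Ad; apply/has_densityE; first exact: measurableC.
have c : 1 - ratio A x r @[r --> 0^'+] --> 1 - d by apply: cvgB => //; exact: cvg_cst.
apply: cvg_trans c; apply: near_eq_cvg; near=> r.
by rewrite ratioC//; near: r; exact: nbhs_right_gt.
Unshelve. all: by end_near. Qed.

Lemma has_density_local A B x r0 d : 0 < r0 ->
  A `&` eball x r0 = B `&` eball x r0 -> has_density A x d -> has_density B x d.
Proof.
move=> r00 AB; apply: cvg_trans; apply: near_eq_cvg; near=> r.
have rr0 : r <= r0 by near: r; exact: nbhs_right_le.
have sub C : C `&` eball x r = C `&` eball x r0 `&` eball x r.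
  by rewrite -setIA (setIidr (eballS rr0)).
by rewrite (sub A) (sub B) AB.
Unshelve. all: by end_near. Qed.

Lemma has_density_unique A x d d' : has_density A x d -> has_density A x d' -> d = d'.
Proof. by move=> h h'; apply: (cvg_unique _ h h'). Qed.

Lemma has_density0 x : has_density set0 x 0.
Proof.
apply/has_densityE => //; apply: cvg_near_cst; near=> r.
by rewrite /ratio /lball set0I measure0 mul0r.
Unshelve. all: by end_near. Qed.

Lemma has_densityT x : has_density setT x 1.
Proof.
have := has_densityC (@measurable0 _ _) (has_density0 x).
by rewrite setC0 subr0.
Qed.

Lemma density1C A x : measurable A -> density1 (~` A) x <-> has_density A x 0.
Proof.
move=> mA; split=> [h|/(has_densityC mA)]; last by rewrite subr0.
have := has_densityC (measurableC mA) h.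
by rewrite setCK subrr.
Qed.

Lemma density1_disjoint A x : measurable A -> density1 A x -> density1 (~` A) x -> False.
Proof.
move=> mA h /(density1C _ mA) /(has_density_unique h)/eqP.
by rewrite oner_eq0.
Qed.

Lemma null_density A x y r : measurable A -> L (A `&` eball x r) = 0%E ->
  eball x r y -> has_density A y 0.
Proof.
move=> mA A0 yx; have s0 : 0 < r - enorm (y - x) by rewrite subr_gt0.
apply/has_densityE => //; apply: cvg_near_cst; near=> s.
rewrite /ratio /lball (_ : L _ = 0%E) ?mul0r//.
apply/eqP; rewrite eq_le measure_ge0 andbT -A0 le_measure ?inE//; try exact: mI.
apply: setIS; apply: eball_sub; rewrite addrC -lerBrDr.
near: s; exact: nbhs_right_le.
Unshelve. all: by end_near. Qed.

(** If a strict inequality fails at radius r, then [A] or its complement is null in that ball. The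
    same holds in every smaller ball inside it, so all its points have density 0 or 1 and none lies
    in [bndm A]. *)
Lemma bndm_local A x : measurable A -> ~ bndm A x -> exists W : set E,
  [/\ open W, W x, W `&` bndm A = set0 &
     W `<=` density1 (~` A) \/ W `<=` density1 A].
Proof.
move=> mA; rewrite /bndm /= -existsNE => -[r /not_implyP[r0]].
rewrite !LE; [|exact: measurable_eball|exact: mI].
move=> nb; exists (eball x r).
have case2 : L (A `&` eball x r) = 0%E \/ L (~` A `&` eball x r) = 0%E.
  have [|/negP] := boolP (0 < L (A `&` eball x r))%E; last first.
    by rewrite lt0e measure_ge0 andbT => /negP; rewrite negbK => /eqP; left.
  move=> p; right; have ge : ~~ (L (A `&` eball x r) < L (eball x r))%E.
    by apply/negP => lt; apply: nb.
  rewrite -leNgt in ge.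
  have : ratio (~` A) x r <= 0.
    rewrite ratioC// subr_le0 /ratio ler_pdivlMr ?ball_gt0// mul1r.
    by rewrite fine_le// ?L_eball_fin// LI_fin.
  rewrite /ratio pmulr_lle0 ?invr_gt0 ?ball_gt0// => h.
  have mC := measurableC mA.
  apply/eqP; rewrite eq_le measure_ge0 andbT -(fineK (LI_fin x r0 mC)) lee_fin.
  exact: h.
split.
- exact: open_eball.
- exact: eball_center.
- rewrite -subset0 => y [yx yb]; set s := r - enorm (y - x).
  have s0 : 0 < s by rewrite subr_gt0.
  have sub : eball y s `<=` eball x r by apply: eball_sub; rewrite /s addrC subrK.
  have [] := yb s s0; rewrite !LE; [|exact: measurable_eball|exact: mI].
  case: case2 => [A0 p _|A0 _ lt].
    have : (L (A `&` eball y s) <= 0)%E.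
      by rewrite -A0 le_measure ?inE//; [exact: mI|exact: mI|exact: setIS].
    by rewrite leNgt p.
  have C0 : L (~` A `&` eball y s) = 0%E.
    apply/eqP; rewrite eq_le measure_ge0 andbT -A0 le_measure ?inE//.
    - by apply: mI; exact: measurableC.
    - by apply: mI; exact: measurableC.
    - exact: setIS.
  have := ratioC y s0 mA; rewrite {1}/ratio /lball C0 mul0r => /esym/eqP.
  rewrite subr_eq0 => /eqP/esym/divr1_eq h; move: lt; rewrite /lball in h.
  by rewrite -(fineK (LI_fin y s0 mA)) h fineK ?L_eball_fin// ltxx.
- case: case2 => [A0|A0]; [left=> y yx|right=> y yx].
    by apply/density1C => //; exact: null_density A0 yx.
  rewrite -(setCK A); apply/density1C; first exact: measurableC.
  by apply: null_density A0 yx; exact: measurableC.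
Qed.

(** An open ball is the increasing union of smaller concentric ones, so the measure is left
    continuous in the radius; a rational fits between the smaller radius and r. *)
Lemma L_eball_left A x r (c : \bar R) : measurable A -> (c < L (A `&` eball x r))%E ->
  exists q : rat, ratr q < r /\ (c < L (A `&` eball x (ratr q)))%E.
Proof.
move=> mA cL; pose s (k : nat) : R := r - k.+1%:R^-1.
have cup : \bigcup_k (A `&` eball x (s k)) = A `&` eball x r.
  rewrite -setI_bigcupr; congr (_ `&` _); apply/seteqP; split=> [y [k _]|y yx].
    by apply: eballS; rewrite gerBl invr_ge0.
  have d0 : 0 < r - enorm (y - x) by rewrite subr_gt0.
  have [m _ /(_ m)] := @near_infty_natSinv_lt R (PosNum d0).
  rewrite /= leqnn => /(_ isT) h; exists m => //.
  by rewrite /eball /= /s ltrBrDl -ltrBrDr.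
have nd : nondecreasing_seq (fun k => A `&` eball x (s k)).
  move=> p q pq; apply/subsetPset; apply: setIS; apply: eballS.
  by rewrite lerB// lef_pV2 ?posrE ?ltr0n// ler_nat.
have mAs k : measurable (A `&` eball x (s k)) by exact: mI.
have := nondecreasing_cvg_mu (mu := L) mAs (bigcupT_measurable _ mAs) nd.
rewrite cup => cv.
have [k ck] : exists k, (c < L (A `&` eball x (s k)))%E.
  apply: contrapT => /forallNP h; move: cL; apply/negP; rewrite -leNgt.
  have cc : (fun _ : nat => c) @ \oo --> c by exact: cvg_cst.
  by apply: (le_ecvg cv cc) => k /=; rewrite leNgt; exact/negP/h.
have skr : s k < r by rewrite gtrBl invr_gt0.
have [q] := rat_in_itvoo skr; rewrite in_itv/= => /andP[sq qr].
exists q; split=> //; apply: (lt_le_trans ck).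
rewrite le_measure ?inE//; first exact: mI.
by apply: setIS; apply: eballS; exact: ltW.
Qed.

(** A slightly smaller ball about [x] still has measure above [c], and it is contained in the ball
    of radius r about every centre near [x]. *)
Lemma L_eball_lsc A r (c : \bar R) : measurable A ->
  open [set x | (c < L (A `&` eball x r))%E].
Proof.
move=> mA; apply: open_from_nbhs => x /= cx; have [q [qr cq]] := L_eball_left mA cx.
have d0 : 0 < r - ratr q by rewrite subr_gt0.
apply: filterS (_ : eball x (r - ratr q) `<=` _) _.
  move=> y yx /=; apply: (lt_le_trans cq).
  rewrite le_measure ?inE//; [exact: mI|exact: mI|].
  apply: setIS; apply: eball_sub; rewrite -lerBrDr enormB.
  exact: ltW.
by apply: open_nbhs_nbhs; split; [exact: open_eball|exact: eball_center].
Qed.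

Lemma measurable_lball A r : measurable A -> measurable_fun setT (fun x => lball A x r).
Proof.
move=> mA.
have mL : measurable_fun setT (fun x => L (A `&` eball x r)).
  apply: (measurability _ (ErealGenOInfty.measurableE R)).
  move=> _ [_ [a ->] <-]; rewrite setTI preimage_itvoy; apply: measurable_open.
  exact: L_eball_lsc.
exact: measurableT_comp mL.
Qed.

(* By left continuity in the radius, rational radii decide whether the density
   is 1. *)
Lemma measurable_density1 A : measurable A -> measurable (density1 A).
Proof.
move=> mA; pose G (e : R) (q : rat) := [set x | (1 - e) * lball setT x (ratr q) <= lball A x (ratr q)].
have mG e q : measurable (G e q).
  have mf : measurable_fun setT (fun x => lball A x (ratr q) - (1 - e) * lball setT x (ratr q)).
    apply: measurable_funB; first exact: measurable_lball.
    by apply: measurable_funM => //; exact: measurable_lball.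
  rewrite (_ : G e q = (fun x => lball A x (ratr q) - (1 - e) * lball setT x (ratr q)) @^-1` `[0, +oo[).
    by rewrite -[X in measurable X]setTI; exact: mf.
  by apply/seteqP; split=> x; rewrite /G /= in_itv/= andbT subr_ge0.
(* An enumeration of the rationals. The default 0 for codes that decode to nothing is discarded by
   the condition that the radius be positive. *)
pose rt (j : nat) : rat := odflt 0 (unpickle j).
rewrite (_ : density1 A = \bigcap_m \bigcup_n
    \bigcap_(j in [set j | (0 < ratr (rt j) :> R) && (ratr (rt j) < n.+1%:R^-1 :> R)])
      G m.+1%:R^-1 (rt j)).
  apply: bigcapT_measurable => m; apply: bigcupT_measurable => n.
  by apply: bigcap_measurableType => j _; exact: mG.
have lballT x r : lball setT x r = fine (L (eball x r)) by rewrite /lball setTI.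
apply/seteqP; split=> [x /(has_densityE _ _ mA) h m _|x h].
  have e0 : 0 < (m.+1%:R^-1 : R) by rewrite invr_gt0.
  have /cvgrPdist_lt /(_ _ e0) := h.
  move=> /nbhs_ballP[d /= d0 hd].
  have [n _ /(_ n)] := @near_infty_natSinv_lt R (PosNum d0).
  rewrite /= leqnn => /(_ isT) nd; exists n => // j /=; set q := rt j => /andP[q0 qn].
  have := hd (ratr q); rewrite /ball /= sub0r normrN gtr0_norm// => /(_ (lt_trans qn nd) q0).
  rewrite /G /= lballT /ratio => hq.
  rewrite -ler_pdivlMr ?ball_gt0// lerBlDr -lerBlDl.
  exact: le_trans (ler_norm _) (ltW hq).
apply/has_densityE => //; apply/cvgrPdist_le => e e0.
have [m _ /(_ m)] := @near_infty_natSinv_lt R (PosNum e0).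
rewrite /= leqnn => /(_ isT) me; have [n _ hn] := h m I.
have n0 : 0 < (n.+1%:R^-1 : R) by rewrite invr_gt0.
near=> r.
have r0 : 0 < r by near: r; exact: nbhs_right_gt.
have rn : r < n.+1%:R^-1 by near: r; exact: nbhs_right_lt.
have b0 := ball_gt0 x r0.
have le1 : lball A x r <= fine (L (eball x r)).
  rewrite fine_le ?LI_fin ?L_eball_fin// le_measure ?inE//.
  - exact: mI.
  - exact: measurable_eball.
rewrite ger0_norm; last by rewrite subr_ge0 /ratio ler_pdivrMr// mul1r.
rewrite lerBlDr -lerBlDl /ratio ler_pdivlMr//.
apply: (@le_trans _ _ ((1 - m.+1%:R^-1) * fine (L (eball x r)))).
  by rewrite ler_pM2r// lerB// ltW.
(* If the bound fails at the real radius r, left continuity gives a rational q < r at which the full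
   ball is still larger than L(A ∩ B_r)/(1 - 1/(m+1)). Since L(A ∩ B_q) <= L(A ∩ B_r), the bound
   would fail at q as well. *)
rewrite leNgt; apply/negP => lt.
have c0 : 0 <= 1 - m.+1%:R^-1 :> R.
  by rewrite subr_ge0 invf_le1// ler1n.
have A0 y s : 0 <= lball A y s by exact/fine_ge0/measure_ge0.
have c1 : 0 < 1 - m.+1%:R^-1 :> R.
  rewrite lt0r c0 andbT; apply/eqP => c00; move: lt; rewrite c00 mul0r.
  by rewrite ltNge A0.
have : ((lball A x r / (1 - m.+1%:R^-1))%:E < L (setT `&` eball x r))%E.
  by rewrite setTI -(fineK (L_eball_fin x r0)) lte_fin ltr_pdivrMr// mulrC.
move=> /(L_eball_left measurableT)[q [qr]]; rewrite setTI => cq.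
have q0 : 0 < ratr q :> R.
  rewrite ltNge; apply/negP => q0; move: cq; rewrite (_ : eball x _ = set0); last first.
    rewrite -subset0 => y; rewrite /eball /= => /lt_le_trans/(_ q0).
    by rewrite ltNge enorm_ge0.
  by rewrite measure0 lte_fin ltNge divr_ge0// ltW.
have := hn (pickle q); rewrite /= /rt pickleK /= q0 (lt_trans qr rn) => /(_ isT); rewrite /G /= lballT.
move: cq; rewrite -(fineK (L_eball_fin x q0)) lte_fin ltr_pdivrMr// mulrC => l1 l2.
have : lball A x (ratr q) <= lball A x r.
  rewrite fine_le ?LI_fin// le_measure ?inE//; try exact: mI.
  by apply: setIS; apply: eballS; exact: ltW.
by rewrite leNgt (lt_le_trans l1 l2).
Unshelve. all: by end_near. Qed.

Lemma measurable_essbnd A : measurable A -> measurable (essbnd A).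
Proof.
move=> mA; apply: measurableC; apply: measurableU; apply: measurable_density1 => //.
exact: measurableC.
Qed.

End density_points.

(** * Traces of indicator functions *)

Section indicator_traces.
Context {R : realType} {N : nat}.
Notation E := 'rV[R]_N.
Variable L : {measure set E -> \bar R}.
Hypothesis LE : forall A, measurable A -> lebN A = L A.
Hypothesis Lcube : forall (c : E) (r : R), 0 < r ->
  L (cube c r) = ((r *+ 2) ^+ N)%:E.
Variables (O A : set E) (oO : open O) (mA : measurable A).

(** The density at a point of the open set [O] only depends on a small ball inside [O]. The level
    sets of [uminus] and [uplus] are cut off by [O], and this removes the cut. *)
Let local_density (S B : set E) x (d : R) : O x -> S `&` O = B `&` O ->
  has_density S x d <-> has_density B x d.
Proof.
move=> Ox SB; have [r r0 rO] := eball_nbhs oO Ox.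
have rE : S `&` eball x r = B `&` eball x r.
  by rewrite -(setIidr rO) !setIA SB.
by split; apply: (has_density_local r0).
Qed.

Let indicP y : (A y /\ \1_A y = 1 :> R) \/ (~ A y /\ \1_A y = 0 :> R).
Proof.
by rewrite indicE; have [Ay|Ay] := pselect (A y); [left; rewrite mem_set|right; rewrite memNset].
Qed.

Let below_setE (t : \bar R) : (0 < t)%E -> (t <= 1)%E ->
  [set y | O y /\ ((\1_A y)%:E < t)%E] `&` O = ~` A `&` O.
Proof.
move=> t0 t1; apply/seteqP; split=> y /=.
  move=> [[Oy +] _]; have [[Ay ->]|[]//] := indicP y.
  by rewrite ltNge t1.
by move=> [Ay Oy]; have [[]//|[_ ->]] := indicP y.
Qed.

Let above_setE (t : \bar R) : (0 <= t)%E -> (t < 1)%E ->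
  [set y | O y /\ (t < (\1_A y)%:E)%E] `&` O = A `&` O.
Proof.
move=> t0 t1; apply/seteqP; split=> y /=.
  move=> [[Oy +] _]; have [[]//|[Ay ->]] := indicP y.
  by rewrite ltNge t0.
by move=> [Ay Oy]; have [[_ ->]|[]//] := indicP y.
Qed.

Let not_full x (S : set E) : O x -> S `&` O = setT `&` O -> ~ has_density S x 0.
Proof.
move=> Ox SO /(local_density _ Ox SO) h.
have := has_density_unique h (has_densityT LE Lcube x).
by move/esym/eqP; rewrite oner_eq0.
Qed.

Let below_gt1 x (t : \bar R) : O x -> (1 < t)%E ->
  ~ has_density [set y | O y /\ ((\1_A y)%:E < t)%E] x 0.
Proof.
move=> Ox t1; apply: not_full => //; apply/seteqP; split=> y /= [] //.
move=> _ Oy; split => //; split=> //.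
have [[_ ->]//|[_ ->]] := indicP y.
by apply: lt_trans t1; rewrite lte_fin.
Qed.

Let above_lt0 x (t : \bar R) : O x -> (t < 0)%E ->
  ~ has_density [set y | O y /\ (t < (\1_A y)%:E)%E] x 0.
Proof.
move=> Ox t1; apply: not_full => //; apply/seteqP; split=> y /= [] //.
move=> _ Oy; split => //; split=> //.
have [[_ ->]|[_ ->]//] := indicP y.
by apply: (lt_trans t1); rewrite lte_fin.
Qed.

Lemma below_le0 B x (t : \bar R) : (t <= 0)%E ->
  has_density [set y | O y /\ ((\1_B y : R)%:E < t)%E] x 0.
Proof.
move=> t0; rewrite (_ : [set _ | _] = set0); first exact: has_density0 LE x.
rewrite -subset0 => y /= [_]; rewrite ltNge => /negP; apply.
by rewrite (le_trans t0)// lee_fin indicE.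
Qed.

Lemma above_ge1 B x (t : \bar R) : (1 <= t)%E ->
  has_density [set y | O y /\ (t < (\1_B y : R)%:E)%E] x 0.
Proof.
move=> t0; rewrite (_ : [set _ | _] = set0); first exact: has_density0 LE x.
rewrite -subset0 => y /= [_]; rewrite ltNge => /negP; apply.
by rewrite (le_trans _ t0)// lee_fin indicE lern1; case: (y \in B).
Qed.

(** Inside [O] the set where the indicator is below t is empty for t <= 0, the complement of [A] for
    0 < t <= 1, and everything for t > 1. The supremum is thus 1 or 0, depending on whether the
    complement has density 0. The four evaluations all follow this scheme. *)
Lemma uminus_indic1 x : O x -> density1 A x -> uminus O \1_A x = 1%E.
Proof.
move=> Ox Ax; apply/eqP; rewrite eq_le; apply/andP; split.
  apply: ge_ereal_sup => t /= h; rewrite leNgt; apply/negP => t1.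
  exact: below_gt1 Ox t1 h.
apply: ereal_sup_ubound => /=; apply/(local_density _ Ox); first exact: below_setE.
apply/(density1C LE Lcube); first exact: measurableC.
by rewrite setCK.
Qed.

Lemma uminus_indic0 x : O x -> ~ density1 A x -> uminus O \1_A x = 0%E.
Proof.
move=> Ox Ax; apply/eqP; rewrite eq_le; apply/andP; split.
  apply: ge_ereal_sup => t /= h; rewrite leNgt; apply/negP => t0.
  have [t1|t1] := leP t 1%E; last exact: below_gt1 Ox t1 h.
  apply: Ax; rewrite -(setCK A); apply/(density1C LE Lcube); first exact: measurableC.
  exact/(local_density _ Ox (below_setE t0 t1)).
by apply: ereal_sup_ubound => /=; exact: below_le0.
Qed.

Lemma uplus_indic0 x : O x -> density1 (~` A) x -> uplus O \1_A x = 0%E.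
Proof.
move=> Ox Ax; apply/eqP; rewrite eq_le; apply/andP; split.
  apply: ereal_inf_lbound => /=; apply/(local_density _ Ox); first exact: above_setE.
  exact/(density1C LE Lcube).
apply: le_ereal_inf_tmp => t /= h; rewrite leNgt; apply/negP => t1.
exact: above_lt0 Ox t1 h.
Qed.

Lemma uplus_indic1 x : O x -> ~ density1 (~` A) x -> uplus O \1_A x = 1%E.
Proof.
move=> Ox Ax; apply/eqP; rewrite eq_le; apply/andP; split.
  by apply: ereal_inf_lbound => /=; exact: above_ge1.
apply: le_ereal_inf_tmp => t /= h; rewrite leNgt; apply/negP => t1.
have [t0|t0] := leP 0%E t; last exact: above_lt0 Ox t0 h.
apply: Ax; apply/(density1C LE Lcube) => //.
exact/(local_density _ Ox (above_setE t0 t1)).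
Qed.

Definition trace_indic (lam : E -> R) (x : E) : R :=
  \1_(density1 A) x + lam x * \1_(essbnd A) x.

Lemma ulam_indic (lam : E -> R) x : O x -> ulam O lam \1_A x = (trace_indic lam x)%:E.
Proof.
move=> Ox; rewrite /ulam /trace_indic !indicE.
have [A1|A1] := pselect (density1 A x).
  have C1 : ~ density1 (~` A) x by exact: (density1_disjoint LE Lcube mA).
  rewrite (uminus_indic1 Ox A1) (uplus_indic1 Ox C1) /=.
  rewrite (mem_set A1) memNset; last by rewrite /essbnd /=; apply; left.
  by rewrite !mule1 -EFinD mulr0 addr0 subrK.
rewrite (uminus_indic0 Ox A1) (memNset A1).
have [C1|C1] := pselect (density1 (~` A) x).
  rewrite (uplus_indic0 Ox C1) /= memNset; last by rewrite /essbnd /=; apply; right.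
  by rewrite !mule0 adde0 mulr0 addr0.
rewrite (uplus_indic1 Ox C1) /= mem_set; last by rewrite /essbnd /= => -[].
by rewrite mule0 mule1 add0e mulr1 add0r.
Qed.

End indicator_traces.

Section indicator_traces_global.
Context {R : realType} {N : nat}.
Notation E := 'rV[R]_N.
Variables (O : set E).

(** This holds at every [x], also outside [O], and excludes the exceptional branch of [ulam]. The
    next two identities are therefore equalities of functions on the whole space and can be
    rewritten inside [msupp]. *)
Lemma uplus_indic_lty (A : set E) x : (uplus O \1_A x < +oo)%E.
Proof.
have [L [LE Lc]] := @lebN_measure R N; apply: (@le_lt_trans _ _ 1%E); last exact: ltry.
by apply: ereal_inf_lbound => /=; exact: (above_ge1 LE).
Qed.

Lemma ulam_indic_cst0 (A : set E) : ulam O (cst 0) \1_A = uminus O \1_A.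
Proof.
apply/funext => x; rewrite /ulam lt_eqF ?uplus_indic_lty//=.
by rewrite subr0 mul1e mul0e adde0.
Qed.

Lemma ulam_indic_cst1 (A : set E) : ulam O (cst 1) \1_A = uplus O \1_A.
Proof.
apply/funext => x; rewrite /ulam lt_eqF ?uplus_indic_lty//=.
by rewrite subrr mul1e mul0e add0e.
Qed.

End indicator_traces_global.

(** * Total variation and supports *)

Section variation.
Context {R : realType} {N : nat}.
Notation E := 'rV[R]_N.
Variable O : set E.
Implicit Types (mu : set E -> R) (A : set E -> E) (B F : set E).

Lemma meas_variation_ge (V : Type) (nrm : V -> R) (mu : set E -> V) B F :
  (forall v, 0 <= nrm v) -> relcpt_borel O F -> F `<=` B ->
  ((nrm (mu F))%:E <= meas_variation O nrm mu B)%E.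
Proof.
move=> nrm0 rF FB; pose G (k : nat) : set E := if k is 0 then F else set0.
apply: (@le_trans _ _ (\sum_(0 <= k <oo) (nrm (mu (G k)))%:E)%E).
  apply: le_trans (nneseries_lim_ge 1 _) => /=; last by move=> k _ _; rewrite lee_fin.
  by rewrite big_nat1.
apply: ereal_sup_ubound; exists G => //; split.
- apply/trivIsetP => -[|i] [|j] _ _ //= _; rewrite ?set0I ?setI0//.
- by case=> [|k] //=; exact: relcpt0.
- by case=> [|k] //=; exact: sub0set.
Qed.

Lemma meas_variation_set0 (V : Type) (nrm : V -> R) (mu : set E -> V) :
  nrm (mu set0) = 0 -> meas_variation O nrm mu set0 = 0%E.
Proof.
move=> mu0; apply/eqP; rewrite eq_le; apply/andP; split.
  apply: ge_ereal_sup => _ [G [_ _ G0] <-]; rewrite eseries0// => k _ _.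
  have -> : G k = set0 by apply/seteqP; split => //; exact: G0.
  by rewrite mu0.
apply: ereal_sup_ubound; exists (fun=> set0).
  by split=> [|k|k]; [exact: trivIset_set0|exact: relcpt0|exact: sub0set].
by rewrite eseries0// => k _ _; rewrite mu0.
Qed.

Lemma meas_variation_ge0 (V : Type) (nrm : V -> R) (mu : set E -> V) B :
  (forall v, 0 <= nrm v) -> (0 <= meas_variation O nrm mu B)%E.
Proof.
move=> nrm0; apply: le_trans (meas_variation_ge mu nrm0 (relcpt0 O) (@sub0set _ B)).
by rewrite lee_fin.
Qed.

Lemma mpos_le_tv mu B : (mpos O mu B <= tv O mu B)%E.
Proof.
apply: ge_ereal_sup => _ [F [rF FB] <-].
apply: le_trans (meas_variation_ge mu (@normr_ge0 R R) rF FB).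
by rewrite lee_fin ler_norm.
Qed.

Lemma mneg_le_tv mu B : (mneg O mu B <= tv O mu B)%E.
Proof.
apply: ge_ereal_sup => _ [F [rF FB] <-].
apply: le_trans (meas_variation_ge mu (@normr_ge0 R R) rF FB).
by rewrite lee_fin -normrN ler_norm.
Qed.

Lemma mpos_le_vtv A i B : (mpos O (fun F => A F 0%R i) B <= vtv O A B)%E.
Proof.
apply: ge_ereal_sup => _ [F [rF FB] <-].
apply: le_trans (meas_variation_ge A (fun v => sqrtr_ge0 _) rF FB).
by rewrite lee_fin (le_trans (ler_norm _))// ler_enorm.
Qed.

Lemma mneg_le_vtv A i B : (mneg O (fun F => A F 0%R i) B <= vtv O A B)%E.
Proof.
apply: ge_ereal_sup => _ [F [rF FB] <-].
apply: le_trans (meas_variation_ge A (fun v => sqrtr_ge0 _) rF FB).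
by rewrite lee_fin (le_trans (ler_norm _))// normrN ler_enorm.
Qed.

Lemma tv_set0 mu : Mloc O mu -> tv O mu set0 = 0%E.
Proof. by move=> /Mloc0 mu0; rewrite /tv meas_variation_set0// mu0 normr0. Qed.

Lemma vtv_set0 A : vMloc O A -> vtv O A set0 = 0%E.
Proof.
move=> MA; rewrite /vtv meas_variation_set0// /enorm big1 ?sqrtr0// => i _.
by rewrite (Mloc0 (MA i)) expr0n.
Qed.

Lemma tv_sintegrable mu D f : Mloc O mu -> (tv O mu).-integrable D f ->
  sintegrable O mu D f.
Proof.
move=> Mmu itv; have [p pE] := mpos_measure Mmu; have [n nE] := mneg_measure Mmu.
rewrite /sintegrable -pE -nE; split.
  by apply: integrable_le_set (tv_set0 Mmu) _ _ _ _ itv => B _; rewrite pE mpos_le_tv.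
by apply: integrable_le_set (tv_set0 Mmu) _ _ _ _ itv => B _; rewrite nE mneg_le_tv.
Qed.

Lemma vtv_sintegrable A i D f : vMloc O A -> (vtv O A).-integrable D f ->
  sintegrable O (fun F => A F 0 i) D f.
Proof.
move=> MA itv.
have [p pE] := mpos_measure (MA i); have [n nE] := mneg_measure (MA i).
rewrite /sintegrable -pE -nE; split.
  by apply: integrable_le_set (vtv_set0 MA) _ _ _ _ itv => B _; rewrite pE mpos_le_vtv.
by apply: integrable_le_set (vtv_set0 MA) _ _ _ _ itv => B _; rewrite nE mneg_le_vtv.
Qed.

End variation.

(** * Dependence of the integral on the domain *)

Section sint_domain.
Context {R : realType} {N : nat}.
Notation E := 'rV[R]_N.
Variables (O : set E) (oO : open O).
Local Notation measureE := {measure set E -> \bar R}.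
Implicit Types (mu : set E -> R) (D X Y : set E) (f g : E -> \bar R).

Lemma eq_sint_patch mu D D' f g : f \_ D = g \_ D' -> sint O mu D f = sint O mu D' g.
Proof. by rewrite /sint /integral => ->. Qed.

Lemma eq_sint mu D f g : (forall x, D x -> f x = g x) -> sint O mu D f = sint O mu D g.
Proof. by move=> fg; apply/eq_sint_patch/eq_restrictP => x /set_mem/fg. Qed.

Lemma sint_setS mu X Y f : X `<=` Y -> (forall x, Y x -> ~ X x -> f x = 0%E) ->
  sint O mu Y f = sint O mu X f.
Proof.
move=> XY f0; apply: eq_sint_patch; apply/funext => x; rewrite /patch.
have [Xx|Xx] := pselect (X x); first by rewrite !mem_set//; exact: XY.
by rewrite (memNset Xx); case: ifPn => // /set_mem/f0 ->.
Qed.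

Lemma sint0 mu D : Mloc O mu -> sint O mu D (cst 0%E) = 0.
Proof.
move=> Mmu; have [p pE] := mpos_measure Mmu; have [n nE] := mneg_measure Mmu.
by rewrite /sint -pE -nE !integral0 subrr.
Qed.

Lemma sintegrableS mu D D' f : measurable D -> measurable D' -> D' `<=` D ->
  Mloc O mu -> sintegrable O mu D f -> sintegrable O mu D' f.
Proof.
move=> mD mD' DD Mmu.
have [p pE] := mpos_measure Mmu; have [n nE] := mneg_measure Mmu.
rewrite /sintegrable -pE -nE => -[ip iN].
by split; [exact: (integrableS mD)|exact: (integrableS mD)].
Qed.

Lemma sint_setU mu X Y f : Mloc O mu -> measurable X -> measurable Y ->
  X `&` Y = set0 -> sintegrable O mu (X `|` Y) f ->
  sint O mu (X `|` Y) f = sint O mu X f + sint O mu Y f.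
Proof.
move=> Mmu mX mY XY; have mXY := measurableU _ _ mX mY.
have [p pE] := mpos_measure Mmu; have [n nE] := mneg_measure Mmu.
rewrite /sintegrable /sint -pE -nE => -[ip iN].
have mf := measurable_int _ ip.
have XYb : [disjoint X & Y]%classic by apply/disj_set2P.
rewrite !integral_setU//.
have /fineK <- := integrable_fin_num mX (integrableS mXY mX (@subsetUl _ X Y) ip).
have /fineK <- := integrable_fin_num mY (integrableS mXY mY (@subsetUr _ X Y) ip).
have /fineK <- := integrable_fin_num mX (integrableS mXY mX (@subsetUl _ X Y) iN).
have /fineK <- := integrable_fin_num mY (integrableS mXY mY (@subsetUr _ X Y) iN).
by rewrite -!EFinD /=; lra.
Qed.

Definition jordan_finite mu := (mpos O mu O < +oo)%E /\ (mneg O mu O < +oo)%E.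

Lemma Mfin_jordan mu : Mfin O mu -> jordan_finite mu.
Proof.
move=> [_ tvf]; split; apply: le_lt_trans tvf; first exact: mpos_le_tv.
exact: mneg_le_tv.
Qed.

Lemma bounded_sintegrable mu D (h : E -> R) : Mloc O mu -> jordan_finite mu ->
  measurable D -> D `<=` O -> measurable_fun D h -> bounded_on D h ->
  sintegrable O mu D (EFin \o h).
Proof.
move=> Mmu [pf nf] mD DO mh bh; have mO := measurable_open oO.
have [p pE] := mpos_measure Mmu; have [n nE] := mneg_measure Mmu.
rewrite /sintegrable -pE -nE; split; apply: measurable_bounded_integrable => //;
  try exact: bounded_onP.
  by rewrite (le_lt_trans _ pf)// -pE le_measure ?inE.
by rewrite (le_lt_trans _ nf)// -nE le_measure ?inE.
Qed.

Lemma sint_cst1_setD mu D : Mloc O mu -> measurable D -> D `<=` O ->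
  mpos O mu (O `\` D) = 0%E -> mneg O mu (O `\` D) = 0%E ->
  sint O mu O (cst 1%E) = sint O mu D (cst 1%E).
Proof.
move=> Mmu mD DO; have mO := measurable_open oO.
have [p pE] := mpos_measure Mmu; have [n nE] := mneg_measure Mmu.
have H (m : measureE) : m (O `\` D) = 0%E -> m O = m D.
  move=> m0; have mOD : measurable (O `\` D) by exact: measurableD.
  have dis : D `&` (O `\` D) = set0 by rewrite setDE setICA setICr setI0.
  have := measureU m mD mOD dis; rewrite (setDUK DO) => ->.
  by rewrite [X in (_ + X)%E](_ : _ = 0%E) ?adde0.
rewrite /sint -pE -nE => p0 n0.
by rewrite !integral_cst// !mul1e (H p)// (H n).
Qed.

End sint_domain.

(** * The support of a weighted variation *)

Section support.
Context {R : realType} {N : nat}.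
Notation E := 'rV[R]_N.
Variables (O : set E) (oO : open O).
Local Notation measureE := {measure set E -> \bar R}.

(* [m] ranges over the Jordan parts of the components of [A]: the measure g A is
   carried by the support of g |A|. *)
Lemma msupp_null (A : set E -> E) (g w : E -> \bar R) (m : measureE) :
  vMloc O A -> (vtv O A).-integrable O w -> measurable_fun O g ->
  (forall x, O x -> `|g x| <= `|w x|)%E ->
  (forall B, measurable B -> (m B <= vtv O A B)%E) ->
  m (O `&` (~` closure (msupp O (wvtv O g A)) `&` [set x | g x != 0%E])) = 0%E.
Proof.
move=> MA iw mg gw mV; have mO := measurable_open oO.
set S := closure _; pose G := O `&` ~` S.
have oG : open G by apply: openI => //; exact/closed_openC/closed_closure.
have V0 := vtv_set0 MA.
have wfin : (\int[vtv O A]_(x in O) `|w x| < +oo)%E by case/integrableP : iw.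
pose null (F : set E) := forall F', measurable F' -> F' `<=` F ->
  wvtv O g A F' = 0.
(* A point off the closed support has an open neighbourhood of zero variation; on each relatively
   compact Borel subset of it the integral of [g] is 0. A rational cube inside it makes the family
   of such neighbourhoods countable. *)
have nullP x : G x -> exists j, [/\ qcube j x, qccube j `<=` G & null (@qcube R N j)].
  move=> [Ox xS]; have : ~ msupp O (wvtv O g A) x by move/subset_closure.
  move=> /not_andP[//|/existsNP[W /not_implyP[oW /not_implyP[Wx /negP]]]].
  rewrite -leNgt => tv0.
  have [j [xj jWG]] := qcube_basis (openI oW oG) (conj Wx (conj Ox xS)).
  exists j; split => //; first by move=> y /jWG[].
  move=> F mF Fj; have FW : F `<=` W by move=> y /Fj/qcube_ccube/jWG[].
  have rQ : relcpt_borel O (@qccube R N j).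
    by apply: compact_relcpt; [exact: compact_qccube|move=> y /jWG[_ []]].
  have rF : relcpt_borel O F.
    by apply: relcptS rQ => // y /Fj/qcube_ccube.
  have := le_trans (meas_variation_ge (wvtv O g A) (@normr_ge0 R R) rF FW) tv0.
  by rewrite lee_fin normr_le0 => /eqP.
have mgset (P : set (\bar R)) : measurable P -> measurable (O `&` g @^-1` P).
  by move=> mP; exact: mg.
have mzero j : qccube j `<=` G -> null (@qcube R N j) ->
    m.-negligible (qcube j `&` [set x | g x != 0%E]).
  move=> jG nj; have jO : @qcube R N j `<=` O by move=> x /qcube_ccube/jG[].
  have mj : measurable (@qcube R N j) by apply: measurable_open; exact: open_qcube.
  (* The set where [g] is nonzero is exhausted by the sets s g >= 1/(k+1), with s = 1 or s = -1. On
     each of them s g has integral 0, so Chebyshev's inequality gives [vtv] zero there, and [m] is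
     dominated by [vtv]. *)
  have half (s : R) (k : nat) : (s = 1 \/ s = -1) ->
      m.-negligible (qcube j `&` (O `&` g @^-1` [set y | (k.+1%:R^-1)%:E <= s%:E * y]%E)).
    move=> s1; set F := _ `&` _.
    have mF : measurable F.
      apply: measurableI => //; apply: mgset.
      have : measurable_fun setT (fun y : \bar R => (s%:E * y)%E) by exact: measurable_funeM.
      move=> /(_ measurableT `[(k.+1%:R^-1)%:E, +oo[%classic (emeasurable_itv _)).
      rewrite setTI; congr measurable; apply/seteqP; split => y /=.
        by rewrite in_itv /= andbT.
      by rewrite in_itv /= andbT.
    have Fj : F `<=` qcube j by move=> x [].
    have FO : F `<=` O by apply: subset_trans jO.
    have c0 : 0 < (k.+1%:R^-1 : R) by rewrite invr_gt0.
    have h0 x : F x -> (0 <= s%:E * g x)%E.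
      by move=> [_ [_ /=]]; apply: le_trans; rewrite lee_fin ltW.
    have I0 : (\int[vtv O A]_(x in F) (s%:E * g x) = 0)%E.
      (* Finiteness must come from [w]: since [fine] sends +oo to 0, [wvtv] being 0 does not by
         itself make the integral 0. *)
      have Ile : (\int[vtv O A]_(x in F) (s%:E * g x) < +oo)%E.
        apply: le_lt_trans wfin; apply: integral_set_le => // x Fx.
        rewrite (le_trans (lee_abs _))// abseM (_ : `|s%:E|%E = 1%E) ?mul1e.
          exact/gw/FO.
        by case: s1 => ->; rewrite /= ?normrN normr1.
      have Ige := integral_set_ge0 V0 h0.
      have Ifin : (\int[vtv O A]_(x in F) (s%:E * g x))%E \is a fin_num.
        by rewrite ge0_fin_numE.
      have gI := nj F mF Fj; rewrite /wvtv in gI.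
      case: s1 => s1.
        have E1 : (fun x => s%:E * g x)%E = g by apply/funext => x; rewrite s1 mul1e.
        by rewrite E1 in Ifin *; rewrite -(fineK Ifin) gI.
      have E1 : g = (fun x => - (s%:E * g x))%E.
        by apply/funext => x; rewrite s1 mulN1e oppeK.
      rewrite E1 integral_setN// in gI.
      rewrite -(fineK Ifin); congr EFin; apply/eqP; rewrite -oppr_eq0 -fineN.
      exact/eqP.
    have := integral_set_ge V0 c0 mF (@subset_refl _ F) h0
      (fun x Fx => Fx.2.2).
    rewrite I0 pmule_rle0 ?lte_fin// => vF.
    apply/negligibleP => //.
    by apply/eqP; rewrite eq_le measure_ge0 andbT (le_trans (mV _ mF)).
  have arch (y : \bar R) : (0 < y)%E -> exists k : nat, ((k.+1%:R^-1)%:E <= y)%E.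
    case: y => [r|_|//]; last by exists 0%N; exact: leey.
    rewrite lte_fin => r0; have [k _ /(_ k)] := @near_infty_natSinv_lt R (PosNum r0).
    by rewrite /= leqnn => /(_ isT) kr; exists k; rewrite lee_fin ltW.
  apply: (@negligibleS _ _ _ _ (\bigcup_k (
      (qcube j `&` (O `&` g @^-1` [set y | (k.+1%:R^-1)%:E <= 1%:E * y]%E)) `|`
      (qcube j `&` (O `&` g @^-1` [set y | (k.+1%:R^-1)%:E <= (-1)%:E * y]%E))))).
    move=> x [xj /= gx]; have [g0|g0] := leP 0%E (g x).
      have [|k kg] := arch (g x); first by rewrite lt0e gx.
      by exists k => //; left; split=> //; split; [exact: jO|rewrite /= mul1e].
    have [|k kg] := arch (- g x)%E; first by rewrite oppe_gt0.
    by exists k => //; right; split=> //; split; [exact: jO|rewrite /= mulN1e].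
  apply: negligible_bigcup => k; apply: negligibleU; apply: half; first by left.
  by right.
apply: measure_negligible.
  have -> : O `&` (~` S `&` [set x | g x != 0%E]) =
      ~` S `&` (O `&` g @^-1` (~` [set 0%E])).
    apply/seteqP; split=> x /= [h1 [h2 h3]]; split=> //; split=> //.
      exact/eqP.
    by apply/eqP.
  apply: measurableI; last by apply: mgset; apply: measurableC; exact: emeasurable_set1.
  by apply: measurableC; apply: measurable_closed; exact: closed_closure.
apply: (@negligibleS _ _ _ _ (\bigcup_j (if `[< qccube j `<=` G /\ null (@qcube R N j) >]
  then qcube j `&` [set x | g x != 0%E] else set0))).
  move=> x [Ox [xS gx]]; have [j [xj jG nj]] := nullP x (conj Ox xS).
  by exists j => //; rewrite asboolT.
apply: negligible_bigcup => j; case: asboolP => [[jG nj]|_]; first exact: mzero.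
exact: negligible_set0.
Qed.

End support.

(** * The Gauss--Green formula *)

Section gauss_green.
Context {R : realType} {N : nat}.
Notation T := 'rV[R]_N.
Variables (O : set T) (oO : open O) (A : set T -> T).
Hypothesis hA : DMloc O A.
Variables (lam1 lam2 u : T -> R) (E : set T).
Hypothesis hlam2 : borel01 O lam2.
Hypothesis hu : BVspace O A lam1 u.
Hypothesis mE : measurable E.

Local Notation w := (ulam O lam1 u).
Local Notation B := (wmeasure O w A).
Hypothesis hE : BVspace O B lam2 \1_E.
Hypothesis hS : relcpt_in O (msupp O
  (wvtv O (fun x => ulam O lam2 \1_E x * w x)%E A)).

Local Notation divA := (divm O A).
Local Notation P := (pairm O A lam1 u).
Local Notation Q := (pairm O B lam2 \1_E).
Local Notation chi := (trace_indic E lam2).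
Local Notation Ai i := (fun F => A F 0 i).
Local Notation dd i f := ('D_(basis_vec R i) f).

Let mO : measurable O. Proof. exact: measurable_open. Qed.

Let MA i : Mloc O (Ai i). Proof. exact: hA.1. Qed.

Let divA_prop : Mloc O divA /\ represents O divA (distr_div O A).
Proof. by apply: dmeasureP; exact: hA.2. Qed.

(** The chosen measure is only known to be locally finite. Finiteness of its Jordan parts is
    inherited, through uniqueness, from the finite representative that [BVspace] provides. *)
Let P_prop : [/\ Mloc O P, represents O P (pairing O A lam1 u) & jordan_finite O P].
Proof.
have [_ [mu [Mmu rmu]]] := hu.
have [MP rP] : Mloc O P /\ represents O P (pairing O A lam1 u).
  by apply: dmeasureP; exists mu; split => //; exact: Mmu.1.
split=> //; rewrite /jordan_finite.
have [-> ->] := eq_mpos (represents_unique oO MP Mmu.1 rP rmu).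
exact: Mfin_jordan.
Qed.

Let Q_prop : [/\ Mloc O Q, represents O Q (pairing O B lam2 \1_E) & jordan_finite O Q].
Proof.
have [_ [mu [Mmu rmu]]] := hE.
have [MQ rQ] : Mloc O Q /\ represents O Q (pairing O B lam2 \1_E).
  by apply: dmeasureP; exists mu; split => //; exact: Mmu.1.
split=> //; rewrite /jordan_finite.
have [-> ->] := eq_mpos (represents_unique oO MQ Mmu.1 rQ rmu).
exact: Mfin_jordan.
Qed.

Let w_vtv : (vtv O A).-integrable O w. Proof. by have [[]] := hu. Qed.

Let w_Ai i : sintegrable O (Ai i) O w.
Proof. exact: vtv_sintegrable hA.1 w_vtv. Qed.

Let w_divA : sintegrable O divA O w.
Proof. by apply: tv_sintegrable divA_prop.1 _; have [[]] := hu. Qed.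

Let B_prop i : Mloc O (fun F => B F 0 i) /\ forall D f, measurable D -> D `<=` O ->
    measurable_fun D f -> bounded_on D f ->
    [/\ sintegrable O (fun F => B F 0 i) D (EFin \o f),
      sintegrable O (Ai i) D (fun x => w x * (f x)%:E)%E &
      sint O (fun F => B F 0 i) D (EFin \o f) = sint O (Ai i) D (fun x => w x * (f x)%:E)%E].
Proof.
by apply: (sint_weight oO (MA i) (w_Ai i)) => F _; rewrite mxE.
Qed.

(* div(wA) = w div A + (A, Du) *)
Let divB F := sint O divA F w + P F.

Let divB_sint : Mloc O divB /\ forall D f, measurable D -> D `<=` O ->
    measurable_fun D f -> bounded_on D f ->
    sint O divB D (EFin \o f) =
    sint O divA D (fun x => w x * (f x)%:E)%E + sint O P D (EFin \o f).
Proof.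
have [MP _ fP] := P_prop.
have [M1 I1] := @sint_weight _ _ O oO divA (fun F => sint O divA F w) w
  divA_prop.1 w_divA (fun F _ => erefl).
split; first by case: (@sintD _ _ O oO _ _ divB O (cst 0%E) M1 MP (fun F _ => erefl)).
move=> D f mD DO mf bf; have [i1 i2 E1] := I1 D f mD DO mf bf.
have [_ I2] := @sintD _ _ O oO _ _ divB D (EFin \o f) M1 MP (fun F _ => erefl).
have [//|//|//||_ ->] := I2; first exact: bounded_sintegrable.
by rewrite E1.
Qed.

(** By the definition of the pairing the terms with div A cancel; the remaining gradient term is an
    integral against B, as B has density w with respect to A. *)
Let distr_divB : represents O divB (distr_div O B).
Proof.
move=> phi tphi; have [_ rP _] := P_prop.
have mphi : measurable_fun O phi.
  by apply: measurable_funTS; apply: continuous_measurable; exact: test_fun_continuous tphi.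
have bphi : bounded_on O phi by exact: test_fun_bounded tphi.
rewrite divB_sint.2// -rP// /pairing addrA subrr sub0r.
rewrite /distr_div /vint; congr (- _); apply: eq_bigr => i _.
have [_ BI] := B_prop i; have [//|||_ _ ->//] := BI O (dd i phi) mO.
  apply: measurable_funTS; apply: continuous_measurable.
  exact: test_fun_derive_continuous tphi.
exact: test_fun_derive_bounded tphi.
Qed.

Let divm_B F : relcpt_borel O F -> divm O B F = divB F.
Proof.
have [MdB rdB] := dmeasureP (ex_intro _ divB (conj divB_sint.1 distr_divB)).
exact: represents_unique MdB divB_sint.1 rdB distr_divB F.
Qed.

Let ulam_chi x : O x -> ulam O lam2 \1_E x = (chi x)%:E.
Proof. by have [L [LE Lc]] := @lebN_measure R N; exact: (ulam_indic LE Lc). Qed.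

Let mD1 : measurable (density1 E).
Proof. by have [L [LE Lc]] := @lebN_measure R N; exact: (measurable_density1 LE Lc). Qed.

Let mbd : measurable (essbnd E).
Proof. by have [L [LE Lc]] := @lebN_measure R N; exact: (measurable_essbnd LE Lc). Qed.

Let mchi : measurable_fun O chi.
Proof.
apply: measurable_funD; first exact: measurable_indic.
by apply: measurable_funM; [exact: hlam2.1|exact: measurable_indic].
Qed.

Let disj x : density1 E x -> essbnd E x -> False.
Proof. by move=> x1; apply; left. Qed.

Let chi_itv x : O x -> 0 <= chi x <= 1.
Proof.
move=> Ox; have /andP[l0 l1] := hlam2.2 x Ox; rewrite /trace_indic !indicE.
have [x1|x1] := pselect (density1 E x).
  by rewrite mem_set// memNset ?mulr0 ?addr0 ?ler01 ?lexx//; exact: disj.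
rewrite memNset// add0r.
have [x2|x2] := pselect (essbnd E x); first by rewrite mem_set// mulr1 l0.
by rewrite memNset// mulr0 lexx ler01.
Qed.

Let bchi : bounded_on O chi.
Proof. by exists 1 => x /chi_itv/andP[c0 c1]; rewrite ger0_norm. Qed.

Let bounded_chiM h : bounded_on O h -> bounded_on O (fun x => chi x * h x).
Proof.
move=> [M hM]; exists M => x Ox; have /andP[c0 c1] := chi_itv Ox.
by rewrite normrM ger0_norm// (le_trans _ (hM x Ox))// ler_piMl.
Qed.

Let Q_sint phi : test_fun O phi -> sint O Q O (EFin \o phi) =
  - (sint O divA O (fun x => w x * (chi x * phi x)%:E)%E +
     sint O P O (EFin \o (fun x => chi x * phi x))) -
  \sum_(i < N) sint O (Ai i) O (fun x => w x * (chi x * dd i phi x)%:E)%E.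
Proof.
move=> tphi; have [_ rQ _] := Q_prop.
have mphi : measurable_fun O phi.
  by apply: measurable_funTS; apply: continuous_measurable; exact: test_fun_continuous tphi.
have bphi : bounded_on O phi by exact: test_fun_bounded tphi.
apply: etrans (esym (rQ phi tphi)) _; congr (- _ - _).
  rewrite (eq_sint_relcpt _ _ divm_B).
  rewrite (@eq_sint _ _ _ _ _ _ (EFin \o (fun x => chi x * phi x))); last first.
    by move=> x Ox; rewrite ulam_chi.
  rewrite divB_sint.2//; first exact: measurable_funM.
  exact: bounded_chiM.
rewrite /vint; apply: eq_bigr => i _.
rewrite (@eq_sint _ _ _ _ _ _ (EFin \o (fun x => chi x * dd i phi x))); last first.
  by move=> x Ox; rewrite ulam_chi.
have [_ BI] := B_prop i; have [//|||_ _ ->//] := BI O (fun x => chi x * dd i phi x) mO.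
  apply: measurable_funM => //; apply: measurable_funTS; apply: continuous_measurable.
  exact: test_fun_derive_continuous tphi.
by apply: bounded_chiM; exact: test_fun_derive_bounded tphi.
Qed.

Let Q_total : sint O Q O (cst 1%E) =
  - (sint O divA O (fun x => w x * (chi x)%:E)%E + sint O P O (EFin \o chi)).
Proof.
have [MP _ fP] := P_prop; have [MQ _ fQ] := Q_prop.
set S := closure (msupp O (wvtv O (fun x => ulam O lam2 \1_E x * w x)%E A)).
have cS : compact S.
  by apply: bounded_closed_compact; [exact: hS.1|exact: closed_closure].
have [phi [tphi phi01 phi1 dphi0]] := cutoff_exists oO cS hS.2.
have mphi k : measurable_fun O (phi k).
  by apply: measurable_funTS; apply: continuous_measurable; exact: test_fun_continuous (tphi k).
have nphi k x : `|phi k x| <= 1.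
  by have /andP[p0 p1] := phi01 k x; rewrite ger0_norm.
have mw : measurable_fun O w by case/integrableP : w_vtv.
(* On [S] the gradient of the cutoff is 0. Off [S] the product of the two traces is 0 almost
   everywhere for any measure dominated by [vtv O A], in particular for the Jordan parts of the
   components of [A]. *)
have zero k i : sint O (Ai i) O (fun x => w x * (chi x * dd i (phi k) x)%:E)%E = 0.
  set g := (fun x => ulam O lam2 \1_E x * w x)%E.
  have gE x : O x -> g x = ((chi x)%:E * w x)%E by move=> Ox; rewrite /g ulam_chi.
  have mg : measurable_fun O g.
    apply: (eq_measurable_fun (fun x => (chi x)%:E * w x)%E).
      by move=> x /set_mem/gE ->.
    by apply: emeasurable_funM => //; exact/measurable_EFinP.
  have gw x : O x -> (`|g x| <= `|w x|)%E.
    move=> Ox; rewrite gE// abseM; have /andP[c0 c1] := chi_itv Ox.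
    by rewrite -[leRHS]mul1e lee_wpmul2r// lee_fin ger0_norm.
  have null (m : {measure set T -> \bar R}) :
      (forall F, measurable F -> (m F <= vtv O A F)%E) ->
      (\int[m]_(x in O) (w x * (chi x * dd i (phi k) x)%:E) = 0)%E.
    move=> mV; have N0 := msupp_null oO hA.1 w_vtv mg gw mV.
    set X := O `&` _ in N0.
    have f0 x : O x -> ~ X x -> (w x * (chi x * dd i (phi k) x)%:E = 0)%E.
      move=> Ox nX; have [Sx|Sx] := pselect (S x).
        by rewrite dphi0// mulr0 mule0.
      have g0 : g x = 0%E.
        by apply/eqP/negPn/negP => gx; apply: nX; split => //; split.
      rewrite EFinM muleA [(w x * _)%E]muleC -gE// g0 mul0e//.
    have mX : measurable X.
      have -> : X = ~` S `&` (O `&` g @^-1` (~` [set 0%E])).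
        apply/seteqP; split=> x /= [h1 [h2 h3]]; split=> //; split=> //.
          exact/eqP.
        by apply/eqP.
      apply: measurableI.
        by apply: measurableC; apply: measurable_closed; exact: closed_closure.
      by apply: mg => //; apply: measurableC; exact: emeasurable_set1.
    have mf : measurable_fun O (fun x => w x * (chi x * dd i (phi k) x)%:E)%E.
      apply: emeasurable_funM => //; apply/measurable_EFinP.
      apply: measurable_funM => //; apply: measurable_funTS; apply: continuous_measurable.
      exact: test_fun_derive_continuous (tphi k).
    have XO : X `<=` O by move=> x [].
    rewrite (_ : integral m O _ = (\int[m]_(x in X) (w x * (chi x * dd i (phi k) x)%:E))%E).
      by rewrite null_set_integral//; exact: measurable_funS mf.
    rewrite integral_mkcond [RHS]integral_mkcond; congr (integral _ _ _).
    apply/funext => x; rewrite /patch; have [Xx|Xx] := pselect (X x).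
      by rewrite !mem_set//; exact: XO.
    by rewrite (memNset Xx); case: ifPn => // /set_mem/f0 ->.
  have [p pE] := mpos_measure (MA i); have [n nE] := mneg_measure (MA i).
  rewrite /sint -pE -nE !null ?subrr// => F _; rewrite ?pE ?nE.
    exact: mneg_le_vtv.
  exact: mpos_le_vtv.
have Qk k : sint O Q O (EFin \o phi k) =
    - (sint O divA O (fun x => w x * (chi x * phi k x)%:E)%E +
       sint O P O (EFin \o (fun x => chi x * phi k x))).
  apply: etrans (Q_sint (tphi k)) _.
  by rewrite [X in _ - X]big1 ?subr0// => i _; exact: zero.
(* The constant 1 is the majorant for both pairings, since they are finite. For div A the majorant
   is [w]. *)
have i1 mu : Mloc O mu -> jordan_finite O mu -> sintegrable O mu O (EFin \o cst 1).
  move=> Mmu fmu; apply: bounded_sintegrable => //.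
  by exists 1 => x _; rewrite normr1.
have phiE x : O x -> \forall k \near \oo, phi k x = 1 by exact: phi1.
have [||_ cQ] := @sint_dominated _ _ O Q O (fun k => EFin \o phi k) (cst 1%E) _
    MQ mO (i1 _ MQ fQ) (fun k => (measurable_EFinP _ _).2 (mphi k)).
- by move=> k x _; rewrite /= lee_fin normr1.
- by move=> x Ox; apply: cvg_near_cst; apply: filterS (phi1 x Ox) => k /= ->.
have [||_ cP] := @sint_dominated _ _ O P O
    (fun k => EFin \o (fun x => chi x * phi k x)) (EFin \o chi) _
    MP mO (i1 _ MP fP)
    (fun k => (measurable_EFinP _ _).2 (measurable_funM mchi (mphi k))).
- move=> k x Ox; have /andP[c0 c1] := chi_itv Ox.
  rewrite /= lee_fin normr1 normrM ger0_norm// -[leRHS]mul1r.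
  by rewrite ler_pM.
- by move=> x Ox; apply: cvg_near_cst; apply: filterS (phi1 x Ox) => k /= ->; rewrite mulr1.
have [|||_ cA] := @sint_dominated _ _ O divA O
    (fun k x => w x * (chi x * phi k x)%:E)%E (fun x => w x * (chi x)%:E)%E _
    divA_prop.1 mO w_divA.
- move=> k; apply: emeasurable_funM => //; apply/measurable_EFinP.
  exact: measurable_funM.
- move=> k x Ox; have /andP[c0 c1] := chi_itv Ox.
  rewrite abseM -[leRHS]mule1 lee_wpmul2l// lee_fin normrM ger0_norm//.
  by rewrite -[leRHS]mul1r ler_pM.
- by move=> x Ox; apply: cvg_near_cst; apply: filterS (phi1 x Ox) => k /= ->; rewrite mulr1.
have c := cvgN (cvgD cA cP).
have c2 : (fun k => sint O Q O (EFin \o phi k)) @ \oo -->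
    - (sint O divA O (fun x => w x * (chi x)%:E)%E + sint O P O (EFin \o chi)).
  by rewrite (funext Qk); exact: c.
exact: (cvg_unique _ cQ c2).
Qed.

(** If chi is 0 on the cube, both terms of the pairing vanish. If chi is 1, the pairing with a test
    function on the cube is minus the integral of that function against div B, minus the integral of
    its gradient against B; this is 0 by the definition of the distributional divergence. *)
Let Q_local j : qccube j `<=` O ->
  (@qcube R N j `<=` density1 (~` E) \/ @qcube R N j `<=` density1 E) ->
  mpos O Q (qcube j) = 0%E /\ mneg O Q (qcube j) = 0%E.
Proof.
move=> jO jE; have [MQ rQ _] := Q_prop.
have QO : @qcube R N j `<=` O := subset_trans (@qcube_ccube R N j) jO.
apply: (vanish_open oO MQ (@open_qcube _ _ j) QO) => phi tphi.
have tO := test_funS QO tphi; rewrite -rQ// /pairing.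
have [L [LE Lc]] := @lebN_measure R N.
have phi0 x : ~ qcube j x -> phi x = 0 by exact: test_fun_eq0 tphi.
have dphi0 i x : ~ qcube j x -> dd i phi x = 0.
  move=> xj; apply/eqP/negP => /negP /derive_support h; apply: xj.
  by have [_ _] := tphi; exact.
have chiE : (forall x, qcube j x -> chi x = 0) \/ (forall x, qcube j x -> chi x = 1).
  case: jE => jE; [left|right] => x /jE xE; rewrite /trace_indic !indicE.
    rewrite memNset ?memNset ?mulr0 ?addr0//; first by apply; right.
    by move=> x1; exact: (density1_disjoint LE Lc mE x1 xE).
  by rewrite mem_set// memNset ?mulr0 ?addr0//; exact: disj.
case: chiE => chiE.
  rewrite (@eq_sint _ _ _ _ _ _ (cst 0%E)); last first.
    move=> x Ox; rewrite ulam_chi//; have [/chiE ->|/phi0 ->] := pselect (qcube j x).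
      by rewrite mul0e.
    by rewrite mule0.
  rewrite sint0 ?oppr0 ?sub0r; last first.
    by have [] := dmeasureP (ex_intro _ divB (conj divB_sint.1 distr_divB)).
  rewrite /vint big1 ?oppr0// => i _.
  rewrite (@eq_sint _ _ _ _ _ _ (cst 0%E)) ?sint0//; first exact: (B_prop i).1.
  move=> x Ox; rewrite ulam_chi//; have [/chiE ->|/dphi0 ->] := pselect (qcube j x).
    by rewrite mul0e.
  by rewrite mule0.
rewrite (@eq_sint _ _ _ _ _ _ (EFin \o phi)); last first.
  move=> x Ox; rewrite ulam_chi//; have [/chiE ->|/phi0 xj] := pselect (qcube j x).
    by rewrite mul1e.
  by rewrite /= xj mule0.
rewrite (eq_sint_relcpt _ _ divm_B) -distr_divB// /distr_div opprK.
apply/eqP; rewrite subr_eq0; apply/eqP; apply: eq_bigr => i _.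
apply: eq_sint => x Ox; rewrite ulam_chi//.
have [/chiE ->|/(dphi0 i) xj] := pselect (qcube j x); first by rewrite mul1e.
by rewrite /= xj mule0.
Qed.

Let mbndm : measurable (bndm E).
Proof.
have [L [LE Lc]] := @lebN_measure R N.
rewrite -[bndm E]setCK; apply: measurableC; apply: measurable_open.
apply: open_from_nbhs => x /(bndm_local LE Lc mE)[W [oW Wx Wb _]].
apply: filterS (open_nbhs_nbhs (conj oW Wx)) => y Wy yb.
by have : (W `&` bndm E) y by []; rewrite Wb.
Qed.

(** By [bndm_local], rational cubes to which [Q_local] applies cover the part of [O] outside
    [bndm E]. They are countably many null sets for both Jordan parts. *)
Let Q_bndm : sint O Q O (cst 1%E) = sint O Q (bndm E `&` O) (cst 1%E).
Proof.
have [MQ _ _] := Q_prop; have [L [LE Lc]] := @lebN_measure R N.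
pose good j := qccube j `<=` O /\
  (@qcube R N j `<=` density1 (~` E) \/ @qcube R N j `<=` density1 E).
have cov : O `\` (bndm E `&` O) `<=`
    \bigcup_j (if `[< good j >] then @qcube R N j else set0).
  move=> x [Ox xb]; have [|W [oW Wx _ WE]] := bndm_local LE Lc mE (x := x).
    by move=> b; apply: xb.
  have [j [xj jW]] := qcube_basis (openI oW oO) (conj Wx Ox).
  exists j => //; rewrite asboolT//; split; first by move=> y /jW[].
  have jW' : qcube j `<=` W by move=> y /qcube_ccube/jW[].
  by case: WE => WE; [left|right]; exact: subset_trans WE.
have mOb : measurable (O `\` (bndm E `&` O)).
  by apply: measurableD => //; exact: measurableI.
have null (m : {measure set T -> \bar R}) : (forall j, good j -> m (qcube j) = 0%E) ->
    m (O `\` (bndm E `&` O)) = 0%E.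
  move=> mj; apply: measure_negligible => //; apply: negligibleS cov _.
  apply: negligible_bigcup => j; case: asboolP => [/mj j0|_]; last exact: negligible_set0.
  by apply/negligibleP => //; apply: measurable_open; exact: open_qcube.
have [p pE] := mpos_measure MQ; have [n nE] := mneg_measure MQ.
apply: (sint_cst1_setD oO MQ).
- exact: measurableI.
- exact: subIsetr.
- by rewrite -pE; apply: null => j [jO jE]; rewrite pE; have [] := Q_local jO jE.
- by rewrite -nE; apply: null => j [jO jE]; rewrite nE; have [] := Q_local jO jE.
Qed.

Let split_chi mu (f g : T -> \bar R) : Mloc O mu -> sintegrable O mu O f ->
  (forall x, density1 E x -> f x = g x) ->
  (forall x, O x -> ~ density1 E x -> ~ essbnd E x -> f x = 0%E) ->
  sint O mu O f = sint O mu (density1 E `&` O) g + sint O mu (essbnd E `&` O) f.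
Proof.
move=> Mmu fi fg f0; set X := density1 E `&` O; set Y := essbnd E `&` O.
have XYO : X `|` Y `<=` O by move=> x [[]|[]].
have mX : measurable X by exact: measurableI.
have mY : measurable Y by exact: measurableI.
rewrite (@sint_setS _ _ O mu _ _ f XYO); last first.
  move=> x Ox /not_orP[x1 x2]; apply: f0 => // xx; first by apply: x1.
  by apply: x2.
rewrite sint_setU//.
- by congr (_ + _); apply: eq_sint => x [/fg].
- by rewrite -subset0 => x [[x1 _] [x2 _]]; exact: disj x2.
- by apply: sintegrableS fi => //; exact: measurableU.
Qed.

Lemma gauss_green :
  sint O divA (density1 E `&` O) w
  + sint O divA (essbnd E `&` O) (fun x => (lam2 x)%:E * w x)%E
  + sint O P (density1 E `&` O) (cst 1%E)
  + sint O P (essbnd E `&` O) (EFin \o lam2)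
  = - sint O Q (bndm E `&` O) (cst 1%E).
Proof.
have [MP _ fP] := P_prop.
have chi1 x : density1 E x -> chi x = 1.
  move=> x1; rewrite /trace_indic !indicE mem_set// memNset ?mulr0 ?addr0//.
  exact: disj.
have chi2 x : essbnd E x -> chi x = lam2 x.
  move=> x2; rewrite /trace_indic !indicE (mem_set x2) memNset ?mulr1 ?add0r//.
  by move=> x1; exact: disj x2.
have chi0 x : ~ density1 E x -> ~ essbnd E x -> chi x = 0.
  by move=> x1 x2; rewrite /trace_indic !indicE !memNset// mulr0 addr0.
have iA : sintegrable O divA O (fun x => w x * (chi x)%:E)%E.
  have [_ I1] := @sint_weight _ _ O oO divA (fun F => sint O divA F w) w
    divA_prop.1 w_divA (fun F _ => erefl).
  by have [] := I1 O chi mO (@subset_refl _ O) mchi bchi.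
have iP : sintegrable O P O (EFin \o chi) by exact: bounded_sintegrable.
have sA : sint O divA O (fun x => w x * (chi x)%:E)%E =
    sint O divA (density1 E `&` O) w
    + sint O divA (essbnd E `&` O) (fun x => w x * (chi x)%:E)%E.
  apply: split_chi divA_prop.1 iA _ _ => [x x1|x _ x1 x2].
    by rewrite chi1// mule1.
  by rewrite chi0// mule0.
have sP : sint O P O (EFin \o chi) =
    sint O P (density1 E `&` O) (cst 1%E) + sint O P (essbnd E `&` O) (EFin \o chi).
  apply: split_chi MP iP _ _ => [x x1|x _ x1 x2]; first by rewrite /= chi1.
  by rewrite /= chi0.
have eA : sint O divA (essbnd E `&` O) (fun x => (lam2 x)%:E * w x)%E =
    sint O divA (essbnd E `&` O) (fun x => w x * (chi x)%:E)%E.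
  by apply: eq_sint => x [x2 _]; rewrite chi2// muleC.
have eP : sint O P (essbnd E `&` O) (EFin \o lam2) =
    sint O P (essbnd E `&` O) (EFin \o chi).
  by apply: eq_sint => x [x2 _]; rewrite /= chi2.
have alg (a b b' c d d' X Y q q' : R) : X = a + b' -> Y = c + d' -> b = b' -> d = d' ->
    q = - (X + Y) -> q = q' -> a + b + c + d = - q'.
  by move=> -> -> -> -> -> <-; rewrite opprK addrA.
exact: alg sA sP eA eP Q_total Q_bndm.
Qed.

Lemma gauss_green_lam0 : (forall x, lam2 x = 0) ->
  sint O divA (density1 E `&` O) w + sint O P (density1 E `&` O) (cst 1%E)
  = - sint O Q (bndm E `&` O) (cst 1%E).
Proof.
move=> l0; have [MP _ _] := P_prop.
have eA : sint O divA (essbnd E `&` O) (fun x => (lam2 x)%:E * w x)%E = 0.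
  apply: etrans (sint0 (essbnd E `&` O) divA_prop.1).
  by apply: eq_sint => x _; rewrite l0 mul0e.
have eP : sint O P (essbnd E `&` O) (EFin \o lam2) = 0.
  apply: etrans (sint0 (essbnd E `&` O) MP).
  by apply: eq_sint => x _; rewrite /= l0.
have alg (a b c d q : R) : b = 0 -> d = 0 -> a + b + c + d = q -> a + c = q.
  by move=> -> -> <-; rewrite !addr0.
exact: alg eA eP gauss_green.
Qed.

Lemma gauss_green_lam1 : (forall x, lam2 x = 1) ->
  sint O divA ((density1 E `|` essbnd E) `&` O) w
  + sint O P ((density1 E `|` essbnd E) `&` O) (cst 1%E)
  = - sint O Q (bndm E `&` O) (cst 1%E).
Proof.
move=> l1; have [MP _ fP] := P_prop.
have mX : measurable (density1 E `&` O) by exact: measurableI.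
have mY : measurable (essbnd E `&` O) by exact: measurableI.
have mXY : measurable (density1 E `&` O `|` essbnd E `&` O) by exact: measurableU.
have XYO : density1 E `&` O `|` essbnd E `&` O `<=` O by move=> x [[]|[]].
have XY : density1 E `&` O `&` (essbnd E `&` O) = set0.
  by rewrite -subset0 => x [[x1 _] [x2 _]]; exact: disj x2.
have sA : sint O divA ((density1 E `|` essbnd E) `&` O) w =
    sint O divA (density1 E `&` O) w + sint O divA (essbnd E `&` O) w.
  rewrite setIUl; apply: (sint_setU divA_prop.1 mX mY XY).
  exact: sintegrableS mO mXY XYO divA_prop.1 w_divA.
have sP : sint O P ((density1 E `|` essbnd E) `&` O) (cst 1%E) =
    sint O P (density1 E `&` O) (cst 1%E) + sint O P (essbnd E `&` O) (cst 1%E).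
  rewrite setIUl; apply: (sint_setU MP mX mY XY).
  apply: (@bounded_sintegrable _ _ O oO P _ (cst 1) MP fP mXY XYO) => //.
  by exists 1 => x _; rewrite normr1.
have eA : sint O divA (essbnd E `&` O) w =
    sint O divA (essbnd E `&` O) (fun x => (lam2 x)%:E * w x)%E.
  by apply: eq_sint => x _; rewrite l1 mul1e.
have eP : sint O P (essbnd E `&` O) (cst 1%E) = sint O P (essbnd E `&` O) (EFin \o lam2).
  by apply: eq_sint => x _; rewrite /= l1.
have alg (X Y a b b' c d d' q : R) : X = a + b' -> Y = c + d' -> b' = b -> d' = d ->
    a + b + c + d = q -> X + Y = q.
  by move=> -> -> -> -> <-; rewrite !addrA.
exact: alg sA sP eA eP gauss_green.
Qed.

End gauss_green.

Theorem theorem8p6 (R : realType) (N : nat) (hN : (0 < N)%N)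
  (Omega : set 'rV[R]_N) (oO : open Omega) (O0 : Omega !=set0)
  (A : set 'rV[R]_N -> 'rV[R]_N) (hA : DMloc Omega A) :
  (forall (lam1 lam2 u : 'rV[R]_N -> R) (E : set 'rV[R]_N),
     borel01 Omega lam1 -> borel01 Omega lam2 ->
     BVspace Omega A lam1 u ->
     measurable E -> E `<=` Omega ->
     BVspace Omega (wmeasure Omega (ulam Omega lam1 u) A) lam2 \1_E ->
     relcpt_in Omega (msupp Omega
       (wvtv Omega (fun x => ulam Omega lam2 \1_E x * ulam Omega lam1 u x)%E A)) ->
     sint Omega (divm Omega A) (density1 E `&` Omega) (ulam Omega lam1 u)
     + sint Omega (divm Omega A) (essbnd E `&` Omega)
         (fun x => (lam2 x)%:E * ulam Omega lam1 u x)%E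
     + sint Omega (pairm Omega A lam1 u) (density1 E `&` Omega) (cst 1%E)
     + sint Omega (pairm Omega A lam1 u) (essbnd E `&` Omega) (EFin \o lam2)
     = - sint Omega (pairm Omega (wmeasure Omega (ulam Omega lam1 u) A) lam2 \1_E)
           (bndm E `&` Omega) (cst 1%E))
  /\
  (forall (lam u : 'rV[R]_N -> R) (E : set 'rV[R]_N),
     borel01 Omega lam ->
     BVspace Omega A lam u ->
     measurable E -> E `<=` Omega ->
     BVspace Omega (wmeasure Omega (ulam Omega lam u) A) (cst 0) \1_E ->
     relcpt_in Omega (msupp Omega
       (wvtv Omega (fun x => uminus Omega \1_E x * ulam Omega lam u x)%E A)) ->
     sint Omega (divm Omega A) (density1 E `&` Omega) (ulam Omega lam u)
     + sint Omega (pairm Omega A lam u) (density1 E `&` Omega) (cst 1%E)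
     = - sint Omega (pairm Omega (wmeasure Omega (ulam Omega lam u) A) (cst 0) \1_E)
           (bndm E `&` Omega) (cst 1%E))
  /\
  (forall (lam u : 'rV[R]_N -> R) (E : set 'rV[R]_N),
     borel01 Omega lam ->
     BVspace Omega A lam u ->
     measurable E -> E `<=` Omega ->
     BVspace Omega (wmeasure Omega (ulam Omega lam u) A) (cst 1) \1_E ->
     relcpt_in Omega (msupp Omega
       (wvtv Omega (fun x => uplus Omega \1_E x * ulam Omega lam u x)%E A)) ->
     sint Omega (divm Omega A) ((density1 E `|` essbnd E) `&` Omega) (ulam Omega lam u)
     + sint Omega (pairm Omega A lam u) ((density1 E `|` essbnd E) `&` Omega) (cst 1%E)
     = - sint Omega (pairm Omega (wmeasure Omega (ulam Omega lam u) A) (cst 1) \1_E)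
           (bndm E `&` Omega) (cst 1%E)).
Proof.
split; [|split].
- by move=> lam1 lam2 u E _ hl2 hu mE _ hE hS; exact: gauss_green.
(* The support hypothesis is given with the lower trace of the indicator; it is converted to the
   trace with weight 0 that the general formula uses. *)
- move=> lam u E _ hu mE _ hE; rewrite -ulam_indic_cst0 => hS.
  apply: (gauss_green_lam0 oO hA _ hu mE hE hS) => //.
  by split=> [|x _]; [exact: measurable_cst|rewrite lexx ler01].
- move=> lam u E _ hu mE _ hE; rewrite -ulam_indic_cst1 => hS.
  apply: (gauss_green_lam1 oO hA _ hu mE hE hS) => //.
  by split=> [|x _]; [exact: measurable_cst|rewrite lexx ler01].
Qed.
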